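(* Let $H_1,\dots,H_k$ be finite simple graphs, where $H_1$ is the complete graph on two vertices (a single edge) and each $H_i$ contains at least one edge, and let $e(H_i)$ be the number of edges of $H_i$. Let $\beta_1,\dots,\beta_k$ be real numbers such that $$\sum_{i=2}^k|\beta_i|\,e(H_i)\bigl(e(H_i)-1\bigr)<2.$$ Let $T(h)=\sum_{i=1}^k\beta_i\,t(H_i,h)$ for $h\in\mathcal{W}$, let $\psi_n=\frac1{n^2}\log\sum_{G\in\mathcal{G}_n}e^{n^2T(\widetilde{G})}$, and let $G_n$ be a random element of $\mathcal{G}_n$ with $\mathbb{P}(G_n=G)=e^{n^2(T(\widetilde{G})-\psi_n)}$. Let $\ell(u)=\sum_{i=1}^k\beta_iu^{e(H_i)}-I(u)$ for $u\in[0,1]$ and let $U\subseteq[0,1]$ be the set of maximizers of $\ell$ on $[0,1]$. Then: (1) $\lim_{n\to\infty}\psi_n=\sup_{0\le u\le1}\ell(u)$, and each maximizer $h$ of $T(h)-I(h)$ over $\mathcal{W}$ is (almost everywhere) a constant function, where the constant belongs to $U$. (2) If $U=\{u^*\}$ is a single point, then $\widetilde{G}_n$ converges to (the class $\widetilde{u^*}$ of) the constant function $u^*$ in probability as $n\to\infty$, in the metric $\delta_\Box$. (3) Even if the maximizer of $\ell$ is not unique, the set $U$ is finite and $\min_{u\in U}\delta_\Box(\widetilde{G}_n,\widetilde{u})\to0$ in probability as $n\to\infty$, where $\widetilde{u}$ denotes the image in $\widetilde{\mathcal{W}}$ of the constant function $u$.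
   Context: $\mathcal{G}_n$ is the set of all simple graphs (undirected, no loops, no multiple edges) on the vertex set $\{1,\dots,n\}$. $\mathcal{W}$ is the set of all measurable functions $h:[0,1]^2\to[0,1]$ with $h(x,y)=h(y,x)$. The cut distance on $\mathcal{W}$ is $d_\Box(f,g)=\sup_{S,A\subseteq[0,1]}\left|\int_{S\times A}[f(x,y)-g(x,y)]\,dx\,dy\right|$ (supremum over measurable sets). Let $\Sigma$ be the set of measure-preserving bijections $\sigma:[0,1]\to[0,1]$ and write $g_\sigma(x,y)=g(\sigma x,\sigma y)$. For $g\in\mathcal{W}$, $\widetilde{g}$ denotes the closure in $(\mathcal{W},d_\Box)$ of the orbit $\{g_\sigma:\sigma\in\Sigma\}$; $\widetilde{\mathcal{W}}$ is the resulting quotient space, with metric $\delta_\Box(\widetilde{f},\widetilde{g})=\inf_{\sigma\in\Sigma}d_\Box(f,g_\sigma)$. For a finite simple graph $H$ with vertex set $\{1,\dots,m\}$ and edge set $E(H)$, and $h\in\mathcal{W}$, $t(H,h)=\int_{[0,1]^m}\prod_{\{i,j\}\in E(H)}h(x_i,x_j)\,dx_1\cdots dx_m$. For a simple graph $G$ on $\{1,\dots,n\}$, $f^G\in\mathcal{W}$ is defined by $f^G(x,y)=1$ if $(\lceil nx\rceil,\lceil ny\rceil)$ is an edge of $G$ and $0$ otherwise; $\widetilde{G}:=\widetilde{f^G}$, and $T(\widetilde{G})=T(f^G)=\sum_{i=1}^k\beta_it(H_i,G)$, where $t(H,G)=|\hom(H,G)|/|V(G)|^{|V(H)|}=t(H,f^G)$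 is the homomorphism density ($|\hom(H,G)|$ is the number of edge-preserving maps $V(H)\to V(G)$). $I(u)=\frac12u\log u+\frac12(1-u)\log(1-u)$ for $u\in[0,1]$ ($0\log0=0$), and $I(h)=\iint_{[0,1]^2}I(h(x,y))\,dx\,dy$ for $h\in\mathcal{W}$. *)

(* Defs.v *)
From HB Require Import structures.
From mathcomp Require Import all_boot all_order all_algebra.
From mathcomp Require Import generic_quotient ring lra.
From mathcomp Require Import all_classical all_reals all_analysis.
From mathcomp Require Import measurable_realfun.

Set Implicit Arguments.
Unset Strict Implicit.
Unset Printing Implicit Defensive.

Import Order.TTheory GRing.Theory Num.Theory.
Import numFieldNormedType.Exports.

Local Open Scope classical_set_scope.
Local Open Scope ring_scope.

(* A graph on 'I_n is stored as the set of ordered pairs (i, j) of adjacent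
   vertices; vertex i : 'I_n stands for i.+1 in {1, ..., n}. *)
Definition is_simple n (E : {set 'I_n * 'I_n}) :=
  [forall i, (i, i) \notin E] &&
  [forall i, forall j, ((i, j) \in E) == ((j, i) \in E)].

Record sgraph n := SGraph {
  adj :> {set 'I_n * 'I_n};
  adj_simple : is_simple adj }.

HB.instance Definition _ n := [isSub for @adj n].
HB.instance Definition _ n := [Finite of sgraph n by <:].

(* The undirected edge {i, j} is represented by the pair (i, j) with i < j. *)
Definition edges n (G : sgraph n) : {set 'I_n * 'I_n} :=
  [set p in adj G | (p.1 < p.2)%N].

Definition num_edges n (G : sgraph n) : nat := #|edges G|.

Lemma complete_simple n :
  is_simple [set p : 'I_n * 'I_n | p.1 != p.2].
Proof.
apply/andP; split; first by apply/forallP => i; rewrite inE eqxx.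
by apply/forallP => i; apply/forallP => j; rewrite !inE /= (eq_sym j) eqxx.
Qed.

Definition complete_graph n : sgraph n := SGraph (complete_simple n).

Lemma product_sigma_finite d1 d2 (T1 : measurableType d1)
    (T2 : measurableType d2) (R : realType)
    (m1 : {sigma_finite_measure set T1 -> \bar R})
    (m2 : {sigma_finite_measure set T2 -> \bar R}) :
  sigma_finite setT (m1 \x m2)%E.
Proof.
have /sigma_finiteP[F [TF ndF Foo]] := sigma_finiteT m1.
have /sigma_finiteP[G [TG ndG Goo]] := sigma_finiteT m2.
exists (fun n => F n `*` G n).
  rewrite -setXTT TF TG predeqE => -[x y]; split.
    move=> [/= [n _ Fnx] [k _ Gky]]; exists (maxn n k) => //; split.
    - by move: x Fnx; exact/subsetPset/ndF/leq_maxl.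
    - by move: y Gky; exact/subsetPset/ndG/leq_maxr.
  by move=> [n _ []/= ? ?]; split; exists n.
move=> k; have [mF Fk] := Foo k; have [mG Gk] := Goo k.
split; first exact: measurableX.
by rewrite product_measure1E// lte_mul_pinfty// ge0_fin_numE.
Qed.

Section LebesguePowers.
Variable R : realType.
Local Notation mR := (measurableTypeR R).
Local Notation mu := (@lebesgue_measure R).

Definition cons_tuple n (z : mR * n.-tuple mR) : n.+1.-tuple mR :=
  [tuple of z.1 :: z.2].

Lemma measurable_cons_tuple n : measurable_fun setT (@cons_tuple n).
Proof. exact: measurable_cons. Qed.

Lemma cons_tuple_sigma_finite n
    (nu : {sigma_finite_measure set (n.-tuple mR) -> \bar R}) :
  sigma_finite setT (pushforward (mu \x nu)%E (@cons_tuple n)).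
Proof.
have [F FT Foo] := product_sigma_finite mu nu.
pose unc (x : n.+1.-tuple mR) : mR * n.-tuple mR :=
  (thead x, [tuple of behead x]).
have munc : measurable_fun setT unc.
  apply: measurable_fun_pair; last exact: measurable_behead.
  exact: measurable_tnth.
have uncK z : unc (cons_tuple z) = z.
  case: z => a t; rewrite /unc /cons_tuple /=; congr pair.
  by apply/val_inj.
exists (fun k => unc @^-1` F k).
  by rewrite -preimage_bigcup -FT preimage_setT.
move=> k; have [mFk Fkoo] := Foo k; split.
  by rewrite -[X in measurable X]setTI; exact: munc.
rewrite /pushforward (_ : _ @^-1` _ = F k) //.
by apply/funext => z; rewrite /preimage /= uncK.
Qed.

Section LebesgueCons.
Variables (n : nat) (nu : {sigma_finite_measure set (n.-tuple mR) -> \bar R}).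

Definition lebesgue_cons : set (n.+1.-tuple mR) -> \bar R :=
  pushforward (mu \x nu)%E (@cons_tuple n).

Let lebesgue_cons0 : lebesgue_cons set0 = 0%E.
Proof. by rewrite /lebesgue_cons /pushforward preimage_set0 measure0. Qed.

Let lebesgue_cons_ge0 A : (0 <= lebesgue_cons A)%E.
Proof. by rewrite /lebesgue_cons /pushforward measure_ge0. Qed.

Let lebesgue_cons_sigma_additive : semi_sigma_additive lebesgue_cons.
Proof.
move=> F mF tF mUF.
have mp A : measurable A -> measurable (@cons_tuple n @^-1` A).
  by move=> mA; rewrite -[X in measurable X]setTI; exact: measurable_cons_tuple.
rewrite /lebesgue_cons /pushforward preimage_bigcup.
apply: measure_semi_sigma_additive => [k||]; first exact: mp.
- apply/trivIsetP => /= i j _ _ ij; rewrite -preimage_setI.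
  by move/trivIsetP : tF => /(_ _ _ _ _ ij) ->//; rewrite preimage_set0.
- by rewrite -preimage_bigcup; exact: mp.
Qed.

HB.instance Definition _ := isMeasure.Build _ _ _ lebesgue_cons
  lebesgue_cons0 lebesgue_cons_ge0 lebesgue_cons_sigma_additive.

HB.instance Definition _ := Measure_isSigmaFinite.Build _ _ _ lebesgue_cons
  (cons_tuple_sigma_finite nu).

End LebesgueCons.

(* Lebesgue measure on R^n: the iterated product of the one-dimensional one. *)
Fixpoint lebesgue_tuple n : {sigma_finite_measure set (n.-tuple mR) -> \bar R} :=
  match n with
  | 0 => (\d_([tuple] : 0.-tuple mR))%R
  | n'.+1 => lebesgue_cons (lebesgue_tuple n')
  end.

End LebesguePowers.

Definition unit_itv (R : realType) : set (measurableTypeR R) :=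
  [set` `[0, 1]].

Definition unit_square (R : realType) :
    set (measurableTypeR R * measurableTypeR R) :=
  @unit_itv R `*` @unit_itv R.

Definition unit_cube (R : realType) n : set (n.-tuple (measurableTypeR R)) :=
  [set x | forall i, unit_itv (tnth x i)].

Arguments unit_itv : clear implicits.
Arguments unit_square : clear implicits.
Arguments unit_cube : clear implicits.

(* Elements of W are functions on [0,1]^2; they are represented by total
   functions on R * R of which only the values on the unit square matter.
   Measurability is Borel measurability. *)
Definition is_graphon (R : realType)
    (h : measurableTypeR R * measurableTypeR R -> measurableTypeR R) : Prop :=
  [/\ measurable_fun (unit_square R) h,
      forall z, unit_square R z -> 0 <= h z <= 1 &
      forall x y, unit_square R (x, y) -> h (x, y) = h (y, x)].

Record graphon (R : realType) := Graphon {
  gfun :> R * R -> R;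
  gfunP : is_graphon gfun }.

HB.instance Definition _ (R : realType) := gen_eqMixin (graphon R).
HB.instance Definition _ (R : realType) := gen_choiceMixin (graphon R).

Section Graphons.
Variable R : realType.
Local Notation mR := (measurableTypeR R).
Local Notation mu := (@lebesgue_measure R).
Local Notation mu2 := (mu \x mu)%E.
Local Notation I01 := (unit_itv R).

Definition cut_dist (f g : graphon R) : R :=
  sup [set r | exists S A : set mR,
    [/\ measurable S, measurable A, S `<=` I01, A `<=` I01 &
        r = `| \int[mu2]_(z in S `*` A) (f z - g z) |] ].

(* The elements of Sigma; as for graphons, only the values on [0,1] matter.
   Measurability of the inverse (mpfun_image) is automatic for a Borel
   bijection of [0,1], by the Lusin-Souslin theorem. *)
Record mp_bijection := MPBijection {
  mpfun :> R -> R;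
  mpfun_bij : set_bij I01 I01 mpfun;
  mpfun_meas : measurable_fun I01 (mpfun : mR -> mR);
  mpfun_image : forall A : set mR, measurable A -> A `<=` I01 ->
    measurable (mpfun @` A : set mR);
  mpfun_preserving : forall A : set mR, measurable A -> A `<=` I01 ->
    mu (I01 `&` mpfun @^-1` A) = mu A }.

Lemma measurable_unit_itv : measurable I01.
Proof. exact: measurable_itv. Qed.
Hint Resolve measurable_unit_itv : core.

Lemma measurable_unit_square : measurable (unit_square R).
Proof. exact: measurableX. Qed.
Hint Resolve measurable_unit_square : core.

Lemma mpfun_in (s : mp_bijection) x : I01 x -> I01 (s x).
Proof. by have [h _ _] := mpfun_bij s; exact: h. Qed.

Definition mp_ext (s : mp_bijection) (x : mR) : mR :=
  if x \in I01 then s x else x.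

Lemma mp_extE (s : mp_bijection) x : I01 x -> mp_ext s x = s x.
Proof. by move=> xI; rewrite /mp_ext mem_set. Qed.

Lemma mp_ext_out (s : mp_bijection) x : ~ I01 x -> mp_ext s x = x.
Proof. by move=> xI; rewrite /mp_ext memNset. Qed.

Lemma measurable_mp_ext (s : mp_bijection) : measurable_fun setT (mp_ext s).
Proof.
rewrite -(setUv I01); apply/measurable_funU => //; first exact: measurableC.
split.
- apply: (@eq_measurable_fun _ _ _ _ _ (s : mR -> mR)); last exact: mpfun_meas.
  by move=> x /set_mem xI; rewrite mp_extE.
- apply: (@eq_measurable_fun _ _ _ _ _ (id : mR -> mR)); last exact: measurable_id.
  by move=> x /set_mem xI; rewrite mp_ext_out.
Qed.

Definition mp_ext2 (s : mp_bijection) (z : mR * mR) : mR * mR :=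
  (mp_ext s z.1, mp_ext s z.2).

Lemma measurable_mp_ext2 (s : mp_bijection) : measurable_fun setT (mp_ext2 s).
Proof.
by apply: measurable_fun_pair; apply: measurableT_comp => //;
  exact: measurable_mp_ext.
Qed.

Lemma relabel_is_graphon (g : graphon R) (s : mp_bijection) :
  is_graphon (fun z => g (s z.1, s z.2)).
Proof.
have [mg g01 gC] := gfunP g.
split=> [|z [z1 z2]|x y [/= xI yI]].
- apply: (@eq_measurable_fun _ _ _ _ _ ((g : mR * mR -> mR) \o mp_ext2 s)).
    by move=> z /set_mem [z1 z2]; rewrite /mp_ext2 /= !mp_extE.
  apply: (measurable_comp measurable_unit_square _ mg).
    move=> _ [z [z1 z2] <-]; rewrite /mp_ext2 !mp_extE//.
    by split; exact: mpfun_in.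
  by apply: measurable_funTS; exact: measurable_mp_ext2.
- by apply: g01; split; exact: mpfun_in.
- by apply: gC; split; exact: mpfun_in.
Qed.

Definition relabel (g : graphon R) (s : mp_bijection) : graphon R :=
  Graphon (relabel_is_graphon g s).

Lemma mp_id_subproof :
  [/\ set_bij I01 I01 (id : R -> R), measurable_fun I01 (id : mR -> mR),
   forall A : set mR, measurable A -> A `<=` I01 -> measurable (id @` A : set mR) &
   forall A : set mR, measurable A -> A `<=` I01 ->
     mu (I01 `&` id @^-1` A) = mu A].
Proof.
split=> [||A mA AI|A mA AI].
- by split=> // x xI; exists x.
- exact: measurable_id.
- by rewrite image_id.
- by rewrite preimage_id (setIidr AI).
Qed.

Definition mp_id : mp_bijection := {|
  mpfun := id;
  mpfun_bij := let: And4 a _ _ _ := mp_id_subproof in a;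
  mpfun_meas := let: And4 _ b _ _ := mp_id_subproof in b;
  mpfun_image := let: And4 _ _ c _ := mp_id_subproof in c;
  mpfun_preserving := let: And4 _ _ _ d := mp_id_subproof in d |}.

Lemma mp_comp_subproof (s t : mp_bijection) :
  [/\ set_bij I01 I01 (s \o t : R -> R),
   measurable_fun I01 (s \o t : mR -> mR),
   forall A : set mR, measurable A -> A `<=` I01 ->
     measurable ((s \o t) @` A : set mR) &
   forall A : set mR, measurable A -> A `<=` I01 ->
     mu (I01 `&` (s \o t) @^-1` A) = mu A].
Proof.
have tI : t @` I01 `<=` I01 by move=> _ [x xI <-]; exact: mpfun_in.
have ms := mpfun_meas s; have mt := mpfun_meas t.
split=> [||A mA AI|A mA AI].
- have [h1 h2 h3] := mpfun_bij s; have [k1 k2 k3] := mpfun_bij t.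
  split.
  + by move=> x xI; apply: h1; exact: k1.
  + move=> x y; rewrite !inE => xI yI /= e.
    by apply: k2; rewrite ?inE//; apply: h2; rewrite ?inE//; exact: k1.
  + move=> z /h3[y /k3[x xI <-] <-]; by exists x.
- exact: (measurable_comp measurable_unit_itv tI ms mt).
- rewrite -image_comp; apply: mpfun_image.
    exact: mpfun_image mA AI.
  by move=> _ [x /AI xI <-]; exact: mpfun_in.
- rewrite -(mpfun_preserving s mA AI) -(@mpfun_preserving t (I01 `&` s @^-1` A)).
  + congr (mu _); apply/seteqP; split=> x /=.
      by move=> [xI sxA]; split=> //; split=> //; exact: mpfun_in.
    by move=> [xI [_ sxA]].
  + exact: ms.
  + by move=> x [].
Qed.

Definition mp_comp (s t : mp_bijection) : mp_bijection := {|
  mpfun := s \o t;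
  mpfun_bij := let: And4 a _ _ _ := mp_comp_subproof s t in a;
  mpfun_meas := let: And4 _ b _ _ := mp_comp_subproof s t in b;
  mpfun_image := let: And4 _ _ c _ := mp_comp_subproof s t in c;
  mpfun_preserving := let: And4 _ _ _ d := mp_comp_subproof s t in d |}.

Lemma mp_ext_preserving (s : mp_bijection) (A : set mR) : measurable A ->
  mu (mp_ext s @^-1` A) = mu A.
Proof.
move=> mA.
have mAI : measurable (A `&` I01) by exact: measurableI.
have mAC : measurable (A `\` I01) by exact: measurableD.
have mp : measurable (I01 `&` s @^-1` (A `&` I01)) by exact: mpfun_meas.
have -> : mp_ext s @^-1` A = (I01 `&` s @^-1` (A `&` I01)) `|` (A `\` I01).
  apply/seteqP; split=> x /=.
    move=> Ax; have [xI|xI] := pselect (I01 x).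
      by left; split=> //; split; [rewrite mp_extE in Ax|exact: mpfun_in].
    by right; split=> //; rewrite mp_ext_out in Ax.
  by move=> [[xI [sA _]]|[xA xI]]; [rewrite mp_extE|rewrite mp_ext_out].
rewrite measureU//; last by apply/seteqP; split=> x //= [[xI _] [_ /(_ xI)]].
rewrite -[in RHS](setUIDK A I01) measureU//; last first.
  by apply/seteqP; split=> x //= [[_ xI] [_ /(_ xI)]].
congr (_ + _)%E; exact: (mpfun_preserving s mAI (@subIsetr _ A I01)).
Qed.

Lemma mp_ext2_preserving (s : mp_bijection) (X : set (mR * mR)) :
  measurable X -> mu2 (mp_ext2 s @^-1` X) = mu2 X.
Proof.
move=> mX; have mphi := measurable_mp_ext2 s.
pose nu : {measure set (mR * mR) -> \bar R} :=
  measure_function_pushforward__canonical__measure_function_Measure mu2 mphi.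
suff nuE (A B : set mR) : measurable A -> measurable B ->
    nu (A `*` B) = (mu A * mu B)%E.
  exact: (esym (product_measure_unique nuE mX)).
move=> mA mB.
rewrite /= /pushforward.
have -> : mp_ext2 s @^-1` (A `*` B) = (mp_ext s @^-1` A) `*` (mp_ext s @^-1` B).
  by apply/seteqP; split=> z [z1 z2]; split.
have mext C : measurable C -> measurable (mp_ext s @^-1` C).
  by move=> mC; rewrite -[X in measurable X]setTI; exact: measurable_mp_ext.
have -> : (mu \x mu)%E (mp_ext s @^-1` A `*` mp_ext s @^-1` B) =
    (mu (mp_ext s @^-1` A) * mu (mp_ext s @^-1` B))%E.
  by apply: product_measure1E; exact: mext.
by rewrite !mp_ext_preserving.
Qed.

Lemma mu_unit_itv : mu I01 = 1%E.
Proof.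
rewrite /unit_itv lebesgue_measure_itv /= lte_fin ltr01.
by rewrite oppr0 adde0.
Qed.

Lemma mu2_unit_square : mu2 (unit_square R) = 1%E.
Proof.
have -> : mu2 (unit_square R) = (mu I01 * mu I01)%E.
  exact: product_measure1E.
by rewrite mu_unit_itv mule1.
Qed.

Lemma sub_unit_square (S A : set mR) :
  S `<=` I01 -> A `<=` I01 -> S `*` A `<=` unit_square R.
Proof. by move=> SI AI [x y] [/SI xI /AI yI]. Qed.

Lemma measurable_graphonB (f g : graphon R) (D : set (mR * mR)) :
  measurable D -> D `<=` unit_square R ->
  measurable_fun D (fun z : mR * mR => f z - g z : mR).
Proof.
move=> mD DI; have [mf _ _] := gfunP f; have [mg _ _] := gfunP g.
by apply: measurable_funB; exact: (measurable_funS measurable_unit_square DI).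
Qed.

Lemma graphonB_le1 (f g : graphon R) z : unit_square R z -> `|f z - g z| <= 1.
Proof.
move=> zI; have [_ f01 _] := gfunP f; have [_ g01 _] := gfunP g.
have /andP[f0 f1] := f01 _ zI; have /andP[g0 g1] := g01 _ zI.
by rewrite ler_norml; apply/andP; split; lra.
Qed.

Lemma integrable_graphonB (f g : graphon R) (D : set (mR * mR)) :
  measurable D -> D `<=` unit_square R ->
  mu2.-integrable D (EFin \o (fun z : mR * mR => f z - g z)).
Proof.
move=> mD DI; apply: measurable_bounded_integrable => //.
- apply: (@le_lt_trans _ _ (mu2 (unit_square R))).
    by apply: le_measure => //; rewrite inE.
  by rewrite mu2_unit_square ltry.
- exact: measurable_graphonB.
- exists 1; split=> // M M1 z zD.
  by apply: (le_trans (graphonB_le1 _ _ (DI _ zD))); exact: ltW.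
Qed.

Lemma cut_integral_le1 (f g : graphon R) (D : set (mR * mR)) :
  measurable D -> D `<=` unit_square R ->
  `| \int[mu2]_(z in D) (f z - g z) | <= 1.
Proof.
move=> mD DI.
apply: (le_trans (le_normr_Rintegral mD (integrable_graphonB f g mD DI))).
have Dle : (mu2 D <= 1)%E.
  by rewrite -mu2_unit_square; apply: le_measure => //; rewrite inE.
have le1 : (\int[mu2]_(z in D) `|f z - g z|%:E <= 1)%E.
  apply: (@le_trans _ _ (\int[mu2]_(z in D) (cst 1 z))%E).
    apply: ge0_le_integral => //.
    - apply/measurable_EFinP; apply: measurableT_comp => //.
      exact: measurable_graphonB.
    - by move=> z zD /=; rewrite lee_fin; exact/graphonB_le1/DI.
  by rewrite integral_cst// mul1e.
rewrite /Rintegral -lee_fin fineK//.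
rewrite ge0_fin_numE; last exact: integral_ge0.
exact: le_lt_trans le1 (ltry _).
Qed.

Lemma cut_dist_has_sup (f g : graphon R) :
  has_sup [set r | exists S A : set mR,
    [/\ measurable S, measurable A, S `<=` I01, A `<=` I01 &
        r = `| \int[mu2]_(z in S `*` A) (f z - g z) |] ].
Proof.
split.
  by exists `| \int[mu2]_(z in set0 `*` set0) (f z - g z) |, set0, set0; split.
exists 1 => _ [S [A [mS mA SI AI ->]]].
by apply: cut_integral_le1; [exact: measurableX|exact: sub_unit_square].
Qed.

Lemma cut_dist_ub (f g : graphon R) (S A : set mR) :
  measurable S -> measurable A -> S `<=` I01 -> A `<=` I01 ->
  `| \int[mu2]_(z in S `*` A) (f z - g z) | <= cut_dist f g.
Proof.
move=> mS mA SI AI; apply: ub_le_sup; first by case: (cut_dist_has_sup f g).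
by exists S, A.
Qed.

Lemma cut_dist_le (f g : graphon R) (e : R) :
  (forall S A : set mR, measurable S -> measurable A -> S `<=` I01 ->
    A `<=` I01 -> `| \int[mu2]_(z in S `*` A) (f z - g z) | <= e) ->
  cut_dist f g <= e.
Proof.
move=> h; apply: ge_sup; first by case: (cut_dist_has_sup f g).
by move=> _ [S [A [mS mA SI AI ->]]]; exact: h.
Qed.

Lemma cut_dist_ge0 (f g : graphon R) : 0 <= cut_dist f g.
Proof. exact: le_trans (normr_ge0 _) (@cut_dist_ub f g set0 set0 _ _ _ _). Qed.

Lemma cut_distxx (f : graphon R) : cut_dist f f = 0.
Proof.
apply/eqP; rewrite eq_le cut_dist_ge0 andbT; apply: cut_dist_le => S A mS mA SI AI.
under eq_Rintegral do rewrite subrr.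
by rewrite /Rintegral integral0 normr0.
Qed.

Lemma cut_dist_sym (f g : graphon R) : cut_dist f g = cut_dist g f.
Proof.
suff le f' g' : cut_dist f' g' <= cut_dist g' f'.
  by apply/eqP; rewrite eq_le !le.
apply: cut_dist_le => S A mS mA SI AI.
have -> : \int[mu2]_(z in S `*` A) (f' z - g' z) =
    - \int[mu2]_(z in S `*` A) (g' z - f' z).
  rewrite -mulN1r -RintegralZl; [|exact: measurableX|
    by apply: integrable_graphonB; [exact: measurableX|exact: sub_unit_square]].
  by apply: eq_Rintegral => z _; rewrite mulN1r opprB.
by rewrite normrN; exact: cut_dist_ub.
Qed.

Lemma cut_dist_triangle (f g h : graphon R) :
  cut_dist f h <= cut_dist f g + cut_dist g h.
Proof.
apply: cut_dist_le => S A mS mA SI AI.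
have mD : measurable (S `*` A) by exact: measurableX.
have DI := sub_unit_square SI AI.
have -> : \int[mu2]_(z in S `*` A) (f z - h z) =
    \int[mu2]_(z in S `*` A) (f z - g z) + \int[mu2]_(z in S `*` A) (g z - h z).
  rewrite -RintegralD//; try exact: integrable_graphonB.
  by apply: eq_Rintegral => z _; rewrite addrA subrK.
by apply: (le_trans (ler_normD _ _)); apply: lerD; exact: cut_dist_ub.
Qed.

Lemma preimage_mp_ext_image (s : mp_bijection) (B : set mR) :
  B `<=` I01 -> mp_ext s @^-1` (s @` B) = B.
Proof.
move=> BI; apply/seteqP; split=> x /=; last first.
  by move=> Bx; exists x => //; rewrite mp_extE//; exact: BI.
move=> [y By]; have yI := BI _ By.
have [xI|xI] := pselect (I01 x); last first.
  by rewrite mp_ext_out// => yx; case: xI; rewrite -yx; exact: mpfun_in.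
rewrite mp_extE// => syx; have [_ injs _] := mpfun_bij s.
by rewrite (injs x y) ?inE.
Qed.

Lemma cut_dist_relabel (f g : graphon R) (s : mp_bijection) :
  cut_dist (relabel f s) (relabel g s) <= cut_dist f g.
Proof.
apply: cut_dist_le => S A mS mA SI AI.
have sI (B : set mR) : B `<=` I01 -> s @` B `<=` I01.
  by move=> BI _ [x /BI xI <-]; exact: mpfun_in.
have msS := mpfun_image s mS SI; have msA := mpfun_image s mA AI.
apply: le_trans (cut_dist_ub f g msS msA (sI _ SI) (sI _ AI)).
set D' := (s @` S) `*` (s @` A).
have mD' : measurable D' by exact: measurableX.
have D'I : D' `<=` unit_square R by apply: sub_unit_square; exact: sI.
pose F := (fun z : mR * mR => f z - g z : mR) \_ (unit_square R).
have mF : measurable_fun setT F.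
  have := measurable_graphonB f g measurable_unit_square (fun z h => h).
  by move/(measurable_restrictT _ measurable_unit_square).
have F1 z : `|F z| <= 1.
  rewrite /F patchE; case: ifPn => [/set_mem zI|_]; first exact: graphonB_le1.
  by rewrite normr0.
have preD' : mp_ext2 s @^-1` D' = S `*` A.
  by rewrite -[in RHS](preimage_mp_ext_image s SI) -[in RHS](preimage_mp_ext_image s AI).
have intF : mu2.-integrable (mp_ext2 s @^-1` D') ((EFin \o F) \o mp_ext2 s).
  rewrite preD'; apply: (measurable_bounded_integrable (f := F \o mp_ext2 s)).
  - exact: measurableX.
  - apply: (@le_lt_trans _ _ (mu2 (unit_square R))).
      apply: le_measure; rewrite ?inE//; first exact: measurableX.
      exact: sub_unit_square.
    by rewrite mu2_unit_square ltry.
  - apply: measurable_funTS; apply: measurableT_comp => //.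
    exact: measurable_mp_ext2.
  - by exists 1; split=> // M M1 z _; apply: (le_trans (F1 _)); exact: ltW.
have -> : \int[mu2]_(z in D') (f z - g z) =
    \int[mu2]_(z in S `*` A) (relabel f s z - relabel g s z).
  congr fine.
  transitivity (\int[mu2]_(z in D') (F z)%:E)%E.
    apply: eq_integral => z /set_mem zD; rewrite /F patchE mem_set//.
    exact: D'I.
  pose nu : {measure set (mR * mR) -> \bar R} :=
    measure_function_pushforward__canonical__measure_function_Measure
      mu2 (measurable_mp_ext2 s).
  transitivity (\int[nu]_(z in D') (F z)%:E)%E.
    apply: eq_measure_integral => X mX _.
    exact: (esym (mp_ext2_preserving s mX)).
  have mF' : measurable_fun setT (EFin \o F) by exact/measurable_EFinP.
  rewrite [LHS](integral_pushforward (measurable_mp_ext2 s) mF' intF mD').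
  rewrite preD'; apply: eq_integral => z /set_mem [/SI zS /AI zA] /=.
  rewrite /F patchE /mp_ext2 !mp_extE// mem_set//.
  by split; exact: mpfun_in.
by [].
Qed.

(* The closure of the orbit {g_sigma} for the pseudometric cut_dist. *)
Definition orbit_closure (g : graphon R) : set (graphon R) :=
  [set f | forall e, 0 < e -> exists s, cut_dist f (relabel g s) < e].

Definition weak_equiv (f g : graphon R) : bool :=
  `[< orbit_closure f = orbit_closure g >].

Lemma weak_equiv_is_equiv : equiv_class_of weak_equiv.
Proof.
split=> [f|f g|g f h].
- exact/asboolP.
- by apply/asboolP/asboolP.
- by move=> /asboolP fg /asboolP gh; apply/asboolP; rewrite fg.
Qed.

Canonical weak_equiv_rel := EquivRelPack weak_equiv_is_equiv.

(* A point of Wtilde is the class of all graphons with a given orbit closure,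
   so that tilde f = tilde g iff the orbit closures of f and g coincide. *)
Definition Wtilde := {eq_quot weak_equiv_rel}%qT.

Definition tilde (g : graphon R) : Wtilde := (\pi_Wtilde g)%qT.

Definition cut_dist_inf (f g : graphon R) : R :=
  inf [set r | exists s, r = cut_dist f (relabel g s)].

(* Independent of the chosen representatives, by delta_cutE below. *)
Definition delta_cut (F G : Wtilde) : R := cut_dist_inf (repr F) (repr G).

Lemma cut_dist_inf_le (f f' g g' : graphon R) :
  orbit_closure f = orbit_closure f' -> orbit_closure g = orbit_closure g' ->
  cut_dist_inf f' g' <= cut_dist_inf f g.
Proof.
move=> ff' gg'.
have in_closure h : orbit_closure h h.
  move=> e e0; exists mp_id; suff -> : cut_dist h (relabel h mp_id) = 0 by [].
  rewrite -[RHS](cut_distxx h); congr sup; apply/funext => r; apply/propext.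
  split=> -[S [A [mS mA SI AI ->]]]; exists S, A; split=> //; congr (`|_|).
    by apply: eq_Rintegral => -[x y].
  by apply: eq_Rintegral => -[x y].
apply: lb_le_inf; first by exists (cut_dist f (relabel g mp_id)), mp_id.
move=> _ [s ->]; apply/ler_addgt0Pr => e e0.
have e20 : 0 < e / 2 by rewrite divr_gt0.
have := in_closure f'; rewrite -{1}ff' => /(_ _ e20)[u hu].
have := in_closure g; rewrite {1}gg' => /(_ _ e20)[t ht].
pose w := mp_comp t (mp_comp s u).
apply: (@le_trans _ _ (cut_dist f' (relabel g' w))).
  apply: ge_inf; last by exists w.
  by exists 0 => _ [v ->]; exact: cut_dist_ge0.
have h1 := cut_dist_triangle f' (relabel f u) (relabel g' w).
have h2 := cut_dist_triangle (relabel f u) (relabel (relabel g s) u) (relabel g' w).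
have h3 := cut_dist_relabel f (relabel g s) u.
have h4 := cut_dist_relabel (relabel g s) (relabel (relabel g' t) s) u.
have h5 := cut_dist_relabel g (relabel g' t) s.
have h6 : cut_dist (relabel (relabel g s) u) (relabel (relabel (relabel g' t) s) u)
  = cut_dist (relabel (relabel g s) u) (relabel g' w) by [].
lra.
Qed.

Lemma delta_cutE (f g : graphon R) :
  delta_cut (tilde f) (tilde g) = cut_dist_inf f g.
Proof.
have cl h : orbit_closure (repr (tilde h)) = orbit_closure h.
  have : tilde (repr (tilde h)) = tilde h by rewrite /tilde reprK.
  by move=> /eqmodP /asboolP.
by apply/eqP; rewrite eq_le !cut_dist_inf_le.
Qed.

Lemma cst_is_graphon (u : R) : 0 <= u <= 1 -> is_graphon (fun=> u).
Proof. by move=> u01; split=> // *; exact: measurable_cst. Qed.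

Definition cst_graphon (u : R) (u01 : 0 <= u <= 1) : graphon R :=
  Graphon (cst_is_graphon u01).

(* f^G; recall that i : 'I_n is the vertex i.+1 of {1, ..., n}. *)
Definition step_fun n (G : sgraph n) (z : R * R) : R :=
  [exists p : 'I_n * 'I_n, [&& p \in adj G,
     Num.ceil (n%:R * z.1) == p.1.+1%:Z &
     Num.ceil (n%:R * z.2) == p.2.+1%:Z]]%:R.

Lemma measurable_ceil_eq n (k : int) :
  measurable ([set x : mR | Num.ceil (n%:R * x) == k] : set mR).
Proof.
pose m := (fun x : mR => n%:R * x : mR).
have mm : measurable_fun setT m by exact: measurable_funM.
rewrite (_ : [set x | _] = m @^-1` `]k%:~R - 1, k%:~R]).
  by rewrite -[X in measurable X]setTI; apply: mm => //; exact: measurable_itv.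
by apply/seteqP; split=> x /=; rewrite in_itv /= /m ceil_eq intrB.
Qed.

Lemma step_is_graphon n (G : sgraph n) : is_graphon (step_fun G).
Proof.
split=> [|z _|x y _].
- pose E := \bigcup_(p in [set` adj G])
    ([set x : mR | Num.ceil (n%:R * x) == p.1.+1%:Z] `*`
     [set x : mR | Num.ceil (n%:R * x) == p.2.+1%:Z]).
  have mE : measurable E.
    by apply: fin_bigcup_measurable => // p _; apply: measurableX;
      exact: measurable_ceil_eq.
  apply: (@eq_measurable_fun _ _ _ _ _ (\1_E : mR * mR -> mR)).
    move=> z _; rewrite indicE /step_fun; congr ((nat_of_bool _)%:R).
    apply/idP/existsP => [/set_mem[p pG [p1 p2]]|[p /and3P[pG p1 p2]]].
      by exists p; apply/and3P.
    by apply/mem_set; exists p.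
  exact: measurable_indic.
- by rewrite /step_fun; case: [exists _, _]; rewrite /= ?lexx ?ler01.
- have sym a b : (a, b) \in adj G -> (b, a) \in adj G.
    by case/andP: (adj_simple G) => _ /forallP/(_ a)/forallP/(_ b)/eqP ->.
  rewrite /step_fun; congr ((nat_of_bool _)%:R).
  by apply/existsP/existsP => -[[i j] /and3P[ij /= xi yj]]; exists (j, i);
    apply/and3P; split=> //; exact: sym.
Qed.

Definition step_graphon n (G : sgraph n) : graphon R :=
  Graphon (step_is_graphon G).

Definition hom_density m (H : sgraph m) (h : graphon R) : R :=
  \int[lebesgue_tuple R m]_(x in unit_cube R m)
    \prod_(p in edges H) h (tnth x p.1, tnth x p.2).

(* The convention 0 log 0 = 0 holds since ln 0 is 0 here. *)
Definition entropy_pt (u : R) : R :=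
  2^-1 * u * ln u + 2^-1 * (1 - u) * ln (1 - u).

Definition entropy (h : graphon R) : R :=
  \int[mu2]_(z in unit_square R) entropy_pt (h z).

End Graphons.

Section Model.
Variables (R : realType) (k : nat).
Variables (H : 'I_k.+1 -> {m : nat & sgraph m}) (beta : 'I_k.+1 -> R).

Definition eH (i : 'I_k.+1) : nat := num_edges (tagged (H i)).

(* The index i : 'I_k.+1 stands for i.+1 in the usual numbering from 1. *)
Definition Tfun (h : graphon R) : R :=
  \sum_(i < k.+1) beta i * hom_density (tagged (H i)) h.

Definition psi (n : nat) : R :=
  (n%:R ^+ 2)^-1 *
  ln (\sum_(G : sgraph n) expR (n%:R ^+ 2 * Tfun (step_graphon R G))).

Definition ell (u : R) : R :=
  \sum_(i < k.+1) beta i * u ^+ eH i - entropy_pt u.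

Definition ell_maximizers : set R :=
  [set u | 0 <= u <= 1 /\ forall v, 0 <= v <= 1 -> ell v <= ell u].

(* X has law P(X = G) = e^(n^2 (T(G) - psi_n)), where T of the class of G is by
   definition T(f^G). *)
Definition exp_random_graph n d (Omega : measurableType d)
    (P : probability Omega R) (X : Omega -> sgraph n) : Prop :=
  forall G : sgraph n, measurable (X @^-1` [set G]) /\
    P (X @^-1` [set G]) =
      (expR (n%:R ^+ 2 * (Tfun (step_graphon R G) - psi n)))%:E.

(* The minimum of delta_cut F over the classes of the constants u in U, written
   as an infimum; the two agree when U is finite and nonempty. *)
Definition min_delta_cut (F : Wtilde R) : R :=
  inf [set r | exists u (u01 : 0 <= u <= 1),
    ell_maximizers u /\ r = delta_cut F (tilde (cst_graphon u01))].

End Model.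

Definition cvg_prob_to0 (R : realType) (d : nat -> measure_display)
    (Omega : forall n, measurableType (d n))
    (P : forall n, probability (Omega n) R) (Z : forall n, Omega n -> R) : Prop :=
  forall e : R, 0 < e -> P n [set w | e < `|Z n w|] @[n --> \oo] --> 0%E.

(* Main.v *)
From HB Require Import structures.
Require Import Defs.
From mathcomp Require Import all_boot all_order all_algebra fingroup perm.
From mathcomp Require Import ring lra.
From mathcomp Require Import all_classical all_reals all_analysis.
From mathcomp Require Import measurable_realfun.

(** Let [gamma] be half of the sum of |beta_i| e(H_i) (e(H_i) - 1) over all i; the
    hypothesis says [gamma < 1].  This one inequality makes both the variational
    problem and the random graph at finite n behave as if all edges were
    independent.

    The variational problem.  The entropy density has second derivative at least 2
    ([entropy_pt_tangent], which is Pinsker's inequality), whereas replacing a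
    constant u by a graphon h changes t(H,h) to second order by at most
    e(e-1)/2 times the squared L2 distance of h and u ([prod_taylor2] integrated
    over the cube, whose two-dimensional marginals are Lebesgue measure on the
    square, [marginal_int]).  The equation ell'(u) = 0 has a solution u in (0,1)
    by the intermediate value theorem; there the first-order terms cancel, and
    T(h) - I(h) <= ell(u) - (1 - gamma) ||h - u||^2 for every graphon h
    ([graphon_tangent]).  Hence u is the only maximizer of ell, and a graphon that
    maximizes T - I equals u almost everywhere.

    The random graph.  The law of G_n is a Gibbs measure on configurations of
    binary variables, one for each pair of vertices.  The conditional probability
    of an edge is a logistic function, which is 1/4-Lipschitz, of a discrete
    derivative of n^2 T, and counting homomorphisms through two given edges bounds
    the total influence of the other edges on it by [gamma]: this is Dobrushin's
    uniqueness condition.  Since a single influence is O(1/n), the comparison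
    argument of [dobrushin_covar] shows that an edge indicator has covariance
    O(1/n) with any bounded function of boundedly many other edges.  All edges have
    the same probability p_n by symmetry, so homomorphism densities have expectation
    p_n^e + O(1/n) ([expect_dens]).

    The free energy.  Gibbs' inequality between the Gibbs measure and the
    independent measures of parameters p_n and u gives
    ell(u) - O(1/n) <= psi_n <= ell(p_n) + O(1/n), and
    ell(p_n) <= ell(u) - (1 - gamma) (p_n - u)^2; so psi_n tends to ell(u) and p_n
    tends to u ([free_energy_limit]).

    The cut distance.  Two applications of the Cauchy-Schwarz inequality bound the
    fourth power of the cut distance between G_n and the constant u by the density
    of 4-cycles in which every edge carries the weight 1_edge - u
    ([cut_dist_step]).  The expectation of this density is (p_n - u)^4 + O(1/n), and
    Markov's inequality concludes ([cvg_prob_cut]). *)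

Import Order.TTheory GRing.Theory Num.Theory.
Import numFieldNormedType.Exports.
Local Open Scope classical_set_scope.
Local Open Scope ring_scope.

Set Implicit Arguments.
Unset Strict Implicit.
Unset Printing Implicit Defensive.

(** * Single-site updates of configurations *)

(** Locked, because unification would otherwise compare two updates of the same
    configuration by enumerating the sites. *)
HB.lock Definition upd (E : finType) (x : {ffun E -> bool}) (e : E) (b : bool) :
  {ffun E -> bool} := [ffun f => if f == e then b else x f].

Section Configurations.
Variables (E : finType).
Implicit Types (x y : {ffun E -> bool}) (e f : E) (b : bool).

Lemma updE x e b f : upd x e b f = if f == e then b else x f.
Proof. by rewrite upd.unlock ffunE. Qed.

Lemma upd_upd x e b b' : upd (upd x e b) e b' = upd x e b'.
Proof. by apply/ffunP => f; rewrite !updE; case: eqP. Qed.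

Lemma updC x e f b b' : e != f -> upd (upd x e b) f b' = upd (upd x f b') e b.
Proof.
move=> ef; apply/ffunP => g; rewrite !updE.
by case: (eqVneq g f) => // ->; rewrite eq_sym (negPf ef).
Qed.

Lemma upd_id x e : upd x e (x e) = x.
Proof. by apply/ffunP => f; rewrite updE; case: eqP => // ->. Qed.

Lemma upd_flipK e : involutive (fun x => upd x e (~~ x e)).
Proof.
move=> x; apply/ffunP => f; rewrite !updE eqxx negbK.
by case: eqP => // ->.
Qed.

(** Flipping site [e] is an involution; pairing every configuration with its flip
    counts the two values at [e] once each. *)
Lemma sum_upd (V : nmodType) (F : {ffun E -> bool} -> V) e :
  (\sum_x F x) *+ 2 = \sum_x (F (upd x e true) + F (upd x e false)).
Proof.
rewrite mulr2n [X in _ + X](reindex_inj (inv_inj (upd_flipK e))) -big_split /=.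
apply: eq_bigr => x _; have := upd_id x e; case: (x e) => {1}<- //=.
by rewrite addrC.
Qed.

End Configurations.

(** * Decay of correlations under Dobrushin's condition *)

Section Dobrushin.
Variables (R : realType) (E : finType) (mu : {ffun E -> bool} -> R).
Implicit Types (x y : {ffun E -> bool}) (e : E) (f g : {ffun E -> bool} -> R).
Hypothesis mu_gt0 : forall x, 0 < mu x.
Hypothesis mu_sum1 : \sum_x mu x = 1.

Definition expect f : R := \sum_x mu x * f x.
Definition covar f g : R := expect (fun x => f x * g x) - expect f * expect g.

(** The conditional probability under [mu] that site [e] is occupied, given the
    configuration at all other sites. *)
Definition cond_prob e x : R :=
  mu (upd x e true) / (mu (upd x e true) + mu (upd x e false)).

Definition cond_expect e f x : R :=
  cond_prob e x * f (upd x e true) + (1 - cond_prob e x) * f (upd x e false).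

(** A bound on oscillations rather than their exact values: it survives the
    single-site updates below. *)
Definition osc_bound f (d : E -> R) :=
  forall e x, `|f (upd x e true) - f (upd x e false)| <= d e.

Definition indep_of g e := forall x b, g (upd x e b) = g x.

Lemma eq_expect f g : f =1 g -> expect f = expect g.
Proof. by move=> fg; apply: eq_bigr => x _; rewrite fg. Qed.

Lemma expect_cst (a : R) : expect (fun=> a) = a.
Proof. by rewrite /expect -mulr_suml mu_sum1 mul1r. Qed.

Lemma expectD f g : expect (fun x => f x + g x) = expect f + expect g.
Proof. by rewrite /expect -big_split /=; apply: eq_bigr => x _; rewrite mulrDr. Qed.

Lemma expectZ (a : R) f : expect (fun x => a * f x) = a * expect f.
Proof. by rewrite /expect mulr_sumr; apply: eq_bigr => x _; rewrite mulrCA. Qed.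

Lemma expect_sum (I : Type) (r : seq I) (P : pred I) (F : I -> {ffun E -> bool} -> R) :
  expect (fun x => \sum_(i <- r | P i) F i x) = \sum_(i <- r | P i) expect (F i).
Proof.
rewrite /expect exchange_big /=; apply: eq_bigr => x _.
by rewrite mulr_sumr.
Qed.

Lemma ler_norm_expect f (c : R) : (forall x, `|f x| <= c) -> `|expect f| <= c.
Proof.
move=> fc; rewrite -(expect_cst c) /expect.
apply: (le_trans (ler_norm_sum _ _ _)); apply: ler_sum => x _.
by rewrite normrM gtr0_norm// ler_pM2l.
Qed.

Lemma cond_prob_itv e x : 0 <= cond_prob e x <= 1.
Proof.
have h1 := mu_gt0 (upd x e true); have h0 := mu_gt0 (upd x e false).
have h : 0 < mu (upd x e true) + mu (upd x e false) by rewrite addr_gt0.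
rewrite /cond_prob divr_ge0 ?(ltW h1) ?(ltW h)//= ler_pdivrMr// mul1r.
by rewrite lerDl ltW.
Qed.

Lemma cond_prob_upd e x b : cond_prob e (upd x e b) = cond_prob e x.
Proof. by rewrite /cond_prob !upd_upd. Qed.

Lemma cond_expect_upd e f x b : cond_expect e f (upd x e b) = cond_expect e f x.
Proof. by rewrite /cond_expect cond_prob_upd !upd_upd. Qed.

Lemma expect_cond e f g : indep_of g e ->
  expect (fun x => cond_expect e f x * g x) = expect (fun x => f x * g x).
Proof.
move=> ge; have n2 : (2%:R : R) != 0 by rewrite pnatr_eq0.
apply: (mulfI n2); rewrite !mulr_natl /expect !(sum_upd _ e).
apply: eq_bigr => x _; rewrite !cond_expect_upd !ge /cond_expect /cond_prob.
have h1 := mu_gt0 (upd x e true); have h0 := mu_gt0 (upd x e false).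
have h : mu (upd x e true) + mu (upd x e false) != 0 by rewrite gt_eqF// addr_gt0.
field. exact: h.
Qed.

(** Averaging over site [e] removes the dependence on [e]; the dependence on another
    site [e'] grows by the influence of [e'] on the conditional law at [e] times the
    dependence on [e] that has been averaged out. *)
Lemma osc_cond (C : E -> E -> R) e f d : osc_bound f d ->
  (forall e', e' != e -> forall x,
     `|cond_prob e (upd x e' true) - cond_prob e (upd x e' false)| <= C e e') ->
  osc_bound (cond_expect e f) (fun e' => if e' == e then 0 else d e' + C e e' * d e).
Proof.
move=> fd Ce e' x; have [->|ne] := eqVneq e' e.
  by rewrite !cond_expect_upd subrr normr0.
set y := upd x e' true; set z := upd x e' false.
have -> : cond_expect e f y - cond_expect e f z =
  cond_prob e z * (f (upd y e true) - f (upd z e true)) +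
  (1 - cond_prob e z) * (f (upd y e false) - f (upd z e false)) +
  (cond_prob e y - cond_prob e z) * (f (upd y e true) - f (upd y e false)).
  by rewrite /cond_expect; ring.
have /andP[q0 q1] := cond_prob_itv e z.
apply: (le_trans (ler_normD _ _)); apply: lerD; last first.
  by rewrite normrM; apply: ler_pM => //; exact: Ce.
apply: (le_trans (ler_normD _ _)).
have -> : d e' = cond_prob e z * d e' + (1 - cond_prob e z) * d e' by ring.
rewrite normrM [X in _ + X]normrM (ger0_norm q0) (@ger0_norm _ (1 - _)) ?subr_ge0//.
apply: lerD; apply: ler_wpM2l; rewrite ?subr_ge0//.
  by rewrite /y /z !(updC _ _ _ ne); exact: fd.
by rewrite /y /z !(updC _ _ _ ne); exact: fd.
Qed.

Lemma osc_ge0 f d e : osc_bound f d -> 0 <= d e.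
Proof. by move=> /(_ e [ffun=> false]); exact: le_trans. Qed.

(** Change [y] into [x] one site at a time. *)
Lemma osc_total f d x y : osc_bound f d -> `|f x - f y| <= \sum_e d e.
Proof.
move=> fd; pose mix (s : seq E) : {ffun E -> bool} := [ffun e => if e \in s then x e else y e].
have step z e b b' : `|f (upd z e b) - f (upd z e b')| <= d e.
  by case: b; case: b'; rewrite ?subrr ?normr0 ?(osc_ge0 _ fd)// 1?distrC; exact: fd.
have mixS e s : mix (e :: s) = upd (mix s) e (x e).
  by apply/ffunP => e'; rewrite updE !ffunE in_cons; case: eqP => [->|].
have H s : `|f (mix s) - f y| <= \sum_(e <- s) d e.
  elim: s => [|e s IH].
    have -> : mix [::] = y by apply/ffunP => e; rewrite ffunE.
    by rewrite subrr normr0 big_nil.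
  rewrite big_cons mixS.
  have -> : f (upd (mix s) e (x e)) - f y =
      (f (upd (mix s) e (x e)) - f (upd (mix s) e (mix s e))) + (f (mix s) - f y).
    by rewrite upd_id; ring.
  by apply: (le_trans (ler_normD _ _)); apply: lerD.
have -> : x = mix (enum E) by apply/ffunP => e; rewrite ffunE mem_enum.
by apply: (le_trans (H _)); rewrite big_enum.
Qed.

Lemma covar_cond e f g : indep_of g e -> covar (cond_expect e f) g = covar f g.
Proof.
move=> ge; rewrite /covar expect_cond//; congr (_ - _ * _).
have h : indep_of (fun=> 1 : R) e by [].
by have := expect_cond f h; under eq_expect do rewrite mulr1;
  under [in RHS]eq_expect do rewrite mulr1.
Qed.

(** The starting point of the iteration in [dobrushin_covar]; only the presence of
    some finite multiple of the total oscillation matters there. *)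
Lemma covar_trivial f g d : osc_bound f d -> (forall x, `|g x| <= 1) ->
  `|covar f g| <= 2 * \sum_e d e.
Proof.
move=> fd g1; pose x0 : {ffun E -> bool} := [ffun=> false].
have S0 : 0 <= \sum_e d e by apply: sumr_ge0 => e _; exact: osc_ge0 fd.
pose h x := f x - f x0.
have -> : covar f g = expect (fun x => h x * g x) - expect h * expect g.
  rewrite /covar.
  have -> : expect (fun x => f x * g x) =
      expect (fun x => h x * g x) + f x0 * expect g.
    by rewrite -expectZ -expectD; apply: eq_expect => x; rewrite /h; ring.
  have -> : expect f = expect h + f x0.
    by rewrite -(expect_cst (f x0)) -expectD; apply: eq_expect => x; rewrite /h; ring.
  by ring.
have hS x : `|h x| <= \sum_e d e by exact: osc_total.
apply: (le_trans (ler_normB _ _)); rewrite mulr_natl mulr2n; apply: lerD.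
  apply: ler_norm_expect => x; rewrite normrM -[leRHS]mulr1; exact: ler_pM.
rewrite normrM -[leRHS]mulr1; apply: ler_pM => //; exact: ler_norm_expect.
Qed.

(** Dobrushin's comparison argument.  Suppose |covar f g| is at most the sum over e
    of a(e) times the oscillation of f at e, for all f.  At a site e outside [B] the
    function f may be replaced by its conditional expectation, since [g] does not
    depend on e; so the weight a(e) may be replaced by the sum of the C e e' a(e').
    The weights 2 on [B] and [kappa] off [B] are a supersolution of this recursion,
    and any excess over them is contracted by a factor at least as good as [gamma].
    The indicator of site [e0] oscillates only at [e0], where the weight is
    [kappa]. *)
Lemma dobrushin_covar (C : E -> E -> R) (gamma eta : R) (B : {set E}) g e0 :
  (forall e e' x, e' != e ->
     `|cond_prob e (upd x e' true) - cond_prob e (upd x e' false)| <= C e e') ->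
  (forall e, \sum_(e' | e' != e) C e e' <= gamma) -> gamma < 1 ->
  (forall e e', e' != e -> C e e' <= eta) ->
  (forall e, e \notin B -> indep_of g e) -> (forall x, `|g x| <= 1) ->
  e0 \notin B ->
  `|covar (fun x => (x e0)%:R) g| <= 2 * #|B|%:R * eta / (1 - gamma).
Proof.
move=> hC hrow gamma1 heta gB g1 e0B.
have C0 e e' : e' != e -> 0 <= C e e'.
  by move=> ne; apply: le_trans (hC e e' [ffun=> false] ne).
have gamma0 : 0 <= gamma.
  by apply: le_trans (hrow e0); apply: sumr_ge0 => e /C0.
have g1' : 0 < 1 - gamma by rewrite subr_gt0.
pose kappa := 2 * #|B|%:R * eta / (1 - gamma).
pose a (t : R) e := if e \in B then 2 else kappa + t.
pose est (t : R) := forall f d, osc_bound f d -> `|covar f g| <= \sum_e a t e * d e.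
pose N : R := #|E|%:R.
have N0 : 0 < N by rewrite /N ltr0n; apply/card_gt0P; exists e0.
pose r := 1 - (1 - gamma) / N.
have kappa_eq : 2 * #|B|%:R * eta = kappa * (1 - gamma) by rewrite /kappa divfK// gt_eqF.
have eta0 e : e \in B -> 0 <= eta.
  move=> eB; have ne : e != e0 by apply: contraNneq e0B => <-.
  exact: le_trans (C0 _ _ ne) (heta _ _ ne).
have kappa0 : 0 <= kappa.
  apply: divr_ge0; last exact: ltW.
  have [B0|/set0Pn[e /eta0 h]] := eqVneq B finset.set0; last by rewrite !mulr_ge0.
  by rewrite B0 cards0 mulr0 mul0r.
(* Averaging the bounds obtained by updating at each site, with no update inside B,
   multiplies the excess t by r, which is less than 1. *)
have step t : 0 <= t -> est t -> est (t * r).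
  move=> t0 et f d fd.
  have one e : `|covar f g| <=
      \sum_e' a t e' * d e' - (if e \in B then 0 else (1 - gamma) * t * d e).
    case: ifPn => eB; first by rewrite subr0; exact: et.
    rewrite -(covar_cond f (gB _ eB)).
    apply: (le_trans (et _ _ (osc_cond fd (fun e' ne x => hC e e' x ne)))).
    rewrite (bigD1 e)//= eqxx mulr0 add0r [in leRHS](bigD1 e)//=.
    have -> : \sum_(i | i != e) a t i * (if i == e then 0 else d i + C e i * d e) =
        \sum_(i | i != e) a t i * d i + (\sum_(i | i != e) a t i * C e i) * d e.
      rewrite mulr_suml -big_split /=; apply: eq_bigr => i /negPf ->; ring.
    have key : \sum_(i | i != e) a t i * C e i <= kappa + gamma * t.
      apply: (@le_trans _ _ (\sum_(i | i != e)
          ((if i \in B then 2 * eta else 0) + (kappa + t) * C e i))).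
        apply: ler_sum => i ie; rewrite /a; case: ifPn => iB.
          rewrite -[leLHS]addr0 lerD ?ler_pM2l ?heta//.
          by rewrite mulr_ge0 ?addr_ge0// C0.
        by rewrite add0r.
      rewrite big_split /= -mulr_sumr.
      have h1 : \sum_(i | i != e) (if i \in B then 2 * eta else 0) <= 2 * #|B|%:R * eta.
        rewrite -big_mkcondr /= (eq_bigl (mem B)); last first.
          by move=> i; rewrite /= andb_idl// => iB; apply: contraNneq eB => <-.
        by rewrite sumr_const -[leLHS]mulr_natr mulrAC.
      have h2 : (kappa + t) * \sum_(i | i != e) C e i <= (kappa + t) * gamma.
        by rewrite ler_wpM2l ?addr_ge0.
      rewrite kappa_eq in h1.
      apply: (le_trans (lerD h1 h2)); lra.
    have de := osc_ge0 e fd.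
    have := ler_wpM2r de key; rewrite /a (negPf eB); lra.
  have sum_one : N * `|covar f g| <= N * (\sum_e' a t e' * d e') -
      (1 - gamma) * t * \sum_(e | e \notin B) d e.
    have -> : N * `|covar f g| = \sum_(e : E) `|covar f g|.
      by rewrite sumr_const mulr_natl.
    apply: (le_trans (ler_sum _ (fun e _ => one e))).
    rewrite big_split /= sumr_const -mulr_natl -/N lerD2l sumrN lerN2 mulr_sumr.
    rewrite [in leLHS]big_mkcond /=.
    by apply: ler_sum => e _; case: (e \in B).
  rewrite -(ler_pM2l N0); apply: (le_trans sum_one).
  have -> : \sum_e' a (t * r) e' * d e' =
     \sum_e' a t e' * d e' - (t - t * r) * \sum_(e | e \notin B) d e.
    rewrite mulr_sumr [X in _ - X]big_mkcond /= -sumrB; apply: eq_bigr => e _.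
    by rewrite /a; case: (e \in B) => /=; [rewrite subr0|ring].
  rewrite mulrBr lerD2l lerN2 mulrA ler_wpM2r//.
    by apply: sumr_ge0 => e _; exact: osc_ge0 fd.
  rewrite /r le_eqVlt; apply/orP; left; apply/eqP; field. by rewrite gt_eqF.
have r01 : 0 <= r < 1.
  rewrite /r subr_ge0 ler_pdivrMr// mul1r gtrBl divr_gt0// andbT.
  have : 1 <= N by rewrite /N ler1n -(ltr0n R).
  lra.
have est0 : est 2.
  move=> f d fd; apply: (le_trans (covar_trivial fd g1)).
  rewrite mulr_sumr; apply: ler_sum => e _; rewrite ler_wpM2r ?(osc_ge0 _ fd)//.
  by rewrite /a; case: ifP => // _; rewrite lerDr.
have estn n : est (2 * r ^+ n).
  elim: n => [|n IH]; first by rewrite expr0 mulr1.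
  by rewrite exprSr mulrA; apply: step => //; case/andP: r01 => r0 _; rewrite mulr_ge0// exprn_ge0.
have osc0 : osc_bound (fun x => (x e0)%:R : R) (fun e => (e == e0)%:R).
  move=> e x; rewrite !updE eq_sym; case: eqP => _; last by rewrite subrr normr0.
  by rewrite subr0 normr1.
have bnd n : `|covar (fun x => (x e0)%:R) g| <= kappa + 2 * r ^+ n.
  apply: (le_trans (estn n _ _ osc0)); rewrite (bigD1 e0)//= eqxx mulr1.
  rewrite big1 ?addr0; last by move=> e /negPf ->; rewrite mulr0.
  by rewrite /a (negPf e0B).
have cv : (kappa + 2 * r ^+ n) @[n --> \oo] --> kappa + 2 * 0.
  apply: cvgD; first exact: cvg_cst.
  apply: cvgM; first exact: cvg_cst.
  apply: cvg_expr; by case/andP: r01 => r0 r1; rewrite ger0_norm.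
rewrite mulr0 addr0 in cv.
rewrite -/kappa -(cvg_lim _ cv)//; apply: limr_ge; first by apply/cvg_ex; exists kappa.
by apply: nearW.
Qed.

End Dobrushin.

(** * Moments of weakly dependent edge indicators *)

Section ProductMoments.
Variables (R : realType) (E : finType) (mu : {ffun E -> bool} -> R).
Hypothesis mu_gt0 : forall x, 0 < mu x.
Hypothesis mu_sum1 : \sum_x mu x = 1.

(** The candidate mean [p] is part of the definition, so that with [eps] equal to 0
    it also describes independent sites of density [p]. *)
Definition almost_indep (r : nat) (p eps : R) :=
  forall (B : {set E}) (e : E) (g : {ffun E -> bool} -> R),
    (#|B| <= r)%N -> e \notin B ->
    (forall f, f \notin B -> indep_of g f) -> (forall x, `|g x| <= 1) ->
    `|expect mu (fun x => ((x e)%:R - p) * g x)| <= eps.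

(** Peel off one factor: x_e - c = (x_e - p) + (p - c), and the first part is almost
    orthogonal to the remaining product. *)
Lemma expect_prod r (p eps c : R) (s : seq E) :
  almost_indep r p eps -> 0 <= p <= 1 -> 0 <= c <= 1 -> uniq s -> (size s <= r)%N ->
  `|expect mu (fun x => \prod_(e <- s) ((x e)%:R - c)) - (p - c) ^+ size s|
    <= (size s)%:R * eps.
Proof.
move=> ai /andP[p0 p1] /andP[c0 c1].
have Y1 (b : bool) : `|b%:R - c| <= 1 by rewrite ler_norml; case: b => /=; lra.
have pc1 : `|p - c| <= 1 by rewrite ler_norml; lra.
elim: s => [|e s IH] /=.
  move=> _ _; under eq_expect do rewrite big_nil.
  by rewrite expect_cst// expr0 subrr normr0 mul0r.
move=> /andP[es us] sr.
pose g (x : {ffun E -> bool}) := \prod_(e' <- s) ((x e')%:R - c).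
have -> : expect mu (fun x => \prod_(e' <- e :: s) ((x e')%:R - c)) =
    expect mu (fun x => ((x e)%:R - p) * g x) + (p - c) * expect mu g.
  by rewrite -expectZ -expectD; apply: eq_expect => x; rewrite big_cons /g; ring.
have h1 : `|expect mu (fun x => ((x e)%:R - p) * g x)| <= eps.
  apply: (ai [set e' in s]%SET e g).
  - by rewrite cardsE; apply: leq_trans (ltnW sr); exact: card_size.
  - by rewrite inE.
  - move=> f; rewrite inE => fs x b; apply: eq_big_seq => e' e's.
    by rewrite updE; case: eqP => // e'f; rewrite -e'f e's in fs.
  - move=> x; rewrite normr_prod; elim: (s) => [|e' s' IH']; first by rewrite big_nil.
    by rewrite big_cons mulr_ile1// prodr_ge0.
have h2 := IH us (ltnW sr).
rewrite exprS -addrA -mulrBr -natr1 [leRHS]mulrDl mul1r [leRHS]addrC.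
apply: (le_trans (ler_normD _ _)); apply: lerD => //.
by rewrite normrM -[leRHS]mul1r ler_pM.
Qed.

End ProductMoments.

Lemma prod_natb (R : comNzRingType) (I : finType) (A : {pred I}) (b : I -> bool) :
  \prod_(i in A) ((b i)%:R : R) = ([forall i in A, b i])%:R.
Proof.
case: (boolP [forall i in A, b i]) => [/forall_inP h|].
  by apply: big1 => i /h ->.
by move=> /forall_inPn[i iA /negPf bi]; rewrite (bigD1 i)//= bi mul0r.
Qed.

(** * Averages over random maps *)

Section Average.
Variables (R : realType) (m n : nat).
Hypothesis n_gt0 : (0 < n)%N.

(** The expectation over a uniformly random map phi.  The values of phi are
    independent, so prescribing some of them costs a factor 1/n each; this replaces
    the counting of maps. *)
Definition avg (F : {ffun 'I_m -> 'I_n} -> R) : R := (n%:R ^+ m)^-1 * \sum_phi F phi.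

Let nR : (n%:R : R) != 0. Proof. by rewrite pnatr_eq0 -lt0n. Qed.
Let inv_ge0 : 0 <= (n%:R ^+ m : R)^-1. Proof. by rewrite invr_ge0 exprn_ge0. Qed.

Lemma eq_avg F G : F =1 G -> avg F = avg G.
Proof. by move=> FG; congr (_ * _); apply: eq_bigr. Qed.

Lemma avg_prod (F : 'I_m -> 'I_n -> R) :
  avg (fun phi => \prod_k F k (phi k)) = \prod_k (n%:R^-1 * \sum_a F k a).
Proof.
rewrite /avg big_split /= bigA_distr_bigA prodr_const card_ord exprVn.
by [].
Qed.

Lemma avg_pin (S : {set 'I_m}) (a : 'I_m -> 'I_n) :
  avg (fun phi => ([forall k in S, phi k == a k])%:R) = n%:R ^- #|S|.
Proof.
transitivity (avg (fun phi => \prod_k (if k \in S then (phi k == a k)%:R else 1))).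
  by apply: eq_avg => phi; rewrite -big_mkcond prod_natb.
rewrite (avg_prod (fun k b => if k \in S then (b == a k)%:R else 1)).
rewrite -exprVn -prodr_const [RHS]big_mkcond /=; apply: eq_bigr => k _.
case: ifP => kS; last by rewrite sumr_const card_ord mulVf.
rewrite (bigD1 (a k))//= eqxx big1 ?addr0 ?mulr1// => b /negPf ->//.
Qed.

Lemma avg_pin2 i j a b : i != j ->
  avg (fun phi => ((phi i == a) && (phi j == b))%:R) = n%:R ^- 2.
Proof.
move=> ij; pose v k := if k == i then a else b.
transitivity (avg (fun phi => ([forall k in [set i; j]%SET, phi k == v k])%:R)).
  apply: eq_avg => phi; congr (nat_of_bool _)%:R; apply/andP/forall_inP.
    move=> [/eqP h1 /eqP h2] k; rewrite !inE /v => /orP[]/eqP ->; first by rewrite eqxx h1.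
    by rewrite (eq_sym j i) (negPf ij) h2.
  move=> h; have := h i; have := h j; rewrite !inE !eqxx orbT /v eqxx => /(_ isT) + /(_ isT).
  by rewrite (eq_sym j i) (negPf ij).
by rewrite avg_pin cards2 ij.
Qed.

Lemma avg_pin3 i j k a b c : i != j -> k != i -> k != j ->
  avg (fun phi => [&& phi i == a, phi j == b & phi k == c]%:R) = n%:R ^- 3.
Proof.
move=> ij ki kj; pose v l := if l == i then a else if l == j then b else c.
transitivity (avg (fun phi => ([forall l in [set i; j; k]%SET, phi l == v l])%:R)).
  apply: eq_avg => phi; congr (nat_of_bool _)%:R; apply/and3P/forall_inP.
    move=> [/eqP h1 /eqP h2 /eqP h3] l; rewrite !inE /v => /orP[/orP[]|]/eqP ->.
    - by rewrite eqxx h1.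
    - by rewrite (eq_sym j i) (negPf ij) eqxx h2.
    - by rewrite (negPf ki) (negPf kj) h3.
  move=> h; have := h i; have := h j; have := h k.
  rewrite !inE !eqxx !orbT /v eqxx eqxx (negPf ki) (negPf kj) (eq_sym j i) (negPf ij).
  by move=> /(_ isT) + /(_ isT) + /(_ isT).
by rewrite avg_pin finset.setUC cardsU1 cards2 ij !inE negb_or ki kj.
Qed.

Lemma ler_avg F G : (forall phi, F phi <= G phi) -> avg F <= avg G.
Proof. by move=> FG; apply: ler_wpM2l => //; apply: ler_sum. Qed.

Lemma avgD F G : avg (fun phi => F phi + G phi) = avg F + avg G.
Proof. by rewrite /avg big_split /= mulrDr. Qed.

Lemma avgB F G : avg (fun phi => F phi - G phi) = avg F - avg G.
Proof. by rewrite /avg sumrB mulrBr. Qed.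

Lemma avgZ c F : avg (fun phi => c * F phi) = c * avg F.
Proof. by rewrite /avg -mulr_sumr mulrCA. Qed.

Lemma avg_sum (I : Type) (r : seq I) (P : pred I) (F : I -> _ -> R) :
  avg (fun phi => \sum_(i <- r | P i) F i phi) = \sum_(i <- r | P i) avg (F i).
Proof. by rewrite /avg exchange_big /= mulr_sumr. Qed.

Lemma avg_cst (c : R) : avg (fun=> c) = c.
Proof.
rewrite /avg sumr_const card_ffun !card_ord -[X in _ * X]mulr_natl natrX mulrA mulVf ?mul1r//.
by rewrite expf_neq0.
Qed.

Lemma ler_norm_avg F G : (forall phi, `|F phi| <= G phi) -> `|avg F| <= avg G.
Proof.
move=> FG; rewrite /avg normrM (ger0_norm inv_ge0) ler_wpM2l//.
by apply: (le_trans (ler_norm_sum _ _ _)); apply: ler_sum.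
Qed.

(** Union bound over pairs of points, each of which collides with probability 1/n. *)
Lemma avg_noninj : avg (fun phi => (~~ injectiveb phi)%:R) <= (m%:R ^+ 2) / n%:R.
Proof.
apply: (@le_trans _ _ (avg (fun phi => \sum_(i : 'I_m) \sum_(j | j != i)
    \sum_a ((phi i == a) && (phi j == a))%:R))).
  apply: ler_avg => phi; case: (boolP (injectiveb phi)) => [_|ninj].
    by apply: sumr_ge0 => i _; apply: sumr_ge0 => j _; apply: sumr_ge0.
  have [i [j [ij eij]]] : exists i j, j != i /\ phi i = phi j.
    move/injectivePn : ninj => [i [j ij e]]; exists j, i; split=> //.
  rewrite (bigD1 i)//= (bigD1 j)//= (bigD1 (phi i))//= eqxx -eij eqxx /= -!addrA lerDl.
  by rewrite !addr_ge0// ?sumr_ge0// => *; rewrite ?sumr_ge0// => *; rewrite ?sumr_ge0.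
rewrite avg_sum.
apply: (@le_trans _ _ (\sum_(i : 'I_m) \sum_(j : 'I_m) n%:R^-1)); last first.
  by rewrite !sumr_const !card_ord -mulrnA -[leLHS]mulr_natl natrM -expr2.
apply: ler_sum => i _; rewrite avg_sum [leRHS](bigID (fun j => j != i))/=.
apply: ler_wpDr; first by apply: sumr_ge0 => *; rewrite invr_ge0.
apply: ler_sum => j ji; rewrite avg_sum.
rewrite (eq_bigr (fun=> n%:R ^- 2)); last by move=> a _; rewrite avg_pin2// eq_sym.
by rewrite sumr_const card_ord -[leLHS]mulr_natl expr2 invfM mulrA mulfV// mul1r.
Qed.

End Average.

(** * Graphs as edge configurations *)

Section Sites.
Variable n : nat.

Definition site := {e : 'I_n * 'I_n | (e.1 < e.2)%N}.
Definition config := {ffun site -> bool}.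

(** [None] exactly on the diagonal. *)
Definition site_of (i j : 'I_n) : option site :=
  insub (if (i < j)%N then (i, j) else (j, i)).

Definition adjb (x : config) i j : bool := oapp x false (site_of i j).

Lemma site_ofC i j : site_of i j = site_of j i.
Proof.
rewrite /site_of; case: (ltngtP i j) => // ij.
by have -> : i = j by apply/val_inj.
Qed.

Lemma site_of_refl i : site_of i i = None.
Proof. rewrite /site_of ltnn; apply: insubF; exact: ltnn. Qed.

Lemma site_of_val (e : site) : site_of (val e).1 (val e).2 = Some e.
Proof. by rewrite /site_of (valP e) -surjective_pairing valK. Qed.

Lemma site_ofP i j e : site_of i j = Some e ->
  (i = (val e).1 /\ j = (val e).2) \/ (i = (val e).2 /\ j = (val e).1).
Proof.
rewrite /site_of; case: insubP => // e' _ ve' [<-]; rewrite ve'.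
by case: ifP => _; [left|right].
Qed.

Lemma site_of_neq i j : i != j -> exists e, site_of i j = Some e.
Proof.
move=> ij; rewrite /site_of; case: insubP => [e _ _|]; first by exists e.
case: (ltngtP i j) => [ij' |ij' |e] /=; rewrite ?ij'//; case/eqP: ij; exact/val_inj.
Qed.

Lemma adjbC x i j : adjb x i j = adjb x j i.
Proof. by rewrite /adjb site_ofC. Qed.

Lemma adjb_refl x i : adjb x i i = false.
Proof. by rewrite /adjb site_of_refl. Qed.

Lemma adjb_upd x e b i j :
  adjb (upd x e b) i j = if site_of i j == Some e then b else adjb x i j.
Proof. by rewrite /adjb; case: (site_of i j) => //= e'; rewrite updE. Qed.

Lemma adjb_val x (e : site) : adjb x (val e).1 (val e).2 = x e.
Proof. by rewrite /adjb site_of_val. Qed.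

Lemma adjb_inj x y : (forall i j, adjb x i j = adjb y i j) -> x = y.
Proof. by move=> xy; apply/ffunP => e; rewrite -!adjb_val. Qed.

Definition config_of (G : sgraph n) : config := [ffun e : site => val e \in adj G].

Lemma adj_sym (G : sgraph n) i j : ((i, j) \in adj G) = ((j, i) \in adj G).
Proof. by case/andP: (adj_simple G) => _ /forallP/(_ i)/forallP/(_ j)/eqP. Qed.

Lemma adj_irr (G : sgraph n) i : ((i, i) \in adj G) = false.
Proof. by case/andP: (adj_simple G) => /forallP/(_ i)/negPf. Qed.

Lemma adjb_config G i j : adjb (config_of G) i j = ((i, j) \in adj G).
Proof.
case: (eqVneq i j) => [->|ij]; first by rewrite adjb_refl adj_irr.
have [e He] := site_of_neq ij; rewrite /adjb He /= ffunE.
by case: (site_ofP He) => -[-> ->]; [|rewrite adj_sym]; rewrite -surjective_pairing.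
Qed.

Lemma graph_of_simple x : is_simple [set p : 'I_n * 'I_n | adjb x p.1 p.2].
Proof.
apply/andP; split; first by apply/forallP => i; rewrite inE /= adjb_refl.
by apply/forallP => i; apply/forallP => j; rewrite !inE /= adjbC.
Qed.

Definition graph_of x : sgraph n := SGraph (graph_of_simple x).

Lemma graph_ofK : cancel graph_of config_of.
Proof. by move=> x; apply: adjb_inj => i j; rewrite adjb_config inE. Qed.

Lemma config_ofK : cancel config_of graph_of.
Proof.
move=> G; apply/val_inj/setP => -[i j] /=.
by rewrite inE /= adjb_config.
Qed.

Lemma sum_config (R : nmodType) (F : config -> R) :
  \sum_(G : sgraph n) F (config_of G) = \sum_x F x.
Proof.
rewrite [RHS](reindex config_of)//; exists graph_of => ? _; [exact: config_ofK|exact: graph_ofK].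
Qed.

Lemma card_site : (#|{: site}| * 2 + n = n * n)%N.
Proof.
have -> : (n * n)%N = #|{: 'I_n * 'I_n}| by rewrite card_prod card_ord.
rewrite card_sig muln2 -addnn.
rewrite -(cardC [pred p : 'I_n * 'I_n | (p.1 < p.2)%N]) -addnA; congr (_ + _)%N.
rewrite -[RHS](cardID [pred p : 'I_n * 'I_n | p.1 == p.2]) addnC; congr (_ + _)%N.
  transitivity #|'I_n|; first by rewrite card_ord.
  rewrite -(card_imset _ (f := fun i : 'I_n => (i, i))); last by move=> i j [].
  apply: eq_card => -[i j]; rewrite !inE /= -leqNgt; apply/imsetP/andP.
    by move=> [k _ [-> ->]].
  by move=> [_ /eqP ->]; exists j.
rewrite -(card_imset _ (f := fun p : 'I_n * 'I_n => (p.2, p.1))); last first.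
  by move=> [i j] [i' j'] [-> ->].
apply: eq_card => -[i j]; rewrite !inE /= -leqNgt; apply/imsetP/andP.
  by move=> [[i' j'] + [-> ->]]; rewrite inE /= => h; rewrite ltnW// -val_eqE/= gtn_eqF.
move=> [ij ji]; exists (j, i) => //; rewrite inE /= ltn_neqAle ji andbT.
by rewrite -val_eqE eq_sym in ij.
Qed.

End Sites.

(** * The logistic function *)

Section Logistic.
Variable R : realType.

Definition logistic (t : R) : R := (1 + expR (- t))^-1.

Lemma logistic_itv t : 0 < logistic t < 1.
Proof.
have h := expR_gt0 (- t).
by rewrite /logistic invr_gt0 invf_lt1 ?ltrDl ?addr_gt0.
Qed.

Lemma is_derive_logistic (t : R) :
  is_derive t (1 : R) logistic (expR (- t) / (1 + expR (- t)) ^+ 2).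
Proof.
have h : 1 + expR (- t) != 0 by rewrite gt_eqF// addr_gt0// expR_gt0.
rewrite /logistic; apply: is_derive_eq.
rewrite /GRing.scale /=. by field.
Qed.

Lemma logistic_lipschitz a b : `|logistic a - logistic b| <= 4^-1 * `|a - b|.
Proof.
wlog ab : a b / b <= a.
  by move=> H; case: (leP b a) => [|/ltW] /H //; rewrite distrC (distrC b a).
have cont : {within `[b, a], continuous logistic}.
  apply: derivable_within_continuous => x _.
  by have := is_derive_logistic x; case.
have [c _ ->] := MVT_segment ab (fun x _ => is_derive_logistic x) cont.
have h := expR_gt0 (- c).
rewrite normrM ler_wpM2r// ger0_norm; last first.
  by rewrite divr_ge0 ?ltW// exprn_ge0// addr_ge0// ltW.
rewrite ler_pdivrMr; last by rewrite exprn_gt0// addr_gt0.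
have := sqr_ge0 (1 - expR (- c)); nra.
Qed.

End Logistic.

(** * Expected densities *)

Section Densities.
Variables (R : realType) (n m : nat) (D : {set 'I_m * 'I_m}).
Hypothesis n_gt0 : (0 < n)%N.
Hypothesis D_lt : forall p, p \in D -> (p.1 < p.2)%N.

(** For c = 0 this is the homomorphism density; for general c every edge carries the
    weight 1_edge - c, which for the 4-cycle controls the distance to the
    constant c. *)
Definition dens (c : R) (x : config n) : R :=
  avg (fun phi : {ffun 'I_m -> 'I_n} =>
    \prod_(p in D) ((adjb x (phi p.1) (phi p.2))%:R - c)).

Definition is_hom (phi : {ffun 'I_m -> 'I_n}) (x : config n) : bool :=
  [forall p in D, adjb x (phi p.1) (phi p.2)].

Lemma dens0E x : dens 0 x = avg (fun phi => (is_hom phi x)%:R).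
Proof.
by apply: eq_avg => phi; under eq_bigr do rewrite subr0; rewrite prod_natb.
Qed.

(** An injective map sends distinct pairs to distinct sites, so that [expect_prod]
    applies to the product over the pairs. *)
Lemma inj_sites (phi : {ffun 'I_m -> 'I_n}) (l : seq ('I_m * 'I_m)) (c : R) :
  injective phi -> {subset l <= D} -> uniq l ->
  exists s : seq (site n), [/\ uniq s, size s = size l,
    forall e, e \in s -> exists2 p, p \in l & site_of (phi p.1) (phi p.2) = Some e &
    forall x : config n, \prod_(p <- l) ((adjb x (phi p.1) (phi p.2))%:R - c) =
              \prod_(e <- s) ((x e)%:R - c)].
Proof.
move=> phi_inj; elim: l => [|p l IH] lD.
  by move=> _; exists [::]; split=> // x; rewrite !big_nil.
move=> /= /andP[pl ul].
have [|s [us ss sP sE]] := IH _ ul.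
  by move=> q ql; apply: lD; rewrite in_cons ql orbT.
have pD : p \in D by apply: lD; rewrite mem_head.
have pne : phi p.1 != phi p.2.
  by apply: contraTneq (D_lt pD) => /phi_inj ->; rewrite ltnn.
have [e He] := site_of_neq pne.
exists (e :: s); split => /=.
- rewrite us andbT; apply/negP => /sP[q ql Hq].
  have qD : q \in D by apply: lD; rewrite in_cons ql orbT.
  have := D_lt pD; have := D_lt qD.
  suff : p = q \/ (p.1 = q.2 /\ p.2 = q.1).
    case=> [pq|[-> ->] h1 h2]; first by rewrite pq ql in pl.
    by have := ltn_trans h1 h2; rewrite ltnn.
  case: (site_ofP He) => -[h1 h2]; case: (site_ofP Hq) => -[h3 h4];
    rewrite -?h3 -?h4 in h1 h2;
    move/phi_inj : h1 => h1; move/phi_inj : h2 => h2;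
    solve [by right | by left; rewrite (surjective_pairing p) h1 h2 -surjective_pairing].
- by rewrite ss.
- move=> e'; rewrite in_cons => /orP[/eqP ->|/sP[q ql <-]].
    by exists p => //; rewrite mem_head.
  by exists q => //; rewrite in_cons ql orbT.
- by move=> x; rewrite !big_cons sE /adjb He.
Qed.

(** Injective maps contribute moments of distinct sites; the other maps are rare. *)
Lemma expect_dens (mu : config n -> R) r (p c eps : R) :
  (forall x, 0 < mu x) -> \sum_x mu x = 1 ->
  almost_indep mu r p eps -> 0 <= eps -> 0 <= p <= 1 -> 0 <= c <= 1 -> (#|D| <= r)%N ->
  `|expect mu (dens c) - (p - c) ^+ #|D| | <= #|D|%:R * eps + 2 * (m%:R ^+ 2 / n%:R).
Proof.
move=> mu0 mu1 ai eps0 p01 c01 Dr.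
have /andP[p0 p1] := p01; have /andP[c0 c1] := c01.
have Y1 (b : bool) : `|b%:R - c| <= 1 by rewrite ler_norml; case: b => /=; lra.
have pc1 : `|p - c| <= 1 by rewrite ler_norml; lra.
pose F (phi : {ffun 'I_m -> 'I_n}) (x : config n) :=
  \prod_(p in D) ((adjb x (phi p.1) (phi p.2))%:R - c).
have -> : expect mu (dens c) - (p - c) ^+ #|D| =
    avg (fun phi => expect mu (F phi) - (p - c) ^+ #|D|).
  rewrite avgD avg_cst// /dens /avg; congr (_ - _).
  by rewrite -expect_sum -expectZ.
have F1 phi x : `|F phi x| <= 1.
  rewrite normr_prod; apply: prodr_ile1 => q _; exact/andP.
apply: (@le_trans _ _ (avg (fun phi : {ffun 'I_m -> 'I_n} =>
    #|D|%:R * eps + 2 * (~~ injectiveb phi)%:R))); last first.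
  by rewrite avgD avg_cst// avgZ lerD2l ler_wpM2l//; exact: avg_noninj.
apply: ler_norm_avg => // phi.
case: (boolP (injectiveb phi)) => [/injectiveP phi_inj|_] /=.
  have [|s [us ss _ sE]] := @inj_sites phi (enum D) c phi_inj _ (enum_uniq D).
    by move=> q; rewrite mem_enum.
  have -> : expect mu (F phi) = expect mu (fun x => \prod_(e <- s) ((x e)%:R - c)).
    by apply: eq_expect => x; rewrite -sE /F big_enum.
  rewrite mulr0 addr0; rewrite -cardE in ss; rewrite -ss; apply: (expect_prod _ ai) => //.
  by rewrite ss.
rewrite mulr1; apply: (le_trans (ler_normB _ _)).
apply: (@le_trans _ _ (1 + 1)); last by have := mulr_ge0 (ler0n R #|D|) eps0; lra.
by rewrite lerD ?ler_norm_expect// normrX exprn_ile1.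
Qed.

End Densities.

(** * Mixed second differences of homomorphism counts *)

Section SecondDifference.
Variables (R : realType) (n m : nat) (D : {set 'I_m * 'I_m}).
Hypothesis n_gt0 : (0 < n)%N.
Hypothesis D_lt : forall p, p \in D -> (p.1 < p.2)%N.
Implicit Types (phi : {ffun 'I_m -> 'I_n}) (e f : site n) (x : config n).

Definition covers phi e (p : 'I_m * 'I_m) : bool := site_of (phi p.1) (phi p.2) == Some e.

Lemma is_hom_upd_le phi x e : is_hom D phi (upd x e false) -> is_hom D phi (upd x e true).
Proof. 
move=> /forall_inP h; apply/forall_inP => p /h.
by rewrite !adjb_upd; case: eqP.
Qed.

Lemma is_hom_upd_neq phi x e b b' : ~~ [exists p in D, covers phi e p] ->
  is_hom D phi (upd x e b) = is_hom D phi (upd x e b').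
Proof. 
move=> /exists_inPn h; apply: eq_forallb => p; apply: implyb_id2l => /h.
by rewrite /covers !adjb_upd => /negPf ->.
Qed.

Definition hom_at phi x e f b b' : R := (is_hom D phi (upd (upd x f b) e b'))%:R.

(** As a function of the states of [e] and [f], the indicator of being a homomorphism
    is monotone, and it depends on a state only if some edge of the pattern lies over
    that site.  So the mixed difference vanishes unless both sites are covered, by
    different edges since [e] and [f] differ, and it never exceeds 1. *)
Lemma hom_second_difference phi x e f : f != e ->
  let h := hom_at phi x e f in is_true (
  `|(h true true - h true false) - (h false true - h false false)| <=
  \sum_(p in D) \sum_(q in D | q != p) (covers phi e p && covers phi f q)%:R).
Proof. 
move=> fe h; rewrite {}/h /hom_at.
have [eD|eD] := boolP [exists p in D, covers phi e p]; last first.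
  rewrite !(is_hom_upd_neq _ true false eD) !subrr normr0.
  by apply: sumr_ge0 => p _; apply: sumr_ge0.
have [fD|fD] := boolP [exists p in D, covers phi f p]; last first.
  rewrite !(updC x _ _ fe) !(is_hom_upd_neq _ true false fD) subrr normr0.
  by apply: sumr_ge0 => p _; apply: sumr_ge0.
have [p pD pe] := exists_inP eD; have [q qD qf] := exists_inP fD.
have qp : q != p.
  apply: contraNneq fe => qp; move: pe qf; rewrite /covers qp => /eqP -> /eqP [->].
  exact: eqxx.
rewrite (bigD1 p)//= (bigD1 q) ?qD//= pe qf /=.
apply: ler_wpDr; first by apply: sumr_ge0 => *; apply: sumr_ge0.
apply: ler_wpDr; first by apply: sumr_ge0.
have h1 := @is_hom_upd_le phi (upd x f true) e.
have h2 := @is_hom_upd_le phi (upd x f false) e.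
 move: h1 h2.
do 4 case: is_hom => //=; move=> h1 h2;
  rewrite ?subrr ?subr0 ?sub0r ?normrN ?normr1 ?normr0 ?ler01 ?lexx//;
  by [have := h1 isT|have := h2 isT].
Qed.

(** A pair lies over [e] in one of two orientations. *)
Lemma avg_over e (p : 'I_m * 'I_m) : p \in D ->
  avg (fun phi => (covers phi e p)%:R : R) <= 2 / n%:R ^+ 2.
Proof. 
move=> pD; have p12 : p.1 != p.2.
  by apply: contraTneq (D_lt pD) => ->; rewrite ltnn.
have -> : 2 / n%:R ^+ 2 = n%:R ^- 2 + n%:R ^- 2 :> R by rewrite mulr_natl mulr2n.
rewrite -{1}(avg_pin2 R n_gt0 (val e).1 (val e).2 p12).
rewrite -(avg_pin2 R n_gt0 (val e).2 (val e).1 p12) -avgD.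
apply: ler_avg => phi; case: (boolP (covers phi e p)) => [/eqP/site_ofP|_]; last by rewrite addr_ge0.
by move=> [[-> ->]|[-> ->]]; rewrite !eqxx ?lerDl ?lerDr.
Qed.

(** Two different edges of the pattern span at least three vertices, and the values of
    the map at these are prescribed up to four choices. *)
Lemma avg_over2 e f (p q : 'I_m * 'I_m) : p \in D -> q \in D -> q != p ->
  avg (fun phi => (covers phi e p && covers phi f q)%:R : R) <= 4 / n%:R ^+ 3.
Proof. 
move=> pD qD qp; have p12 : p.1 != p.2.
  by apply: contraTneq (D_lt pD) => ->; rewrite ltnn.
have [k [kq k1 k2]] : exists k, [/\ k = q.1 \/ k = q.2, k != p.1 & k != p.2].
  have p12' := D_lt pD; have q12' := D_lt qD.
  have [q1|q1] := boolP ((q.1 != p.1) && (q.1 != p.2)).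
    by exists q.1; split; [left| |]; case/andP: q1.
  exists q.2; split; [by right| |].
  - apply/eqP => q2; move: q1; rewrite negb_and !negbK => /orP[]/eqP q1.
      by move: q12'; rewrite q1 q2 ltnn.
    by move: q12'; rewrite q1 q2 => h; have := ltn_trans h p12'; rewrite ltnn.
  - apply/eqP => q2; move: q1; rewrite negb_and !negbK => /orP[]/eqP q1.
      by case/eqP: qp; rewrite (surjective_pairing q) q1 q2 -surjective_pairing.
    by move: q12'; rewrite q1 q2 ltnn.
have pin a b c := avg_pin3 R n_gt0 a b c p12 k1 k2.
have -> : 4 / n%:R ^+ 3 = n%:R ^- 3 + n%:R ^- 3 + (n%:R ^- 3 + n%:R ^- 3) :> R.
  by rewrite mulr_natl -mulr2n -mulr2n -mulrnA.
rewrite -{1}(pin (val e).1 (val e).2 (val f).1) -{1}(pin (val e).1 (val e).2 (val f).2).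
rewrite -{1}(pin (val e).2 (val e).1 (val f).1) -(pin (val e).2 (val e).1 (val f).2).
rewrite -!avgD; apply: ler_avg => phi.
case: (boolP (covers phi e p && covers phi f q)) => [|_]; last by rewrite !addr_ge0.
move=> /andP[/eqP/site_ofP pe /eqP/site_ofP qf].
have kf : phi k = (val f).1 \/ phi k = (val f).2.
  by case: kq => ->; case: qf => -[h1 h2]; rewrite ?h1 ?h2; solve [by left | by right].
have sum4 (a b c d : bool) : [|| a, b, c | d] -> 1 <= a%:R + b%:R + (c%:R + d%:R) :> R.
  by case: a; case: b; case: c; case: d => //= _; lra.
by apply: sum4; case: pe => -[-> ->]; case: kf => ->; rewrite !eqxx ?orbT.
Qed.

End SecondDifference.

(** * Invariance under relabelling of the vertices *)

Lemma edges_lt m (G : sgraph m) p : p \in edges G -> (p.1 < p.2)%N.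
Proof. by rewrite inE => /andP[]. Qed.

Section Relabelling.
Variables (n : nat).

Definition relabel_config (s : {perm 'I_n}) (x : config n) : config n :=
  [ffun e : site n => adjb x (s (val e).1) (s (val e).2)].

Lemma adjb_relabel s x i j : adjb (relabel_config s x) i j = adjb x (s i) (s j).
Proof.
case: (eqVneq i j) => [->|ij]; first by rewrite !adjb_refl.
have [e He] := site_of_neq ij; rewrite {1}/adjb He /= ffunE.
by case: (site_ofP He) => -[-> ->] //; rewrite adjbC.
Qed.

Lemma relabel_config_inj s : injective (relabel_config s).
Proof.
move=> x y xy; apply: adjb_inj => i j.
by rewrite -(permKV s i) -(permKV s j) -!adjb_relabel xy.
Qed.

Lemma dens_relabel (R : realType) m (D : {set 'I_m * 'I_m}) (c : R) s x :
  dens D c (relabel_config s x) = dens D c x.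
Proof.
rewrite /dens /avg; congr (_ * _).
pose h (phi : {ffun 'I_m -> 'I_n}) := [ffun k => s (phi k)].
have hinj : injective h.
  move=> phi psi /ffunP hh; apply/ffunP => k.
  by have := hh k; rewrite !ffunE => /perm_inj.
rewrite [RHS](reindex_inj hinj); apply: eq_bigr => phi _.
by apply: eq_bigr => p _; rewrite adjb_relabel !ffunE.
Qed.

Lemma site_transitive (e f : site n) : exists s : {perm 'I_n},
  s (val e).1 = (val f).1 /\ s (val e).2 = (val f).2.
Proof.
have ne : (val e).1 != (val e).2.
  by apply: contraTneq (valP e) => ->; rewrite ltnn.
have nf : (val f).1 != (val f).2.
  by apply: contraTneq (valP f) => ->; rewrite ltnn.
set i := (val e).1 in ne *; set j := (val e).2 in ne *.
set k := (val f).1 in nf *; set l := (val f).2 in nf *.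
exists (tperm i k * tperm (tperm i k j) l)%g; rewrite !permM tpermL tpermL; split => //.
apply: tpermD; last by rewrite eq_sym.
by rewrite -[X in _ != X](tpermL i k) (inj_eq perm_inj) eq_sym.
Qed.

End Relabelling.

(** * The Gibbs measure and its influences *)

Section Gibbs.
Variables (R : realType) (k : nat).
Variables (H : 'I_k.+1 -> {m : nat & sgraph m}) (beta : 'I_k.+1 -> R).
Variable (n : nat).
Hypothesis n_gt0 : (0 < n)%N.
Implicit Types (x : config n) (e f : site n).

Definition energy x : R := \sum_(i < k.+1) beta i * dens (edges (tagged (H i))) 0 x.

Definition partition_function : R := \sum_(x : config n) expR (n%:R ^+ 2 * energy x).

Definition gibbs x : R := expR (n%:R ^+ 2 * energy x) / partition_function.

(** The number [gamma] of the opening comment; a graph with a single edge contributes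
    nothing to it. *)
Definition influence_sum : R :=
  2^-1 * \sum_(i < k.+1) `|beta i| * (eH H i)%:R * ((eH H i)%:R - 1).

Lemma partition_function_gt0 : 0 < partition_function.
Proof.
rewrite /partition_function (bigD1 [ffun=> false])//=.
by rewrite ltr_wpDr ?expR_gt0// sumr_ge0// => *; exact: expR_ge0.
Qed.

Lemma gibbs_gt0 x : 0 < gibbs x.
Proof. by rewrite divr_gt0 ?expR_gt0// partition_function_gt0. Qed.

Lemma gibbs_sum1 : \sum_x gibbs x = 1.
Proof. by rewrite -mulr_suml divff// gt_eqF// partition_function_gt0. Qed.

Lemma gibbs_relabel s x : gibbs (relabel_config s x) = gibbs x.
Proof.
rewrite /gibbs /energy; congr (expR (_ * _) / _).
by apply: eq_bigr => i _; rewrite dens_relabel.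
Qed.

Definition edge_prob (e : site n) : R := expect gibbs (fun x => (x e)%:R).

(** The symmetric group is transitive on pairs of vertices and preserves the
    measure. *)
Lemma edge_prob_cst e f : edge_prob e = edge_prob f.
Proof.
have [s [s1 s2]] := site_transitive e f.
rewrite /edge_prob /expect (reindex_inj (@relabel_config_inj n s)) /=.
by apply: eq_bigr => x _; rewrite gibbs_relabel -adjb_val adjb_relabel s1 s2 adjb_val.
Qed.

Lemma edge_prob_itv e : 0 < edge_prob e < 1.
Proof.
have pos b : 0 < expect gibbs (fun x => (x e == b)%:R).
  rewrite /expect (bigD1 [ffun=> b])//= ffunE eqxx mulr1.
  by rewrite ltr_wpDr ?gibbs_gt0// sumr_ge0// => x _; rewrite mulr_ge0// ltW// gibbs_gt0.
have -> : edge_prob e = expect gibbs (fun x => (x e == true)%:R).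
  by apply: eq_expect => x; rewrite eqb_id.
rewrite pos /= -subr_gt0.
suff -> : 1 - expect gibbs (fun x => (x e == true)%:R) = expect gibbs (fun x => (x e == false)%:R).
  exact: pos.
rewrite -[X in X - _](expect_cst gibbs_sum1 1) -[LHS]addrC -mulN1r -expectZ -expectD.
by apply: eq_expect => x; case: (x e) => /=; ring.
Qed.

Lemma cond_prob_gibbs e x :
  cond_prob gibbs e x = logistic (n%:R ^+ 2 * (energy (upd x e true) - energy (upd x e false))).
Proof.
have Z := partition_function_gt0.
rewrite /cond_prob /gibbs /logistic mulrBr opprB expRD expRN.
set a := expR _; set b := expR _.
have a0 : 0 < a by exact: expR_gt0.
have b0 : 0 < b by exact: expR_gt0.
field; rewrite !gt_eqF// addr_gt0//.
Qed.

(** The factor 1/4 is the Lipschitz constant of [logistic]; the sums bound the mixed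
    second difference of the energy in the states of [e] and [f]. *)
Definition influence e f : R := n%:R ^+ 2 / 4 * \sum_(i < k.+1) `|beta i| *
  \sum_(p in edges (tagged (H i))) \sum_(q in edges (tagged (H i)) | q != p)
     avg (fun phi : {ffun 'I_(tag (H i)) -> 'I_n} => (covers phi e p && covers phi f q)%:R).

Lemma influenceP e f x : f != e ->
  `|cond_prob gibbs e (upd x f true) - cond_prob gibbs e (upd x f false)| <= influence e f.
Proof.
move=> fe; rewrite !cond_prob_gibbs; apply: (le_trans (logistic_lipschitz _ _)).
rewrite -mulrBr normrM ger0_norm ?exprn_ge0// mulrA (mulrC 4^-1) /influence.
apply: ler_wpM2l.
  by rewrite divr_ge0// exprn_ge0.
rewrite /energy -!sumrB; apply: (le_trans (ler_norm_sum _ _ _)).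
apply: ler_sum => i _; rewrite -!(mulrBr (beta i)) normrM; apply: ler_wpM2l => //; rewrite !dens0E.
rewrite -!avgB.
under [leRHS]eq_bigr do rewrite -avg_sum.
rewrite -avg_sum; apply: ler_norm_avg => // phi.
exact: hom_second_difference.
Qed.

Lemma sum_edge_pairs i (F : R) :
  \sum_(p in edges (tagged (H i))) \sum_(q in edges (tagged (H i)) | q != p) F =
  (eH H i)%:R * ((eH H i)%:R - 1) * F.
Proof.
rewrite (eq_bigr (fun=> ((eH H i)%:R - 1) * F)).
  by rewrite sumr_const -[LHS]mulr_natl mulrA.
move=> p pD; rewrite sumr_const -[LHS]mulr_natl; congr (_ * _).
rewrite /eH /num_edges (cardsD1 p) pD natrD addrAC subrr add0r; congr _%:R.
by apply: eq_card => q; rewrite finset.in_setD1 unfold_in andbC.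
Qed.

(** Once the map is known, a pair q lies over at most one site f; so summing over f
    leaves the probability that p lies over [e]. *)
Lemma influence_row e : \sum_(f | f != e) influence e f <= influence_sum.
Proof.
rewrite /influence -mulr_sumr exchange_big /=.
have -> : influence_sum = n%:R ^+ 2 / 4 * \sum_(i < k.+1) `|beta i| *
    ((eH H i)%:R * ((eH H i)%:R - 1) * (2 / n%:R ^+ 2)).
  rewrite /influence_sum !mulr_sumr; apply: eq_bigr => i _.
  by field; rewrite pnatr_eq0 -lt0n.
apply: ler_wpM2l; first by rewrite divr_ge0 ?exprn_ge0.
apply: ler_sum => i _.
rewrite -mulr_sumr; apply: ler_wpM2l => //; rewrite -sum_edge_pairs exchange_big /=.
apply: ler_sum => p pD; rewrite exchange_big /=; apply: ler_sum => q qD.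
apply: le_trans (avg_over R n_gt0 (@edges_lt _ _) e pD).
rewrite -avg_sum; apply: ler_avg => // phi; rewrite /covers.
case: (site_of (phi q.1) (phi q.2)) => [f|]; last first.
  by rewrite big1// => f _; rewrite andbF.
apply: (@le_trans _ _ (\sum_(f' | f' == f) (site_of (phi p.1) (phi p.2) == Some e)%:R)).
  rewrite [leRHS]big_mkcond [leLHS]big_mkcond /=; apply: ler_sum => f' _.
  case: (eqVneq f' f) => [->|ne]; first by rewrite eqxx andbT; case: ifP.
  have -> : (Some f == Some f') = false by apply/negP => /eqP[]/esym/eqP; rewrite (negPf ne).
  by rewrite andbF; case: ifP.
by rewrite big_pred1_eq.
Qed.

Lemma influence_entry e f : influence e f <= 2 * influence_sum / n%:R.
Proof.
have -> : 2 * influence_sum / n%:R = n%:R ^+ 2 / 4 * \sum_(i < k.+1) `|beta i| *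
    ((eH H i)%:R * ((eH H i)%:R - 1) * (4 / n%:R ^+ 3)).
  rewrite /influence_sum !mulr_sumr mulr_suml; apply: eq_bigr => i _.
  by field; rewrite pnatr_eq0 -lt0n.
apply: ler_wpM2l; first by rewrite divr_ge0 ?exprn_ge0.
apply: ler_sum => i _.
apply: ler_wpM2l => //; rewrite -sum_edge_pairs; apply: ler_sum => p pD; apply: ler_sum => q /andP[qD qp].
exact: (avg_over2 R n_gt0 (@edges_lt _ _) _ _ pD qD qp).
Qed.

Lemma influence_sum_ge0 : 0 <= influence_sum.
Proof.
rewrite mulr_ge0 ?invr_ge0//; apply: sumr_ge0 => i _.
case: (eH H i) => [|a]; first by rewrite mulr0 mul0r.
by rewrite !mulr_ge0// subr_ge0 ler1n.
Qed.

Definition gibbs_eps (r : nat) : R :=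
  4 * r%:R * influence_sum / (1 - influence_sum) / n%:R.

Lemma gibbs_almost_indep r e0 : influence_sum < 1 ->
  almost_indep gibbs r (edge_prob e0) (gibbs_eps r).
Proof.
move=> s1 B e g Br eB gB g1; rewrite (edge_prob_cst e0 e).
have -> : expect gibbs (fun x => ((x e)%:R - edge_prob e) * g x) =
    covar gibbs (fun x => (x e)%:R) g.
  rewrite /covar -/(edge_prob e) -mulNr -expectZ -expectD.
  by apply: eq_expect => x; ring.
have := dobrushin_covar gibbs_gt0 gibbs_sum1 (fun e f x fe => @influenceP e f x fe)
  influence_row s1 (fun e f _ => influence_entry e f) gB g1 eB.
move/le_trans; apply; rewrite /gibbs_eps.
have n0 : (0 : R) < n%:R by rewrite ltr0n.
have -> : 4 * r%:R * influence_sum / (1 - influence_sum) / n%:R =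
  2 * r%:R * (2 * influence_sum / n%:R) / (1 - influence_sum).
  by field; rewrite (gt_eqF n0) gt_eqF ?subr_gt0.
have s0 := influence_sum_ge0.
apply: ler_wpM2r; first by rewrite invr_ge0 subr_ge0 ltW.
apply: ler_wpM2r; first exact: (divr_ge0 (mulr_ge0 (ler0n R 2) s0) (ltW n0)).
by apply: ler_wpM2l; rewrite ?ler_nat.
Qed.

End Gibbs.

(** * The binary Pinsker inequality *)

Section Pinsker.
Variable R : realType.
Implicit Types (u v t : R).

Lemma is_derive_ln_onem t : t < 1 ->
  is_derive t (1 : R) (fun x : R => ln (1 - x)) (- (1 - t)^-1).
Proof.
move=> t1; have t0 : 0 < 1 - t by rewrite subr_gt0.
have hl := is_derive1_ln t0.
have hi : is_derive t (1 : R) (fun x : R => 1 - x) (- 1).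
  by apply: is_derive_eq; ring.
have := @is_derive1_comp R (@ln R) (fun x : R => 1 - x) t _ _ hl hi.
by rewrite mulrN1.
Qed.

(** The boundary case v = 0 of [pinsker], where v ln u is absent.  The difference of
    the two sides has derivative (1 - 2t)^2 / (1 - t). *)
Lemma pinsker0 u : 0 <= u < 1 -> 2 * u ^+ 2 <= - ln (1 - u).
Proof.
move=> /andP[u0 u1]; pose f t := - ln (1 - t) - 2 * t ^+ 2.
pose df t := (1 - t)^-1 - 4 * t.
have der t : t < 1 -> is_derive t (1 : R) f (df t).
  move=> t1; have t1' : 0 < 1 - t by lra.
  have hl := is_derive_ln_onem t1.
  rewrite /f; apply: is_derive_eq; rewrite /df /GRing.scale /=.
  ring.
have cont : {within `[0, u], continuous f}.
  apply: derivable_within_continuous => x; rewrite in_itv /= => /andP[_ xu].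
  by have := der x (le_lt_trans xu u1); case.
have [|c] := MVT_segment u0 _ cont (df := df).
  by move=> x; rewrite in_itv /= => /andP[_ xu]; apply: der; exact: lt_trans xu u1.
rewrite in_itv /= => /andP[c0 cu] E.
have c1 : 0 < 1 - c by lra.
have : 0 <= f u - f 0.
  rewrite E subr0 mulr_ge0// /df.
  have -> : (1 - c)^-1 - 4 * c = (1 - 2 * c) ^+ 2 / (1 - c) by field; rewrite gt_eqF.
  by rewrite divr_ge0 ?sqr_ge0// ltW.
by rewrite /f !subr0 ln1 expr0n /= mulr0; lra.
Qed.

(** For fixed v the relative entropy minus 2 (v - t)^2, as a function of t, has
    derivative (t - v) (1 / (t (1 - t)) - 4), which has the sign of t - v; so it is
    smallest at t = v, where it vanishes. *)
Lemma pinsker u v : 0 < u < 1 -> 0 <= v <= 1 ->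
  2 * (v - u) ^+ 2 <= v * ln v + (1 - v) * ln (1 - v) - v * ln u - (1 - v) * ln (1 - u).
Proof.
move=> /andP[u0 u1] /andP[]; rewrite le_eqVlt => /predU1P[<- _|v0].
  by have := @pinsker0 u; rewrite (ltW u0) u1 => /(_ isT); rewrite !subr0 ln1; lra.
rewrite le_eqVlt => /predU1P[->|v1].
  have := @pinsker0 (1 - u); rewrite subr_ge0 (ltW u1) gtrBl u0 => /(_ isT).
  by rewrite subKr subrr ln1; lra.
pose f t := - v * ln t - (1 - v) * ln (1 - t) - 2 * (v - t) ^+ 2.
pose df t := (t - v) * ((t * (1 - t))^-1 - 4).
have der t : 0 < t < 1 -> is_derive t (1 : R) f (df t).
  move=> /andP[t0 t1]; have t1' : 0 < 1 - t by lra.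
  have hl := is_derive_ln_onem t1; have hl' := is_derive1_ln t0.
  rewrite /f; apply: is_derive_eq; rewrite /df /GRing.scale /=.
  by field; rewrite !gt_eqF.
suff : f v <= f u.
  by rewrite /f subrr expr0n /= mulr0; lra.
have key (a b : R) (ab : a <= b) : 0 < a -> b < 1 ->
    exists2 c, a <= c <= b & f b - f a = df c * (b - a).
  move=> a0 b1; have [||c] := MVT_segment ab (f := f) (df := df).
  - by move=> x; rewrite in_itv /= => /andP[ax xb]; apply: der; apply/andP; split; lra.
  - apply: derivable_within_continuous => x; rewrite in_itv /= => /andP[ax xb].
    by have [|] := der x; [apply/andP; split; lra|].
  by rewrite in_itv /= => cab E; exists c.
have quarter (c : R) : 0 < c < 1 -> 0 <= (c * (1 - c))^-1 - 4.
  move=> /andP[c0 c1]; have cc : 0 < c * (1 - c) by rewrite mulr_gt0// subr_gt0.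
  rewrite subr_ge0 -(invrK 4) lef_pV2 ?posrE//.
  by have := sqr_ge0 (1 - 2 * c); nra.
case: (leP v u) => uv.
  have [c /andP[vc cu] E] := key _ _ uv v0 u1.
  rewrite -subr_ge0 E /df; apply: mulr_ge0; last by rewrite subr_ge0.
  apply: mulr_ge0; first by rewrite subr_ge0.
  by apply: quarter; apply/andP; split; lra.
have [c /andP[uc cv] E] := key _ _ (ltW uv) u0 v1.
rewrite -subr_le0 E /df; apply: mulr_le0_ge0; last by rewrite subr_ge0 ltW.
apply: mulr_le0_ge0; first by rewrite subr_le0.
by apply: quarter; apply/andP; split; lra.
Qed.

(** The gap between [entropy_pt] and its tangent line at u is half the relative
    entropy. *)
Lemma entropy_pt_tangent u v : 0 < u < 1 -> 0 <= v <= 1 ->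
  entropy_pt u + 2^-1 * (ln u - ln (1 - u)) * (v - u) + (v - u) ^+ 2 <= entropy_pt v.
Proof. by move=> u01 v01; have := pinsker u01 v01; rewrite /entropy_pt; lra. Qed.

End Pinsker.

(** * Second-order expansion of a product *)

Section ProductTaylor.
Variable R : realType.

Lemma prod_taylor1 (I : Type) (s : seq I) (h : I -> R) (u : R) :
  0 <= u <= 1 -> (forall i, 0 <= h i <= 1) ->
  `|\prod_(i <- s) h i - u ^+ size s| <= \sum_(i <- s) `|h i - u|.
Proof.
move=> u01 h01; elim: s => [|i s IH]; first by rewrite !big_nil subrr normr0.
rewrite !big_cons /= exprS.
have -> : h i * \prod_(j <- s) h j - u * u ^+ size s =
  (h i - u) * \prod_(j <- s) h j + u * (\prod_(j <- s) h j - u ^+ size s) by ring.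
have /andP[u0 u1] := u01.
have P01 : 0 <= \prod_(j <- s) h j <= 1.
  by rewrite prodr_ge0 ?prodr_ile1// => j _; case/andP: (h01 j).
apply: (le_trans (ler_normD _ _)); rewrite !normrM; apply: lerD.
  by rewrite ler_piMr// ger0_norm; case/andP: P01.
apply: le_trans IH; rewrite ler_piMl// ger0_norm//.
Qed.

(** The cross terms (h_i - u) (h_j - u) are bounded by half the sum of the two
    squares, so that each square is counted once for every other factor. *)
Lemma prod_taylor2 (I : Type) (s : seq I) (h : I -> R) (u : R) :
  0 <= u <= 1 -> (forall i, 0 <= h i <= 1) ->
  `|\prod_(i <- s) h i - u ^+ size s - u ^+ (size s).-1 * \sum_(i <- s) (h i - u)|
   <= 2^-1 * ((size s)%:R - 1) * \sum_(i <- s) (h i - u) ^+ 2.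
Proof.
move=> u01 h01; have /andP[u0 u1] := u01.
elim: s => [|i s IH].
  by rewrite !big_nil !mulr0 expr0 !subrr normr0.
rewrite !big_cons /= exprS.
set P := \prod_(j <- s) h j in IH *; set S := \sum_(j <- s) (h j - u) in IH *.
set Q := \sum_(j <- s) (h j - u) ^+ 2 in IH *.
have -> : h i * P - u * u ^+ size s - u ^+ size s * (h i - u + S) =
  u * (P - u ^+ size s - u ^+ (size s).-1 * S) + (h i - u) * (P - u ^+ size s).
  rewrite /S; case: (s) => [|j s'] /=; last by rewrite exprS; ring.
  by rewrite big_nil; ring.
have h1 : `|u * (P - u ^+ size s - u ^+ (size s).-1 * S)| <= 2^-1 * ((size s)%:R - 1) * Q.
  by rewrite normrM; apply: le_trans IH; rewrite ler_piMl// ger0_norm.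
have h2 : `|(h i - u) * (P - u ^+ size s)| <= 2^-1 * (Q + (size s)%:R * (h i - u) ^+ 2).
  rewrite normrM; apply: (@le_trans _ _ (`|h i - u| * \sum_(j <- s) `|h j - u|)).
    by rewrite ler_wpM2l// prod_taylor1.
  rewrite /Q mulr_sumr; elim: (s) => [|j s' IH']; first by rewrite !big_nil mul0r addr0 mulr0.
  rewrite !big_cons /= -natr1.
  have ab : `|h i - u| * `|h j - u| <= 2^-1 * ((h i - u) ^+ 2 + (h j - u) ^+ 2).
    rewrite -(real_normK (num_real (h i - u))) -(real_normK (num_real (h j - u))).
    by have := sqr_ge0 (`|h i - u| - `|h j - u|); nra.
  by apply: (le_trans (lerD ab IH')); rewrite le_eqVlt; apply/orP; left; apply/eqP; ring.
apply: (le_trans (ler_normD _ _)); apply: (le_trans (lerD h1 h2)).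
by rewrite -natr1 le_eqVlt; apply/orP; left; apply/eqP; ring.
Qed.

End ProductTaylor.

(** * The variational problem on constants *)

Section ScalarProblem.
Variables (R : realType) (k : nat).
Variables (H : 'I_k.+1 -> {m : nat & sgraph m}) (beta : 'I_k.+1 -> R).
Local Notation gamma := (influence_sum H beta).
Local Notation ell := (ell H beta).

(** The derivative of the sum of the beta_i u^e(H_i). *)
Definition drift (u : R) : R := \sum_(i < k.+1) beta i * ((eH H i)%:R * u ^+ (eH H i).-1).

(** The stationarity equation ell'(u) = 0 solved for u. *)
Definition mean_field u := 0 < u < 1 /\ u = logistic (2 * drift u).

Lemma logistic_ln (s u : R) : u = logistic s -> ln u - ln (1 - u) = s.
Proof.
move=> ->; have e0 := expR_gt0 (- s).
have h : 0 < 1 + expR (- s) by rewrite addr_gt0.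
have -> : 1 - logistic s = expR (- s) * logistic s.
  by rewrite /logistic; field; rewrite gt_eqF.
rewrite lnM ?posrE ?expR_gt0//; last by have /andP[] := logistic_itv s.
by rewrite expRK; lra.
Qed.

(** The logistic function maps into (0,1), so logistic (2 * drift u) - u changes sign
    on [0,1]. *)
Lemma mean_field_exists : exists u, mean_field u.
Proof.
pose F u := logistic (2 * drift u) - u.
have cF : continuous F.
  move=> x; apply: cvgB; last exact: cvg_id.
  apply: (@continuous_comp _ _ _ (fun u => 2 * drift u) (@logistic R)).
    apply: cvgM; first exact: cvg_cst.
    apply: cvg_big => [|i _]; first exact: add_continuous.
    apply: cvgM; first exact: cvg_cst.
    apply: cvgM; first exact: cvg_cst.
    exact: exprn_continuous.
  apply: differentiable_continuous; apply/derivable1_diffP.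
  by have := is_derive_logistic (2 * drift x); case.
have [||c c01 Fc] := IVT (f := F) (v := 0) (a := 0) (b := 1) ler01.
  exact: continuous_subspaceT.
  have /andP[h0 _] := logistic_itv (2 * drift 0).
  have /andP[_ h1] := logistic_itv (2 * drift 1).
  by rewrite ge_min le_max /F subr0; apply/andP; split; apply/orP; [right|left]; lra.
have cE : c = logistic (2 * drift c) by move: Fc; rewrite /F; lra.
by exists c; split => //; rewrite cE; exact: logistic_itv.
Qed.

(** The common core of the scalar and the graphon problem.  [M1] and [M2] stand for the
    integrals of h - u and (h - u)^2, and [t i] for t(H_i,h); the terms in [M1] cancel
    by the mean-field equation. *)
Lemma mean_field_ineq (u M1 M2 I0 : R) (t : 'I_k.+1 -> R) : mean_field u ->
  (forall i, `|t i - u ^+ eH H i - (eH H i)%:R * u ^+ (eH H i).-1 * M1| <=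
     2^-1 * (eH H i)%:R * ((eH H i)%:R - 1) * M2) ->
  entropy_pt u + 2^-1 * (ln u - ln (1 - u)) * M1 + M2 <= I0 ->
  \sum_(i < k.+1) beta i * t i - I0 <= ell u - (1 - gamma) * M2.
Proof.
move=> [u01 /logistic_ln ->] ht hI.
suff : \sum_(i < k.+1) beta i * t i <=
    \sum_(i < k.+1) beta i * u ^+ eH H i + drift u * M1 + gamma * M2.
  move: hI; rewrite /ell; lra.
rewrite /drift /influence_sum mulr_sumr !mulr_suml -!big_split /=.
apply: ler_sum => i _.
have := ht i; set e := (eH H i)%:R; set w := t i - _ - _ => hw.
have -> : beta i * t i = beta i * u ^+ eH H i + beta i * (e * u ^+ (eH H i).-1) * M1 + beta i * w.
  by rewrite /w; ring.
rewrite lerD2l; apply: (le_trans (ler_norm _)); rewrite normrM.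
have := ler_wpM2l (normr_ge0 (beta i)) hw; lra.
Qed.

Lemma ell_tangent u v : mean_field u -> 0 <= v <= 1 ->
  ell v <= ell u - (1 - gamma) * (v - u) ^+ 2.
Proof.
move=> mu v01; have [u01 _] := mu; have /andP[u0 u1] := u01.
apply: (mean_field_ineq mu (M1 := v - u)) => [i|]; last exact: entropy_pt_tangent.
have u01' : 0 <= u <= 1 by rewrite !ltW.
have := prod_taylor2 (nseq (eH H i) tt) u01' (fun=> v01).
rewrite !big_nseq size_nseq !iter_mulr !iter_addr mulr1 !addr0 -(mulr_natl (v - u)) -(mulr_natl ((v - u) ^+ 2)).
by rewrite !mulrA (mulrC (u ^+ _)) (mulrAC _ (_ - 1)).
Qed.

Lemma mean_field_maximizers u : gamma < 1 -> mean_field u -> ell_maximizers H beta = [set u].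
Proof.
move=> g1 mu; have [/andP[u0 u1] _] := mu; apply/seteqP; split=> v /=.
  have u01 : 0 <= u <= 1 by rewrite !ltW.
  move=> [v01 /(_ u u01) h]; have h' := ell_tangent mu v01.
  have : (1 - gamma) * (v - u) ^+ 2 <= 0 by lra.
  rewrite pmulr_rle0 ?subr_gt0// => h2; apply/eqP; rewrite -subr_eq0 -sqrf_eq0.
  by rewrite eq_le h2 sqr_ge0.
move=> ->; split; first by rewrite !ltW.
move=> w w01; have := ell_tangent mu w01.
have : 0 <= (1 - gamma) * (w - u) ^+ 2 by rewrite mulr_ge0 ?sqr_ge0// subr_ge0 ltW.
lra.
Qed.

End ScalarProblem.

(** * Gibbs' inequality and independent edges *)

Section GibbsInequality.
Variable (R : realType).

Lemma gibbs_inequality (T : finType) (P Q : T -> R) :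
  (forall x, 0 < P x) -> (forall x, 0 < Q x) -> \sum_x P x = 1 -> \sum_x Q x = 1 ->
  \sum_x P x * ln (Q x) <= \sum_x P x * ln (P x).
Proof.
move=> P0 Q0 P1 Q1; rewrite -subr_le0 -sumrB.
apply: (@le_trans _ _ (\sum_x (Q x - P x))); last by rewrite sumrB P1 Q1 subrr.
apply: ler_sum => x _; rewrite -mulrBr -ln_div ?posrE//.
have r0 : 0 < Q x / P x by rewrite divr_gt0.
have -> : Q x - P x = P x * (Q x / P x - 1) by field; rewrite gt_eqF.
rewrite ler_pM2l// -[X in ln X](subrK 1) addrC.
by apply: le_ln1Dx; rewrite -subr_gt0 opprK subrK.
Qed.

End GibbsInequality.

Section Bernoulli.
Variables (R : realType) (E : finType) (u : R).
Hypothesis u01 : 0 < u < 1.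
Implicit Types (x : {ffun E -> bool}) (e : E).

Definition bernoulli x : R := \prod_e (if x e then u else 1 - u).

Lemma bernoulli_gt0 x : 0 < bernoulli x.
Proof. by have /andP[u0 u1] := u01; apply: prodr_gt0 => e _; case: ifP; rewrite ?subr_gt0. Qed.

Lemma bernoulli_sum1 : \sum_x bernoulli x = 1.
Proof.
rewrite /bernoulli -(bigA_distr_bigA (fun e b => if b then u else 1 - u)) big1// => e _.
by rewrite big_bool /= addrC subrK.
Qed.

Lemma ln_bernoulli x : ln (bernoulli x) = \sum_e ((x e)%:R * ln u + (1 - (x e)%:R) * ln (1 - u)).
Proof.
have /andP[u0 u1] := u01.
pose K (a b : R) := 0 < a /\ ln a = b.
suff [] : K (bernoulli x) (\sum_e ((x e)%:R * ln u + (1 - (x e)%:R) * ln (1 - u))) by [].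
apply: (big_rec2 K); first by split; rewrite ?ltr01 ?ln1.
move=> e a b _ [b0 Eb]; case: (x e); split; rewrite ?mulr_gt0 ?subr_gt0//.
  by rewrite lnM ?posrE// Eb /=; ring.
by rewrite lnM ?posrE ?subr_gt0// Eb /=; ring.
Qed.

Lemma bernoulli_upd x e : bernoulli (upd x e true) * (1 - u) = bernoulli (upd x e false) * u.
Proof.
rewrite /bernoulli (bigD1 e)//= [in RHS](bigD1 e)//= !updE eqxx.
rewrite mulrAC [RHS]mulrAC mulrC [RHS]mulrC (mulrC u); congr (_ * _).
by apply: eq_bigr => f /negPf ne; rewrite !updE ne.
Qed.

(** The two states of site [e] contribute u (1 - u) and -(1 - u) u, which cancel. *)
Lemma bernoulli_indep r : almost_indep bernoulli r u 0.
Proof.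
move=> B e g _ eB gB _; rewrite normr_le0; apply/eqP.
have n2 : (2%:R : R) != 0 by rewrite pnatr_eq0.
apply: (mulfI n2); rewrite mulr0 mulr_natl /expect (sum_upd _ e) big1// => x _.
rewrite !updE eqxx !(gB e eB) /= sub0r.
have := bernoulli_upd x e.
set a := bernoulli _; set b := bernoulli _ => ab.
have -> : a * ((1 - u) * g x) + b * (- u * g x) = (a * (1 - u) - b * u) * g x by ring.
by rewrite ab subrr mul0r.
Qed.

(** The logarithm of an independent measure is affine in the edge indicators, so its
    expectation under any measure only involves the edge densities. *)
Lemma expect_ln_bernoulli (mu : {ffun E -> bool} -> R) (p : R) : \sum_x mu x = 1 ->
  (forall e, expect mu (fun x => (x e)%:R) = p) ->
  expect mu (fun x => ln (bernoulli x)) = #|E|%:R * (p * ln u + (1 - p) * ln (1 - u)).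
Proof.
move=> mu1 mup.
have -> : expect mu (fun x => ln (bernoulli x)) =
    expect mu (fun x => \sum_e ((ln u - ln (1 - u)) * (x e)%:R + ln (1 - u))).
  by apply: eq_expect => x; rewrite ln_bernoulli; apply: eq_bigr => e _; ring.
rewrite expect_sum (eq_bigr (fun=> p * ln u + (1 - p) * ln (1 - u))).
  by rewrite sumr_const -[LHS]mulr_natl.
by move=> e _; rewrite expectD expectZ expect_cst// mup; ring.
Qed.

Lemma bernoulli_mean e : expect bernoulli (fun x => (x e)%:R) = u.
Proof.
have := @bernoulli_indep 0 finset.set0 e (fun=> 1).
rewrite cards0 inE normr1 => /(_ isT isT (fun f _ x b => erefl) (fun=> lexx _)).
rewrite normr_le0 => /eqP h.
apply/eqP; rewrite -subr_eq0 -[X in _ - X](expect_cst bernoulli_sum1 u) -mulN1r -expectZ -expectD.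
by rewrite -[X in _ == X]h; apply/eqP; apply: eq_expect => x; ring.
Qed.

End Bernoulli.

(** * The free energy *)

Lemma entropy_pt_le0 (R : realType) (u : R) : 0 < u < 1 -> entropy_pt u <= 0.
Proof.
move=> /andP[u0 u1]; have h (a b : R) : 0 < a -> 0 < b < 1 -> 2^-1 * a * ln b <= 0.
  move=> a0 /andP[b0 b1]; apply: mulr_ge0_le0; last by apply: ln_le0; exact: ltW.
  by apply: mulr_ge0; [rewrite invr_ge0|exact: ltW].
rewrite /entropy_pt -[leRHS]addr0; apply: lerD; apply: h => //; rewrite ?subr_gt0//;
  apply/andP; split; lra.
Qed.

Section FreeEnergy.
Variables (R : realType) (k : nat).
Variables (H : 'I_k.+1 -> {m : nat & sgraph m}) (beta : 'I_k.+1 -> R).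
Local Notation gamma := (influence_sum H beta).
Local Notation ell := (ell H beta).

Definition free_energy (n : nat) : R := (n%:R ^+ 2)^-1 * ln (partition_function H beta n).

(** Summed form of the error in [expect_dens] when [r] dependent sites cost a r / n. *)
Definition density_error (a : R) : R := \sum_(i < k.+1) `|beta i| *
    ((eH H i)%:R * (a * (eH H i)%:R) + 2 * (tag (H i))%:R ^+ 2).

Lemma expect_energy (n : nat) (mu : config n -> R) (p a : R) : (0 < n)%N ->
  (forall x, 0 < mu x) -> \sum_x mu x = 1 -> 0 <= p <= 1 -> 0 <= a ->
  (forall r, almost_indep mu r p (a * r%:R / n%:R)) ->
  `|expect mu (energy H beta (n := n)) - \sum_(i < k.+1) beta i * p ^+ eH H i|
    <= density_error a / n%:R.
Proof.
move=> n0 mu0 mu1 p01 a0 ai.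
rewrite /energy expect_sum -sumrB /density_error mulr_suml.
apply: (le_trans (ler_norm_sum _ _ _)); apply: ler_sum => i _.
rewrite expectZ -mulrBr normrM -mulrA; apply: ler_wpM2l => //.
have eps0 : 0 <= a * (eH H i)%:R / n%:R by rewrite divr_ge0// mulr_ge0.
have c01 : (0 <= 0 :> R) && (0 <= 1 :> R) by rewrite lexx ler01.
have := expect_dens n0 (@edges_lt _ (tagged (H i))) mu0 mu1 (ai (eH H i)) eps0 p01 c01 (leqnn _).
rewrite subr0 => /le_trans; apply; rewrite le_eqVlt; apply/orP; left; apply/eqP.
by rewrite /eH /num_edges; ring.
Qed.

Lemma site_frac n : (0 < n)%N -> 2 * #|{: site n}|%:R / n%:R ^+ 2 = 1 - n%:R^-1 :> R.
Proof.
move=> n0; have n0' : (n%:R : R) != 0 by rewrite pnatr_eq0 -lt0n.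
have /(congr1 (fun m => m%:R : R)) := card_site n.
rewrite natrD !natrM => E.
have -> : 2 * #|{: site n}|%:R = n%:R * n%:R - n%:R :> R by rewrite -E; ring.
by field.
Qed.

Lemma expect_ln_gibbs n (mu : config n -> R) : \sum_x mu x = 1 ->
  expect mu (fun x => ln (gibbs H beta x)) =
  n%:R ^+ 2 * expect mu (energy H beta (n := n)) - ln (partition_function H beta n).
Proof.
move=> mu1; have Z := partition_function_gt0 H beta n.
rewrite -[X in _ - X](expect_cst mu1) -expectZ -mulN1r -expectZ -expectD.
apply: eq_expect => x; rewrite /gibbs ln_div ?posrE ?expR_gt0// expRK; ring.
Qed.

(** Gibbs' inequality with the independent measure of density u in the role of the
    first measure. *)
Lemma free_energy_lower n u : (0 < n)%N -> 0 < u < 1 ->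
  ell u - (density_error 0 - entropy_pt u) / n%:R <= free_energy n.
Proof.
move=> n0 u01; have u01' : 0 <= u <= 1 by have /andP[? ?] := u01; rewrite !ltW.
have b0 := @bernoulli_gt0 _ (site n) _ u01; have b1 := bernoulli_sum1 (site n) u.
have g0 := gibbs_gt0 H beta (n := n); have g1 := gibbs_sum1 H beta n.
have := gibbs_inequality b0 g0 b1 g1.
rewrite -![\sum_x _]/(expect _ (fun x => ln _)) expect_ln_gibbs//.
rewrite (expect_ln_bernoulli u01 b1 (bernoulli_mean u)).
have ai r : almost_indep (@bernoulli R (site n) u) r u (0 * r%:R / n%:R).
  by rewrite !mul0r; exact: bernoulli_indep.
have := expect_energy n0 b0 b1 u01' (lexx 0) ai.
rewrite ler_norml => /andP[h _].
set En := expect _ _ in h *; set N := #|_|%:R; set lZ := ln (partition_function _ _ _) => hG.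
have n2 : (0 : R) < n%:R ^+ 2 by rewrite exprn_gt0// ltr0n.
have hG' : En - 2 * N / n%:R ^+ 2 * entropy_pt u <= free_energy n.
  rewrite /free_energy -/lZ -(ler_pM2l n2) mulVKf ?gt_eqF//.
  have -> : n%:R ^+ 2 * (En - 2 * N / n%:R ^+ 2 * entropy_pt u) =
     n%:R ^+ 2 * En - 2 * N * entropy_pt u by field; rewrite gt_eqF// ltr0n.
  move: hG; rewrite /entropy_pt; lra.
apply: le_trans hG'; rewrite (site_frac n0) /Defs.ell; lra.
Qed.

(** Gibbs' inequality with the independent measure that has the same edge density:
    its entropy is at least that of the Gibbs measure. *)
Lemma free_energy_upper n (e : site n) : (0 < n)%N -> gamma < 1 ->
  free_energy n <= ell (edge_prob H beta e) + density_error (4 * gamma / (1 - gamma)) / n%:R.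
Proof.
move=> n0 gam1; set p := edge_prob _ _ _.
have p01 : 0 < p < 1 by exact: edge_prob_itv.
have p01' : 0 <= p <= 1 by have /andP[? ?] := p01; rewrite !ltW.
have b0 := @bernoulli_gt0 _ (site n) _ p01; have b1 := bernoulli_sum1 (site n) p.
have g0 := gibbs_gt0 H beta (n := n); have g1 := gibbs_sum1 H beta n.
have := gibbs_inequality g0 b0 g1 b1.
rewrite -![\sum_x _]/(expect _ (fun x => ln _)) expect_ln_gibbs//.
rewrite (expect_ln_bernoulli p01 g1 (fun f => edge_prob_cst H beta f e)) -/p.
have a0 : 0 <= 4 * gamma / (1 - gamma).
  apply: divr_ge0; last by rewrite subr_ge0 ltW.
  by apply: mulr_ge0 => //; exact: influence_sum_ge0.
have ai r : almost_indep (gibbs H beta (n := n)) r p (4 * gamma / (1 - gamma) * r%:R / n%:R).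
  have := @gibbs_almost_indep R k H beta n n0 r e gam1.
  rewrite /gibbs_eps; congr (almost_indep _ _ _ _); ring.
have := expect_energy n0 g0 g1 p01' a0 ai.
rewrite ler_norml => /andP[_ h].
set En := expect _ _ in h *; set N := #|_|%:R; set lZ := ln (partition_function _ _ _) => hG.
have n2 : (0 : R) < n%:R ^+ 2 by rewrite exprn_gt0// ltr0n.
have hG' : free_energy n <= En - 2 * N / n%:R ^+ 2 * entropy_pt p.
  rewrite /free_energy -/lZ -(ler_pM2l n2) mulVKf ?gt_eqF//.
  have -> : n%:R ^+ 2 * (En - 2 * N / n%:R ^+ 2 * entropy_pt p) =
     n%:R ^+ 2 * En - 2 * N * entropy_pt p by field; rewrite gt_eqF// ltr0n.
  move: hG; rewrite /entropy_pt. lra.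
apply: (le_trans hG'); rewrite (site_frac n0) /Defs.ell.
have := entropy_pt_le0 p01 => hp.
have : n%:R^-1 * entropy_pt p <= 0 by rewrite mulr_ge0_le0// invr_ge0.
lra.
Qed.

(** The upper bound is smaller than ell(u) by (1 - gamma) (p - u)^2, and the lower bound
    leaves only O(1/n) for this term. *)
Lemma free_energy_limit u : gamma < 1 -> mean_field H beta u ->
  exists2 K, 0 <= K & forall n (e : site n), (0 < n)%N ->
    `|free_energy n - ell u| <= K / n%:R /\ (edge_prob H beta e - u) ^+ 2 <= K / n%:R.
Proof.
move=> gam1 mu; have [u01 _] := mu.
pose K1 := density_error 0 - entropy_pt u.
pose K2 := density_error (4 * gamma / (1 - gamma)).
have g1 : 0 < 1 - gamma by rewrite subr_gt0.
have de0 a : 0 <= a -> 0 <= density_error a.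
  by move=> a0; apply: sumr_ge0 => i _; rewrite !(mulr_ge0, addr_ge0, exprn_ge0).
have K1_0 : 0 <= K1 by rewrite subr_ge0; apply: le_trans (de0 0 _) => //; exact: entropy_pt_le0.
have K2_0 : 0 <= K2.
  apply: de0; apply: divr_ge0; last exact: ltW.
  by apply: mulr_ge0 => //; exact: influence_sum_ge0.
have K12 : 0 <= K1 + K2 by exact: addr_ge0.
exists (K1 + K2 + (K1 + K2) / (1 - gamma)).
  exact: (addr_ge0 K12 (divr_ge0 K12 (ltW g1))).
move=> n e n0.
have lo := free_energy_lower n0 u01; rewrite -/K1 in lo.
have up := free_energy_upper e n0 gam1; rewrite -/K2 in up.
have pI : 0 <= edge_prob H beta e <= 1.
  by have /andP[? ?] := edge_prob_itv H beta e; rewrite !ltW.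
have ta := ell_tangent mu pI.
set D := (edge_prob H beta e - u) ^+ 2 in ta *.
have D0 : 0 <= (1 - gamma) * D by rewrite mulr_ge0 ?sqr_ge0// ltW.
have K1n : 0 <= K1 / n%:R by rewrite divr_ge0.
have K2n : 0 <= K2 / n%:R by rewrite divr_ge0.
have K3n : 0 <= (K1 + K2) / (1 - gamma) / n%:R.
  exact: (divr_ge0 (divr_ge0 K12 (ltW g1)) (ler0n R n)).
set K3 := (K1 + K2) / (1 - gamma) in K3n *.
have -> : (K1 + K2 + K3) / n%:R = K1 / n%:R + K2 / n%:R + K3 / n%:R by ring.
split; first by rewrite ler_norml; apply/andP; split; lra.
apply: (@le_trans _ _ (K3 / n%:R)); last by rewrite lerDr addr_ge0.
rewrite -(ler_pM2l g1).
have -> : (1 - gamma) * (K3 / n%:R) = (K1 + K2) / n%:R.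
  by rewrite /K3; field; rewrite pnatr_eq0 -lt0n n0 gt_eqF.
by rewrite mulrDl; lra.
Qed.

End FreeEnergy.

(** * Integrals of bounded measurable functions *)

Section BoundedIntegral.
Context d (T : measurableType d) (R : realType) (mu : {measure set T -> \bar R}).
Variable D : set T.
Hypothesis mD : measurable D.
Hypothesis finD : (mu D < +oo)%E.
Local Notation mR := (measurableTypeR R).
Implicit Types f g : T -> R.

(** On a set of finite measure this class is integrable and closed under products,
    which makes all integrability conditions below routine. *)
Definition bounded_meas f := measurable_fun D (f : T -> mR) /\
  exists M, forall x, D x -> `|f x| <= M.

Lemma bm_integrable f : bounded_meas f -> mu.-integrable D (EFin \o f).
Proof.
move=> [mf [M fM]]; apply: measurable_bounded_integrable => //.
by exists M; split=> [|M' MM' x Dx]; rewrite ?num_real//; apply: le_trans (fM x Dx) (ltW MM').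
Qed.

Lemma bm_cst c : bounded_meas (fun=> c).
Proof. by split; [exact: measurable_cst|exists `|c|]. Qed.

Lemma bmD f g : bounded_meas f -> bounded_meas g -> bounded_meas (fun x => f x + g x).
Proof.
move=> [mf [M fM]] [mg [N gN]]; split; first exact: measurable_funD.
by exists (M + N) => x Dx; apply: (le_trans (ler_normD _ _)); rewrite lerD ?fM ?gN.
Qed.

Lemma bmM f g : bounded_meas f -> bounded_meas g -> bounded_meas (fun x => f x * g x).
Proof.
move=> [mf [M fM]] [mg [N gN]]; split; first exact: measurable_funM.
by exists (M * N) => x Dx; rewrite normrM ler_pM ?fM ?gN.
Qed.

Lemma eq_bm f g : {in D, f =1 g} -> bounded_meas f -> bounded_meas g.
Proof.
move=> fg [mf [M fM]]; split; first exact: eq_measurable_fun mf.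
by exists M => x Dx; rewrite -fg ?inE// fM.
Qed.

Lemma bmZ c f : bounded_meas f -> bounded_meas (fun x => c * f x).
Proof. by apply: bmM; exact: bm_cst. Qed.

Lemma bmB f g : bounded_meas f -> bounded_meas g -> bounded_meas (fun x => f x - g x).
Proof.
move=> bf bg; apply: (@eq_bm (fun x => f x + -1 * g x)) => [x _|]; first by rewrite mulN1r.
by apply: bmD => //; exact: bmZ.
Qed.

Lemma bm_norm f : bounded_meas f -> bounded_meas (fun x => `|f x|).
Proof.
move=> [mf [M fM]]; split; first exact: measurableT_comp.
by exists M => x Dx; rewrite normr_id fM.
Qed.

Lemma bm_sum (I : Type) (s : seq I) (P : pred I) (F : I -> T -> R) :
  (forall i, P i -> bounded_meas (F i)) -> bounded_meas (fun x => \sum_(i <- s | P i) F i x).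
Proof.
move=> bF; elim: s => [|i s IH].
  by apply: (eq_bm _ (bm_cst 0)) => x _; rewrite big_nil.
case Pi : (P i); last by apply: (eq_bm _ IH) => x _; rewrite big_cons Pi.
by apply: (eq_bm _ (bmD (bF i Pi) IH)) => x _; rewrite big_cons Pi.
Qed.

Lemma bm_prod (I : Type) (s : seq I) (P : pred I) (F : I -> T -> R) :
  (forall i, P i -> bounded_meas (F i)) -> bounded_meas (fun x => \prod_(i <- s | P i) F i x).
Proof.
move=> bF; elim: s => [|i s IH].
  by apply: (eq_bm _ (bm_cst 1)) => x _; rewrite big_nil.
case Pi : (P i); last by apply: (eq_bm _ IH) => x _; rewrite big_cons Pi.
by apply: (eq_bm _ (bmM (bF i Pi) IH)) => x _; rewrite big_cons Pi.
Qed.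

Lemma bm_indic (A : set T) : measurable A -> bounded_meas (\1_A).
Proof.
move=> mA; split; first exact: measurable_indic.
by exists 1 => x _; rewrite indicE; case: (_ \in _); rewrite ?normr1 ?normr0.
Qed.

Local Notation I f := (\int[mu]_(x in D) f x).

Lemma intD f g : bounded_meas f -> bounded_meas g -> I (fun x => f x + g x) = I f + I g.
Proof. by move=> bf bg; rewrite RintegralD//; exact: bm_integrable. Qed.

Lemma intZ c f : bounded_meas f -> I (fun x => c * f x) = c * I f.
Proof. by move=> bf; rewrite RintegralZl//; exact: bm_integrable. Qed.

Lemma intB f g : bounded_meas f -> bounded_meas g -> I (fun x => f x - g x) = I f - I g.
Proof. by move=> bf bg; rewrite RintegralB//; exact: bm_integrable. Qed.

Lemma int_sum (J : Type) (s : seq J) (P : pred J) (F : J -> T -> R) :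
  (forall i, P i -> bounded_meas (F i)) ->
  I (fun x => \sum_(i <- s | P i) F i x) = \sum_(i <- s | P i) I (F i).
Proof.
move=> bF; elim: s => [|i s IH].
  rewrite big_nil; under eq_Rintegral do rewrite big_nil.
  by rewrite Rintegral_cst// mul0r.
rewrite big_cons; case Pi : (P i); last first.
  by rewrite -IH; apply: eq_Rintegral => x _; rewrite big_cons Pi.
rewrite -IH -intD; [|exact: bF|exact: bm_sum].
by apply: eq_Rintegral => x _; rewrite big_cons Pi.
Qed.

Lemma le_int f g : bounded_meas f -> bounded_meas g ->
  (forall x, D x -> f x <= g x) -> I f <= I g.
Proof. by move=> bf bg fg; apply: le_Rintegral => //; exact: bm_integrable. Qed.

Lemma norm_int_le f g : bounded_meas f -> bounded_meas g ->
  (forall x, D x -> `|f x| <= g x) -> `|I f| <= I g.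
Proof.
move=> bf bg fg; apply: (le_trans (le_normr_Rintegral mD (bm_integrable bf))).
by apply: le_int => //; exact: bm_norm.
Qed.

Lemma int_indic (A : set T) : measurable A -> I (\1_A) = fine (mu (A `&` D)).
Proof. by move=> mA; rewrite /Rintegral integral_indic. Qed.

(** The cells need not cover [D], only carry its whole mass.  With r the function 1
    minus the sum of the indicators of the cells, f differs from the simple function
    by at most a constant times r, and r has integral 0. *)
Lemma int_cells (J : finType) (C : J -> set T) (c : J -> R) f :
  bounded_meas f -> (forall j, measurable (C j)) ->
  (forall i j x, C i x -> C j x -> i = j) ->
  (forall j x, D x -> C j x -> f x = c j) ->
  \sum_j fine (mu (C j `&` D)) = fine (mu D) ->
  I f = \sum_j c j * fine (mu (C j `&` D)).
Proof.
move=> bf mC disj fc tot.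
have bC j : bounded_meas (\1_(C j)) by exact: bm_indic.
pose g x := \sum_j c j * \1_(C j) x.
pose r x := 1 - \sum_j \1_(C j) x : R.
have bg : bounded_meas g by apply: bm_sum => j _; exact: bmZ.
have br : bounded_meas r by apply: bmB; [exact: bm_cst|exact: bm_sum].
have Ig : I g = \sum_j c j * fine (mu (C j `&` D)).
  rewrite int_sum; last by move=> j _; exact: bmZ.
  by apply: eq_bigr => j _; rewrite intZ// int_indic.
have Ir : I r = 0.
  rewrite intB; [|exact: bm_cst|exact: bm_sum].
  rewrite int_sum// Rintegral_cst// mul1r -tot; apply/eqP; rewrite subr_eq0; apply/eqP.
  by apply: eq_bigr => j _; rewrite int_indic.
apply/eqP; rewrite -Ig -subr_eq0 -intB// -normr_le0.
have [_ [M fM]] := bf.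
apply: (@le_trans _ _ (M * I r)); last by rewrite Ir mulr0.
rewrite -intZ//; apply: norm_int_le; [exact: bmB|exact: bmZ|].
move=> x Dx; rewrite /g /r.
have [[j Cj]|nC] := pselect (exists j, C j x).
  have E (a : J -> R) : \sum_i a i * \1_(C i) x = a j.
    rewrite (bigD1 j)//= indicE mem_set// mulr1 big1 ?addr0// => i ij.
    rewrite indicE memNset ?mulr0// => Ci; by rewrite (disj _ _ _ Ci Cj) eqxx in ij.
  rewrite E (fc _ _ Dx Cj) subrr normr0.
  have := E (fun=> 1); under eq_bigr do rewrite mul1r; move=> ->.
  by rewrite subrr mulr0.
have N0 j : \1_(C j) x = 0 :> R by rewrite indicE memNset// => Cj; apply: nC; exists j.
rewrite !big1 => [||j _]; [|by move=> j _|by rewrite N0 mulr0].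
by rewrite !subr0 mulr1 fM.
Qed.

End BoundedIntegral.

(** * Boxes and two-dimensional marginals of Lebesgue measure *)

Section Boxes.
Variable R : realType.
Local Notation mR := (measurableTypeR R).
Local Notation mu := (@lebesgue_measure R).
Local Notation mu2 := (mu \x mu)%E.
Local Notation I01 := (unit_itv R).

Definition box m (B : 'I_m -> set mR) : set (m.-tuple mR) :=
  [set x | forall i, B i (tnth x i)].

Lemma measurable_box m (B : 'I_m -> set mR) :
  (forall i, measurable (B i)) -> measurable (box B).
Proof.
move=> mB; have -> : box B = \bigcap_(i in [set: 'I_m]) ((fun x => tnth x i) @^-1` B i).
  by apply/seteqP; split=> x h i; [move=> _; exact: h|exact: h].
apply: fin_bigcap_measurable => // i _.
by rewrite -[X in measurable X]setTI; exact: measurable_tnth.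
Qed.

Lemma lebesgue_box m (B : 'I_m -> set mR) : (forall i, measurable (B i)) ->
  lebesgue_tuple R m (box B) = (\prod_i mu (B i))%E.
Proof.
elim: m B => [|m IH] B mB.
  rewrite big_ord0 /= diracE mem_set// => -[]//.
rewrite big_ord_recl -(IH (fun i => B (lift ord0 i)))//.
rewrite -product_measure1E//; last by apply: measurable_box.
change (lebesgue_tuple R m.+1 (box B)) with
  ((mu \x lebesgue_tuple R m)%E (@Defs.cons_tuple R m @^-1` box B)).
congr ((mu \x lebesgue_tuple R m)%E _); apply/seteqP; split=> -[a t] /=.
  move=> h; split=> /=; first by have := h ord0; rewrite (tnth_nth 0).
  by move=> i; have := h (lift ord0 i); rewrite !(tnth_nth 0).
move=> [/= Ba ht] i; case: (unliftP ord0 i) => [j|] ->; rewrite (tnth_nth 0)//=.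
by have := ht j; rewrite (tnth_nth 0).
Qed.

Lemma measurable_unit_cube m : measurable (unit_cube R m).
Proof. by apply: (@measurable_box m (fun=> I01)) => i; exact: measurable_unit_itv. Qed.

Lemma lebesgue_unit_cube m : lebesgue_tuple R m (unit_cube R m) = 1%E.
Proof.
rewrite (@lebesgue_box m (fun=> I01)) => [|i]; last exact: measurable_unit_itv.
by rewrite big1// => i _; exact: mu_unit_itv.
Qed.

End Boxes.

Section Marginals.
Variables (R : realType) (m : nat) (i j : 'I_m).
Hypothesis ij : i != j.
Local Notation mR := (measurableTypeR R).
Local Notation mu := (@lebesgue_measure R).
Local Notation mu2 := (mu \x mu)%E.
Local Notation I01 := (unit_itv R).
Local Notation lam := (lebesgue_tuple R m).
Local Notation cube := (unit_cube R m).

Definition coord_pair (x : m.-tuple mR) : mR * mR := (tnth x i, tnth x j).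

Lemma measurable_coord_pair : measurable_fun setT coord_pair.
Proof. by apply: measurable_fun_pair; exact: measurable_tnth. Qed.

Let mI : measurable I01 := @measurable_unit_itv R.
Let mC : measurable cube := @measurable_unit_cube R m.
Let mS : measurable (unit_square R) := @measurable_unit_square R.

Let finI : (mu I01 < +oo)%E. Proof. by rewrite mu_unit_itv ltry. Qed.
Let finC : (lam cube < +oo)%E. Proof. by rewrite lebesgue_unit_cube ltry. Qed.
Let finS : (mu2 (unit_square R) < +oo)%E. Proof. by rewrite mu2_unit_square ltry. Qed.

Let muI : {finite_measure set mR -> \bar R} := mfrestr mI finI.
Let lamC : {finite_measure set (m.-tuple mR) -> \bar R} := mfrestr mC finC.
Let mu2S : {finite_measure set (mR * mR)%type -> \bar R} := mfrestr mS finS.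

Let lamCE A : lamC A = lam (A `&` cube). Proof. by []. Qed.
Let mu2SE A : mu2S A = mu2 (A `&` unit_square R). Proof. by []. Qed.
Let muIE A : muI A = mu (A `&` I01). Proof. by []. Qed.

Let nu : {measure set (mR * mR)%type -> \bar R} :=
  measure_function_pushforward__canonical__measure_function_Measure lamC
    measurable_coord_pair.

(** Both sides are finite measures in X that agree on rectangles, where the left one
    is the measure of a box. *)
Lemma marginal_measure (X : set (mR * mR)) : measurable X ->
  lam (coord_pair @^-1` X `&` cube) = mu2 (X `&` unit_square R).
Proof.
move=> mX.
rewrite -[RHS]/(mu2S X) -[LHS]/(nu X).
transitivity ((muI \x muI)%E X); last first.
  apply: product_measure_unique => // A B mA mB.
  transitivity (mu (A `&` I01) * mu (B `&` I01))%E; last by [].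
  rewrite -[LHS]/(mu2 ((A `*` B) `&` unit_square R)) -product_measure1E; [|exact: measurableI|exact: measurableI].
  congr (mu2 _); apply/seteqP; split=> z /=.
    by move=> [[zA zB] [z1 z2]].
  by move=> [[zA z1] [zB z2]].
apply: esym; apply: product_measure_unique => // A B mA mB.
transitivity (mu (A `&` I01) * mu (B `&` I01))%E; last by [].
rewrite -[LHS]/(lam (coord_pair @^-1` (A `*` B) `&` cube)).
pose C k := if k == i then A `&` I01 else if k == j then B `&` I01 else I01.
have mCk k : measurable (C k).
  by rewrite /C; case: eqP => _; [|case: eqP => _ //]; exact: measurableI.
have -> : coord_pair @^-1` (A `*` B) `&` cube = box C.
  apply/seteqP; split=> x /=.
    move=> [[/= xA xB] h] k; rewrite /C; case: eqP => [->|_]; first by split=> //; exact: h.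
    by case: eqP => [->|_]; [split=> //; exact: h|exact: h].
  move=> h; have hi := h i; have hj := h j; rewrite /C eqxx in hi.
  rewrite /C eq_sym (negPf ij) eqxx in hj.
  split; first by split; [case: hi|case: hj].
  by move=> k; have := h k; rewrite /C; case: eqP => _; [case|case: eqP => _; [case|]].
rewrite lebesgue_box// (bigD1 i)//= (bigD1 j) 1?eq_sym//= big1 ?mule1.
  by rewrite /C eqxx eq_sym (negPf ij) eqxx.
by move=> k /andP[/negPf ki /negPf kj]; rewrite /C ki kj mu_unit_itv.
Qed.

Lemma coord_pair_cube x : cube x -> unit_square R (coord_pair x).
Proof. by move=> h; split; exact: h. Qed.

Lemma bm_coord_pair (f : mR * mR -> R) : bounded_meas (unit_square R) f ->
  bounded_meas cube (fun x => f (coord_pair x)).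
Proof.
move=> [mf [M fM]]; split; last by exists M => x /coord_pair_cube; exact: fM.
apply: (measurable_comp mS _ mf) => [_ [x Cx <-]|]; first exact: coord_pair_cube.
by apply: measurable_funTS; exact: measurable_coord_pair.
Qed.

Lemma marginal_int (f : mR * mR -> R) : bounded_meas (unit_square R) f ->
  \int[lam]_(x in cube) f (coord_pair x) = \int[mu2]_(z in unit_square R) f z.
Proof.
move=> [mf [M fM]]; pose F := (f : mR * mR -> mR) \_ (unit_square R).
have mF : measurable_fun setT F by move/(measurable_restrictT _ mS) : mf.
have M0 : 0 <= M.
  by apply: le_trans (fM (0, 0) _) => //; split; rewrite /unit_itv /= in_itv /= lexx ler01.
have FM z : `|F z| <= M.
  by rewrite /F patchE; case: ifPn => [/set_mem/fM//|_]; rewrite normr0.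
have mpS : measurable (coord_pair @^-1` unit_square R).
  by rewrite -[X in measurable X]setTI; exact: measurable_coord_pair.
have mFp : measurable_fun setT (F \o coord_pair : _ -> mR).
  by apply: measurableT_comp => //; exact: measurable_coord_pair.
have intF : lamC.-integrable (coord_pair @^-1` unit_square R) ((EFin \o F) \o coord_pair).
  apply: (measurable_bounded_integrable (f := F \o coord_pair)) => //.
  - by rewrite ltey_eq fin_num_measure.
  - exact: measurable_funTS.
  - by exists M; split=> [|M' MM' x _]; rewrite ?num_real//; apply: le_trans (FM _) (ltW MM').
congr fine.
transitivity (\int[lam]_(x in cube) (F (coord_pair x))%:E)%E.
  apply: eq_integral => x /set_mem /coord_pair_cube h.
  by rewrite /F patchE mem_set.
transitivity (\int[lamC]_(x in cube) (F (coord_pair x))%:E)%E.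
  by apply: eq_measure_integral => A mA Asub; rewrite -[RHS]/(lam (A `&` cube)) (setIidl Asub).
transitivity (\int[lamC]_(x in coord_pair @^-1` unit_square R) (F (coord_pair x))%:E)%E.
  have cubeE : coord_pair @^-1` unit_square R `\` (coord_pair @^-1` unit_square R `\` cube) = cube.
    rewrite setDD; apply/seteqP; split=> x; first by case.
    by move=> h; split=> //; exact: coord_pair_cube.
  rewrite [RHS](@negligible_integral _ _ _ _ _ (coord_pair @^-1` unit_square R `\` cube))//.
  - by rewrite cubeE.
  - exact: measurableD.
  - by rewrite -[LHS]/(lam ((coord_pair @^-1` unit_square R `\` cube) `&` cube)) setDKI measure0.
transitivity (\int[nu]_(z in unit_square R) (F z)%:E)%E.
  have mF' : measurable_fun setT (EFin \o F) by exact/measurable_EFinP.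
  by rewrite [RHS](integral_pushforward measurable_coord_pair mF' intF mS).
transitivity (\int[mu2]_(z in unit_square R) (F z)%:E)%E.
  apply: eq_measure_integral => A mA Asub.
  by rewrite -[LHS]/(lam (coord_pair @^-1` A `&` cube)) marginal_measure// (setIidl Asub).
by apply: eq_integral => z zS; rewrite /F patchE zS.
Qed.

End Marginals.

(** * The variational problem on graphons *)

Section GraphonProblem.
Variable R : realType.
Local Notation mR := (measurableTypeR R).
Local Notation mu := (@lebesgue_measure R).
Local Notation mu2 := (mu \x mu)%E.
Local Notation square := (unit_square R).

Lemma finite_square : (mu2 square < +oo)%E.
Proof. by rewrite mu2_unit_square ltry. Qed.

Lemma finite_cube m : (lebesgue_tuple R m (unit_cube R m) < +oo)%E.
Proof. by rewrite lebesgue_unit_cube ltry. Qed.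

Lemma bm_graphon (h : graphon R) : bounded_meas square h.
Proof.
have [mh h01 _] := gfunP h; split=> //; exists 1 => z /h01/andP[h0 h1].
by rewrite ger0_norm.
Qed.

Lemma square_int_cst (c : R) : \int[mu2]_(z in square) c = c.
Proof.
rewrite Rintegral_cst; last exact: measurable_unit_square.
by rewrite -[X in fine X]/(mu2 square) mu2_unit_square mulr1.
Qed.

Lemma cube_int_cst m (c : R) : \int[lebesgue_tuple R m]_(z in unit_cube R m) c = c.
Proof.
rewrite Rintegral_cst; last exact: measurable_unit_cube.
by rewrite -[X in fine X]/(lebesgue_tuple R m (unit_cube R m)) lebesgue_unit_cube mulr1.
Qed.

Definition mean_dev (h : graphon R) (u : R) : R := \int[mu2]_(z in square) (h z - u).
Definition sq_dev (h : graphon R) (u : R) : R := \int[mu2]_(z in square) ((h z - u) ^+ 2).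

Lemma bm_dev (h : graphon R) u : bounded_meas square (fun z => h z - u).
Proof. by apply: bmB; [exact: bm_graphon|exact: bm_cst]. Qed.

Lemma bm_sqdev (h : graphon R) u : bounded_meas square (fun z => (h z - u) ^+ 2).
Proof.
apply: (@eq_bm _ _ _ _ (fun z => (h z - u) * (h z - u))) => [z _|]; first by rewrite expr2.
by apply: bmM; exact: bm_dev.
Qed.

(** Integrate [prod_taylor2]: each edge of the graph contributes one two-dimensional
    marginal. *)
Lemma hom_density_taylor m (G : sgraph m) (h : graphon R) (u : R) : 0 <= u <= 1 ->
  `|hom_density G h - u ^+ num_edges G
      - (num_edges G)%:R * u ^+ (num_edges G).-1 * mean_dev h u| <=
    2^-1 * (num_edges G)%:R * ((num_edges G)%:R - 1) * sq_dev h u.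
Proof.
move=> u01; set e := num_edges G.
have mC := @measurable_unit_cube R m.
have pne p : p \in edges G -> p.1 != p.2.
  by move=> /edges_lt; apply: contraTneq => ->; rewrite ltnn.
pose hp (p : 'I_m * 'I_m) (x : m.-tuple mR) := h (tnth x p.1, tnth x p.2).
have bh p : p \in edges G -> bounded_meas (unit_cube R m) (hp p).
  by move=> _; exact: (bm_coord_pair p.1 p.2 (bm_graphon h)).
have bd p : p \in edges G -> bounded_meas (unit_cube R m) (fun x => hp p x - u).
  by move=> _; exact: (bm_coord_pair p.1 p.2 (bm_dev h u)).
have bs p : p \in edges G -> bounded_meas (unit_cube R m) (fun x => (hp p x - u) ^+ 2).
  by move=> _; exact: (bm_coord_pair p.1 p.2 (bm_sqdev h u)).
have Id p : p \in edges G ->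
    \int[lebesgue_tuple R m]_(x in unit_cube R m) (hp p x - u) = mean_dev h u.
  by move=> /pne ne; exact: (marginal_int ne (bm_dev h u)).
have Is p : p \in edges G ->
    \int[lebesgue_tuple R m]_(x in unit_cube R m) ((hp p x - u) ^+ 2) = sq_dev h u.
  by move=> /pne ne; exact: (marginal_int ne (bm_sqdev h u)).
pose err (x : m.-tuple mR) := \prod_(p in edges G) hp p x - u ^+ e -
  u ^+ e.-1 * \sum_(p in edges G) (hp p x - u).
pose bnd (x : m.-tuple mR) := 2^-1 * (e%:R - 1) * \sum_(p in edges G) (hp p x - u) ^+ 2.
have bP : bounded_meas (unit_cube R m) (fun x => \prod_(p in edges G) hp p x).
  exact: bm_prod.
have bS : bounded_meas (unit_cube R m) (fun x => \sum_(p in edges G) (hp p x - u)).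
  exact: bm_sum.
have bQ : bounded_meas (unit_cube R m) (fun x => \sum_(p in edges G) (hp p x - u) ^+ 2).
  exact: bm_sum.
have bc (c : R) : bounded_meas (unit_cube R m) (fun=> c) by exact: bm_cst.
have finC := finite_cube m.
have Ie : \int[lebesgue_tuple R m]_(x in unit_cube R m) err x =
    hom_density G h - u ^+ e - e%:R * u ^+ e.-1 * mean_dev h u.
  rewrite intB//; [|exact: bmB|exact: bmZ].
  rewrite intB// cube_int_cst intZ// int_sum// (eq_bigr (fun=> mean_dev h u))//.
  by rewrite sumr_const -[X in _ * X]mulr_natl mulrA (mulrC (u ^+ _)).
have Ib : \int[lebesgue_tuple R m]_(x in unit_cube R m) bnd x =
    2^-1 * e%:R * (e%:R - 1) * sq_dev h u.
  rewrite intZ// int_sum// (eq_bigr (fun=> sq_dev h u))//.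
  by rewrite sumr_const -[X in _ * X]mulr_natl mulrA (mulrAC _ _ e%:R).
rewrite -Ie -Ib; apply: norm_int_le => //.
- by apply: bmB; [exact: bmB|exact: bmZ].
- exact: bmZ.
move=> x Cx.
have [_ h01 _] := gfunP h.
have hp01 p : 0 <= hp p x <= 1 by apply: h01; split; exact: Cx.
have := prod_taylor2 (enum (edges G)) u01 hp01.
by rewrite !big_enum -cardE -/e -/(err x) -/(bnd x).
Qed.

Lemma measurable_entropy_pt : measurable_fun setT (@entropy_pt R : mR -> mR).
Proof.
have mid : measurable_fun setT (fun x : mR => x : mR) by exact: measurable_id.
have m1 : measurable_fun setT (fun x : mR => 1 - x : mR) by exact: measurable_funB.
apply: measurable_funD; apply: measurable_funM.
- exact: measurable_funM.
- exact: measurable_ln.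
- exact: measurable_funM.
- by apply: measurableT_comp => //; exact: measurable_ln.
Qed.

Lemma entropy_pt_bounded (v : R) : 0 <= v <= 1 -> `|entropy_pt v| <= 1.
Proof.
move=> v01; have h01 : 0 < (2^-1 : R) < 1 by apply/andP; split; lra.
have := entropy_pt_tangent h01 v01; have := sqr_ge0 (v - 2^-1).
have -> : 1 - 2^-1 = 2^-1 :> R by lra.
rewrite subrr mulr0 mul0r addr0 => h0 h.
have half : - 1 <= entropy_pt (2^-1 : R).
  have := @le_ln1Dx R 1 ltac:(lra).
  rewrite /entropy_pt; have -> : 1 - 2^-1 = 2^-1 :> R by lra.
  rewrite lnV ?posrE//; have -> : 1 + 1 = 2 :> R by []. lra.
have up : entropy_pt v <= 0.
  have /andP[v0 v1] := v01.
  rewrite /entropy_pt -[leRHS]addr0; apply: lerD; apply: mulr_ge0_le0; rewrite ?ln_le0//;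
   try by apply: mulr_ge0; lra.
  by lra.
by rewrite ler_norml; apply/andP; split; lra.
Qed.

Lemma entropy_tangent (h : graphon R) (u : R) : 0 < u < 1 ->
  entropy_pt u + 2^-1 * (ln u - ln (1 - u)) * mean_dev h u + sq_dev h u <= entropy h.
Proof.
move=> u01; have [mh h01 _] := gfunP h.
have bdev := bm_dev h u; have bsq := bm_sqdev h u.
have bent : bounded_meas square (fun z => entropy_pt (h z)).
  split; last by exists 1 => z /h01; exact: entropy_pt_bounded.
  by apply: measurableT_comp mh; exact: measurable_entropy_pt.
have mS := @measurable_unit_square R; have finS := finite_square.
have bc (c : R) : bounded_meas square (fun=> c) by exact: bm_cst.
set c := 2^-1 * _.
have -> : entropy_pt u + c * mean_dev h u + sq_dev h u =
   \int[mu2]_(z in square) (entropy_pt u + c * (h z - u) + (h z - u) ^+ 2).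
  rewrite intD//; last by apply: bmD => //; exact: bmZ.
  by rewrite intD ?intZ ?square_int_cst//; exact: bmZ.
apply: le_int => //; first by apply: bmD => //; apply: bmD => //; exact: bmZ.
by move=> z /h01; exact: entropy_pt_tangent.
Qed.

Variables (k : nat).
Variables (H : 'I_k.+1 -> {m : nat & sgraph m}) (beta : 'I_k.+1 -> R).
Local Notation gamma := (influence_sum H beta).

Lemma graphon_tangent (h : graphon R) u : mean_field H beta u ->
  Tfun H beta h - entropy h <= ell H beta u - (1 - gamma) * sq_dev h u.
Proof.
move=> mf; have [u01 _] := mf; have u01' : 0 <= u <= 1 by have /andP[? ?] := u01; rewrite !ltW.
apply: (mean_field_ineq mf (M1 := mean_dev h u)) => [i|]; last exact: entropy_tangent.
exact: hom_density_taylor.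
Qed.

Lemma Tfun_cst (u : R) (u01 : 0 <= u <= 1) :
  Tfun H beta (cst_graphon u01) - entropy (cst_graphon u01) = ell H beta u.
Proof.
rewrite /ell /entropy /= square_int_cst; congr (_ - _); apply: eq_bigr => i _.
by rewrite /hom_density /= prodr_const cube_int_cst.
Qed.

Lemma graphon_maximizer (h : graphon R) u : gamma < 1 -> mean_field H beta u ->
  (forall g : graphon R, Tfun H beta g - entropy g <= Tfun H beta h - entropy h) ->
  {ae mu2, forall z, square z -> h z = u}.
Proof.
move=> g1 mf hmax; have [/andP[u0 u1] _] := mf.
have u01 : 0 <= u <= 1 by rewrite !ltW.
have := hmax (cst_graphon u01); rewrite Tfun_cst.
have := graphon_tangent h mf => h1 h2.
have : (1 - gamma) * sq_dev h u <= 0 by lra.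
rewrite pmulr_rle0 ?subr_gt0// => sq0.
have mS := @measurable_unit_square R; have finS := finite_square.
have bsq := bm_sqdev h u.
have m2 : measurable_fun square (fun z => ((h z - u) ^+ 2)%:E : \bar R).
  by apply/measurable_EFinP; case: bsq.
have : (\int[mu2]_(z in square) `|((h z - u) ^+ 2)%:E| = 0)%E.
  have -> : (\int[mu2]_(z in square) `|((h z - u) ^+ 2)%:E| =
      \int[mu2]_(z in square) ((h z - u) ^+ 2)%:E)%E.
    by apply: eq_integral => z _; rewrite gee0_abs// lee_fin sqr_ge0.
  have fin : (\int[mu2]_(z in square) ((h z - u) ^+ 2)%:E)%E \is a fin_num.
    by apply: integrable_fin_num => //; exact: bm_integrable.
  rewrite -(fineK fin); congr (_%:E); apply/eqP; rewrite eq_le sq0/=.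
  by apply: Rintegral_ge0 => z _; exact: sqr_ge0.
move/(ae_eq_integral_abs _ mS m2); apply: filterS => z hz Sz.
by have /= [/eqP] := hz Sz; rewrite sqrf_eq0 subr_eq0 => /eqP.
Qed.

End GraphonProblem.

(** * The cut norm and 4-cycles *)

Section CutNorm.
Variable R : realType.

(** Lagrange's identity. *)
Lemma cauchy_schwarz_sum (I : finType) (a b : I -> R) :
  (\sum_i a i * b i) ^+ 2 <= (\sum_i a i ^+ 2) * (\sum_i b i ^+ 2).
Proof.
rewrite -subr_ge0.
have -> : (\sum_i a i ^+ 2) * (\sum_i b i ^+ 2) - (\sum_i a i * b i) ^+ 2 =
    2^-1 * \sum_i \sum_j (a i * b j - a j * b i) ^+ 2.
  have E (F G : I -> R) : (\sum_i F i) * (\sum_i G i) = \sum_i \sum_j F i * G j.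
    by rewrite mulr_suml; apply: eq_bigr => i _; rewrite mulr_sumr.
  rewrite expr2 !E.
  have -> : \sum_i \sum_j (a i * b j - a j * b i) ^+ 2 =
      \sum_i \sum_j (a i ^+ 2 * b j ^+ 2) + \sum_i \sum_j (a j ^+ 2 * b i ^+ 2)
      - 2 * \sum_i \sum_j (a i * b i * (a j * b j)).
    rewrite -big_split mulr_sumr -sumrB; apply: eq_bigr => i _ /=.
    rewrite -big_split mulr_sumr -sumrB; apply: eq_bigr => j _ /=; ring.
  rewrite [X in _ + X - _]exchange_big /=.
  lra.
by rewrite mulr_ge0// sumr_ge0// => i _; rewrite sumr_ge0// => j _; exact: sqr_ge0.
Qed.

(** The Cauchy-Schwarz inequality in the row index removes the weights [s], and in the
    pair of column indices it removes the weights [a]; what remains is the sum of the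
    squared codegrees of [Y]. *)
Lemma cut_le_four_cycles n (Y : 'I_n -> 'I_n -> R) (s a : 'I_n -> R) : (0 < n)%N ->
  (forall i, 0 <= s i <= n%:R^-1) -> (forall j, 0 <= a j <= n%:R^-1) ->
  (\sum_i \sum_j Y i j * (s i * a j)) ^+ 4 <=
  n%:R ^- 4 * \sum_i \sum_i' \sum_j \sum_j' Y i j * Y i j' * (Y i' j * Y i' j').
Proof.
move=> n0 s01 a01; have nn : (n%:R : R) != 0 by rewrite pnatr_eq0 -lt0n.
have sq_le (x : R) : 0 <= x <= n%:R^-1 -> x ^+ 2 <= n%:R ^- 2.
  by move=> /andP[x0 x1]; rewrite -exprVn lerXn2r// nnegrE ?invr_ge0.
pose T i := \sum_j Y i j * a j.
pose W j j' := \sum_i Y i j * Y i j'.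
have -> : \sum_i \sum_j Y i j * (s i * a j) = \sum_i s i * T i.
  by apply: eq_bigr => i _; rewrite /T mulr_sumr; apply: eq_bigr => j _; ring.
have T2 : \sum_i T i ^+ 2 = \sum_(p : 'I_n * 'I_n) (a p.1 * a p.2) * W p.1 p.2.
  rewrite -(pair_bigA _ (fun j j' => (a j * a j') * W j j'))/=.
  under eq_bigr do rewrite expr2 /T mulr_suml.
  rewrite exchange_big /=; apply: eq_bigr => j _.
  under eq_bigr do rewrite mulr_sumr.
  rewrite exchange_big /=; apply: eq_bigr => j' _.
  by rewrite /W mulr_sumr; apply: eq_bigr => i _; ring.
have T2_ge0 : 0 <= \sum_i T i ^+ 2 by apply: sumr_ge0 => i _; exact: sqr_ge0.
have h1 : (\sum_i s i * T i) ^+ 2 <= n%:R^-1 * \sum_i T i ^+ 2.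
  apply: (le_trans (cauchy_schwarz_sum _ _)); apply: ler_wpM2r => //.
  apply: (@le_trans _ _ (\sum_(i < n) n%:R ^- 2)).
    by apply: ler_sum => i _; exact: sq_le.
  by rewrite sumr_const card_ord -[leLHS]mulr_natl le_eqVlt; apply/orP; left; apply/eqP; field.
have h2 : (\sum_i T i ^+ 2) ^+ 2 <= n%:R ^- 2 * \sum_(p : 'I_n * 'I_n) W p.1 p.2 ^+ 2.
  rewrite T2; apply: (le_trans (cauchy_schwarz_sum _ _)); apply: ler_wpM2r.
    by apply: sumr_ge0 => p _; exact: sqr_ge0.
  apply: (@le_trans _ _ (\sum_(p : 'I_n * 'I_n) n%:R ^- 4)).
    apply: ler_sum => p _; rewrite exprMn.
    have -> : n%:R ^- 4 = n%:R ^- 2 * n%:R ^- 2 :> R by rewrite -!exprVn -exprD.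
    by apply: ler_pM; rewrite ?sqr_ge0// sq_le.
  rewrite sumr_const card_prod card_ord -[leLHS]mulr_natl natrM le_eqVlt.
  by apply/orP; left; apply/eqP; field.
have -> : \sum_i \sum_i' \sum_j \sum_j' Y i j * Y i j' * (Y i' j * Y i' j') =
    \sum_(p : 'I_n * 'I_n) W p.1 p.2 ^+ 2.
  rewrite -(pair_bigA _ (fun j j' => W j j' ^+ 2))/=.
  under eq_bigr do rewrite exchange_big /=.
  rewrite exchange_big /=; apply: eq_bigr => j _.
  under eq_bigr do rewrite exchange_big /=.
  rewrite exchange_big /=; apply: eq_bigr => j' _.
  rewrite expr2 /W mulr_suml; apply: eq_bigr => i _.
  by rewrite mulr_sumr.
rewrite -[4%N]/(2 * 2)%N exprM.
have h3 : ((\sum_i s i * T i) ^+ 2) ^+ 2 <= (n%:R^-1 * \sum_i T i ^+ 2) ^+ 2.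
  by rewrite lerXn2r// nnegrE ?sqr_ge0// mulr_ge0// invr_ge0.
apply: (le_trans h3); rewrite exprMn.
have -> : n%:R ^- (2 * 2) = n%:R^-1 ^+ 2 * n%:R ^- 2 :> R by rewrite -!exprVn -exprD.
by rewrite -mulrA ler_wpM2l// sqr_ge0.
Qed.

(** The vertices of the 4-cycle; its two sides are {0,1} and {2,3}. *)
Definition c4 (k : nat) : 'I_4 := inord k.

Definition four_cycle : {set 'I_4 * 'I_4} :=
  [set (c4 0, c4 2); (c4 0, c4 3); (c4 1, c4 2); (c4 1, c4 3)]%SET.

Lemma c4_eq a b : (a < 4)%N -> (b < 4)%N -> (c4 a == c4 b) = (a == b).
Proof. by move=> a4 b4; rewrite -val_eqE /= !inordK. Qed.

Lemma four_cycle_lt p : p \in four_cycle -> (p.1 < p.2)%N.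
Proof.
by rewrite !inE => /orP[/orP[/orP[]|]|] /eqP -> /=; rewrite !inordK.
Qed.

Lemma card_four_cycle : #|four_cycle| = 4.
Proof.
rewrite /four_cycle finset.setUC cardsU1 !inE !xpair_eqE !c4_eq//=.
rewrite finset.setUC cardsU1 !inE !xpair_eqE !c4_eq//=.
by rewrite finset.setUC cardsU1 !inE !xpair_eqE !c4_eq//= cards1.
Qed.

Lemma prod_four_cycle (F : 'I_4 * 'I_4 -> R) :
  \prod_(p in four_cycle) F p =
  F (c4 0, c4 2) * F (c4 0, c4 3) * (F (c4 1, c4 2) * F (c4 1, c4 3)).
Proof.
rewrite /four_cycle finset.setUC big_setU1; last by rewrite !inE !xpair_eqE !c4_eq.
rewrite finset.setUC big_setU1; last by rewrite !inE !xpair_eqE !c4_eq.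
rewrite finset.setUC big_setU1; last by rewrite !inE !xpair_eqE !c4_eq.
rewrite big_set1 /=; ring.
Qed.

Lemma sum_ffun4 n (F : 'I_n -> 'I_n -> 'I_n -> 'I_n -> R) :
  \sum_(phi : {ffun 'I_4 -> 'I_n}) F (phi (c4 0)) (phi (c4 1)) (phi (c4 2)) (phi (c4 3)) =
  \sum_i \sum_i' \sum_j \sum_j' F i i' j j'.
Proof.
rewrite pair_bigA /=.
under [RHS]eq_bigr do rewrite pair_bigA /=.
rewrite pair_bigA /=.
pose h (q : ('I_n * 'I_n) * ('I_n * 'I_n)) : {ffun 'I_4 -> 'I_n} :=
  [ffun k : 'I_4 => nth q.1.1 [:: q.1.1; q.1.2; q.2.1; q.2.2] k].
rewrite (reindex h) /=.
  by apply: eq_bigr => -[[i i'] [j j']] _; rewrite !ffunE !inordK.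
exists (fun phi => ((phi (c4 0), phi (c4 1)), (phi (c4 2), phi (c4 3)))) => [[[i i'] [j j']] _|phi _].
  by rewrite /h !ffunE !inordK.
apply/ffunP => k; rewrite /h ffunE /=.
have {2}-> : k = c4 k by apply/val_inj; rewrite /= inordK.
by case: k => [[|[|[|[|k]]]]].
Qed.

End CutNorm.

(** * Step graphons *)

Section StepGraphon.
Variables (R : realType) (n : nat).
Hypothesis n_gt0 : (0 < n)%N.
Local Notation mR := (measurableTypeR R).
Local Notation mu := (@lebesgue_measure R).
Local Notation mu2 := (mu \x mu)%E.
Local Notation I01 := (unit_itv R).
Let n0 : (0 : R) < n%:R. Proof. by rewrite ltr0n. Qed.

(** The cells do not contain the point 0, where [step_fun] vanishes for all graphs;
    they fill the unit interval up to a null set. *)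
Definition cell (i : 'I_n) : set mR := [set x | Num.ceil (n%:R * x) == i.+1%:Z].

Lemma cellE i : cell i = [set` `]i%:R / n%:R, i.+1%:R / n%:R] ].
Proof.
have E : (i.+1%:Z)%:~R = i.+1%:R :> R by rewrite -pmulrn.
have E' : i.+1%:R - 1 = i%:R :> R by rewrite -natr1 addrK.
apply/seteqP; split=> x /=; rewrite /cell /= in_itv /= ceil_eq intrB E E' ltr_pdivrMr//
  ler_pdivlMr// (mulrC x)//.
Qed.

Lemma measurable_cell i : measurable (cell i).
Proof. exact: measurable_ceil_eq. Qed.

Lemma cell_sub i : cell i `<=` I01.
Proof.
move=> x; rewrite cellE /unit_itv /= !in_itv /= => /andP[h1 h2]; apply/andP; split.
  by apply: le_trans (ltW h1); rewrite divr_ge0.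
by apply: (le_trans h2); rewrite ler_pdivrMr// mul1r ler_nat.
Qed.

Lemma mu_cell i : mu (cell i) = (n%:R^-1)%:E.
Proof.
rewrite cellE lebesgue_measure_itv /= lte_fin ltr_pM2r ?invr_gt0// ltr_nat ltnSn.
by rewrite -EFinB -mulrBl -natr1 addrAC subrr add0r mul1r.
Qed.

Lemma cell_inj i j x : cell i x -> cell j x -> i = j.
Proof. by rewrite /cell /= => /eqP -> /eqP [] /val_inj. Qed.

Lemma step_fun_cell (G : sgraph n) i j z : cell i z.1 -> cell j z.2 ->
  step_fun G z = ((i, j) \in adj G)%:R :> R.
Proof.
move=> ci cj; rewrite /step_fun; congr (nat_of_bool _)%:R.
apply/existsP/idP => [[[a b] /and3P[ab /= ha hb]]|ij]; last first.
  by exists (i, j); apply/and3P.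
by rewrite (cell_inj ci ha) (cell_inj cj hb).
Qed.

Lemma cell_cover x : 0 < x -> x <= 1 -> exists i, cell i x.
Proof.
move=> x0 x1; have h0 : 0 < n%:R * x by rewrite mulr_gt0.
have h1 : n%:R * x <= n%:R by rewrite ler_piMr// ltW.
have c0 : (0 < Num.ceil (n%:R * x))%R by rewrite ceil_gt0.
have c1 : (Num.ceil (n%:R * x) <= n%:Z)%R by rewrite ceil_le_int -pmulrn.
case E : (Num.ceil (n%:R * x)) c0 c1 => [[|a]|a]// _ c1.
have an : (a < n)%N by [].
by exists (Ordinal an); rewrite /cell /= E.
Qed.

Lemma sum_mu_cell (S : set mR) : measurable S -> S `<=` I01 ->
  \sum_i fine (mu (S `&` cell i)) = fine (mu S).
Proof.
move=> mS SI.
have mI : measurable I01 := @measurable_unit_itv R.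
have finI : (mu I01 < +oo)%E by rewrite mu_unit_itv ltry.
have m0 : measurable ([set 0] : set mR) by exact: measurable_set1.
have mSi i : measurable (S `&` cell i) by apply: measurableI => //; exact: measurable_cell.
have bS (A : set mR) : measurable A -> bounded_meas I01 (\1_A) by exact: bm_indic.
have mS0 : measurable (S `&` [set 0]) by exact: measurableI.
have ind (A : set mR) : measurable A -> A `<=` S ->
    \int[mu]_(x in I01) (\1_A x) = fine (mu A).
  move=> mA AsubS; rewrite int_indic//; congr (fine (mu _)); apply: setIidl.
  exact: subset_trans SI.
rewrite -(ind S)//.
transitivity (\int[mu]_(x in I01) (\sum_i \1_(S `&` cell i) x + \1_(S `&` [set 0]) x)).
  rewrite intD//; [|by apply: bm_sum => i _; exact: bS|exact: bS].
  rewrite int_sum//; last by move=> i _; exact: bS.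
  rewrite ind//.
  have -> : mu (S `&` [set 0]) = 0%E.
    apply/eqP; rewrite eq_le measure_ge0 andbT -(lebesgue_measure_set1 (0 : R)).
    by apply: le_measure; rewrite ?inE// => x [].
  by rewrite addr0; apply: eq_bigr => i _; rewrite ind.
apply: eq_Rintegral => x /set_mem xI; rewrite !indicE.
have [xS|xS] := boolP (x \in S); last first.
  rewrite big1 => [|i _]; last first.
    by rewrite indicE memNset// => -[/mem_set xS']; rewrite xS' in xS.
  by rewrite add0r memNset// => -[/mem_set xS']; rewrite xS' in xS.
have /andP[x0 x1] : 0 <= x <= 1 by move: xI; rewrite /unit_itv /= in_itv.
move: x0; rewrite le_eqVlt => /predU1P[x0|x0].
  rewrite big1 => [|i _]; last first.
    rewrite indicE memNset// => -[_]; rewrite cellE -x0 /= in_itv /= => /andP[h _].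
    by have : 0 <= i%:R / n%:R :> R by [rewrite divr_ge0]; rewrite leNgt h.
  by rewrite add0r mem_set//; split; [exact: set_mem|rewrite /= x0].
have [i ci] := cell_cover x0 x1.
rewrite (bigD1 i)//= indicE mem_set; last by split=> //; exact: set_mem.
rewrite big1 => [|j ji]; last first.
  by rewrite indicE memNset// => -[_ cj]; rewrite (cell_inj cj ci) eqxx in ji.
by rewrite memNset ?addr0// => -[_ /= x00]; rewrite x00 ltxx in x0.
Qed.

Lemma hom_density_step m (H : sgraph m) (G : sgraph n) :
  hom_density H (step_graphon R G) = dens (edges H) 0 (config_of G).
Proof.
have mC := @measurable_unit_cube R m.
pose C (phi : {ffun 'I_m -> 'I_n}) : set (m.-tuple mR) := box (fun k => cell (phi k)).
have mCphi phi : measurable (C phi) by apply: measurable_box => k; exact: measurable_cell.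
have Csub phi : C phi `<=` unit_cube R m by move=> x h k; apply: cell_sub; exact: h.
have muC phi : lebesgue_tuple R m (C phi `&` unit_cube R m) = ((n%:R^-1) ^+ m)%:E.
  rewrite (setIidl (@Csub phi)) lebesgue_box; last by move=> k; exact: measurable_cell.
  rewrite (eq_bigr (fun=> (n%:R^-1)%:E)); last by move=> k _; exact: mu_cell.
  by rewrite prodEFin prodr_const card_ord.
rewrite /hom_density (@int_cells _ _ _ _ _ mC (finite_cube R m) _ C
  (fun phi => \prod_(p in edges H) ((phi p.1, phi p.2) \in adj G)%:R)).
- rewrite /dens /avg mulr_sumr; apply: eq_bigr => phi _.
  rewrite -[X in fine X]/(lebesgue_tuple R m (C phi `&` unit_cube R m)) muC /= mulrC exprVn; congr (_ * _).
  by apply: eq_bigr => p _; rewrite subr0 adjb_config.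
- apply: bm_prod => p _; exact: (bm_coord_pair p.1 p.2 (bm_graphon (step_graphon R G))).
- exact: mCphi.
- move=> phi psi x h1 h2; apply/ffunP => k; exact: cell_inj (h1 k) (h2 k).
- move=> phi x _ h; apply: eq_bigr => p _; exact: (@step_fun_cell G (phi p.1) (phi p.2) (tnth x p.1, tnth x p.2) (h _) (h _)).
rewrite -[RHS]/(fine (lebesgue_tuple R m (unit_cube R m))) lebesgue_unit_cube.
rewrite (eq_bigr (fun=> (n%:R^-1) ^+ m)); last first.
  by move=> phi _; rewrite -[X in fine X]/(lebesgue_tuple R m (C phi `&` unit_cube R m)) muC.
by rewrite sumr_const card_ffun !card_ord -[LHS]mulr_natl natrX -exprMn divff ?expr1n// gt_eqF.
Qed.

Lemma dens_four_cycleE (u : R) (x : config n) :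
  let Y i j : R := (adjb x i j)%:R - u in
  dens four_cycle u x =
  n%:R ^- 4 * \sum_i \sum_i' \sum_j \sum_j' Y i j * Y i j' * (Y i' j * Y i' j').
Proof.
move=> Y.
rewrite /dens /avg -(sum_ffun4 (fun i i' j j' => Y i j * Y i j' * (Y i' j * Y i' j'))).
by congr (_ * _); apply: eq_bigr => phi _; rewrite prod_four_cycle.
Qed.

Lemma dens_four_cycle_ge0 (u : R) (x : config n) : 0 <= dens four_cycle u x.
Proof.
have h0 (i : 'I_n) : 0 <= (0 : R) <= n%:R^-1 by apply/andP; split; rewrite ?invr_ge0.
have := cut_le_four_cycles (fun i j => (adjb x i j)%:R - u) n_gt0 h0 h0.
rewrite dens_four_cycleE; apply: le_trans; apply: exprn_even_ge0.
by [].
Qed.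

(** On a rectangle S x A the integral is a bilinear form in the measures of the traces
    of S and A on the cells; these lie between 0 and 1/n, as [cut_le_four_cycles]
    requires. *)
Lemma cut_dist_step (G : sgraph n) (u : R) (u01 : 0 <= u <= 1) (eps : R) : 0 <= eps ->
  eps < cut_dist (step_graphon R G) (cst_graphon u01) ->
  eps ^+ 4 <= dens four_cycle u (config_of G).
Proof.
move=> eps0 lt_eps.
have [S [A [mS mA SI AI lt]]] : exists S A : set mR,
    [/\ measurable S, measurable A, S `<=` I01, A `<=` I01 &
     eps < `| \int[mu2]_(z in S `*` A) (step_graphon R G z - cst_graphon u01 z) |].
  apply: contrapT => nex; move: lt_eps; apply/negP; rewrite -leNgt.
  apply: cut_dist_le => S A mS mA SI AI; rewrite leNgt; apply/negP => lt.
  by apply: nex; exists S, A.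
pose Y i j : R := (adjb (config_of G) i j)%:R - u.
pose s i := fine (mu (S `&` cell i)); pose a j := fine (mu (A `&` cell j)).
have small (B : set mR) i : measurable B -> 0 <= fine (mu (B `&` cell i)) <= n%:R^-1.
  move=> mB; have le : (mu (B `&` cell i) <= (n%:R^-1)%:E)%E.
    rewrite -(mu_cell i); apply: le_measure; rewrite ?inE//.
    - by apply: measurableI => //; exact: measurable_cell.
    - exact: measurable_cell.
  have fin : mu (B `&` cell i) \is a fin_num.
    by rewrite ge0_fin_numE//; apply: le_lt_trans le (ltry _).
  by rewrite fine_ge0//= -lee_fin fineK.
have mD : measurable (S `*` A) by exact: measurableX.
have finD : (mu2 (S `*` A) < +oo)%E.
  apply: le_lt_trans (finite_square R); apply: le_measure; rewrite ?inE//.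
    exact: measurable_unit_square.
  exact: sub_unit_square.
have fin_mu (B : set mR) : measurable B -> B `<=` I01 -> mu B \is a fin_num.
  move=> mB BI; rewrite ge0_fin_numE//; apply: (@le_lt_trans _ _ (mu I01)).
    by apply: le_measure; rewrite ?inE//; exact: measurable_unit_itv.
  by rewrite mu_unit_itv ltry.
pose C (p : 'I_n * 'I_n) : set (mR * mR) := cell p.1 `*` cell p.2.
have muC p : fine (mu2 (C p `&` (S `*` A))) = s p.1 * a p.2.
  have -> : C p `&` (S `*` A) = (S `&` cell p.1) `*` (A `&` cell p.2).
    by apply/seteqP; split=> z /= [[? ?] [? ?]].
  have mSi : measurable (S `&` cell p.1) by apply: measurableI => //; exact: measurable_cell.
  have mAi : measurable (A `&` cell p.2) by apply: measurableI => //; exact: measurable_cell.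
  rewrite -[X in fine X]/(mu2 ((S `&` cell p.1) `*` (A `&` cell p.2))).
  rewrite [mu2 _]product_measure1E// fineM//; apply: fin_mu => // x [_]; exact: cell_sub.
have E : \int[mu2]_(z in S `*` A) (step_graphon R G z - cst_graphon u01 z) =
    \sum_i \sum_j Y i j * (s i * a j).
  rewrite (@int_cells _ _ _ _ _ mD finD _ C (fun p => Y p.1 p.2)).
  - rewrite pair_bigA /=; apply: eq_bigr => p _; rewrite -muC //.
  - split; first by apply: measurable_graphonB => //; exact: sub_unit_square.
    by exists 1 => z /(sub_unit_square SI AI); exact: graphonB_le1.
  - by move=> p; apply: measurableX; exact: measurable_cell.
  - move=> [i j] [i' j'] z [/= h1 h2] [/= h3 h4].
    by rewrite (cell_inj h1 h3) (cell_inj h2 h4).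
  - move=> [i j] z _ [/= h1 h2]; rewrite /= (step_fun_cell G h1 h2).
    by rewrite /Y adjb_config.
  rewrite (eq_bigr (fun p => s p.1 * a p.2)); last by move=> p _; exact: muC.
  rewrite -(pair_bigA _ (fun i j => s i * a j)) /=.
  under eq_bigr do rewrite -mulr_sumr.
  rewrite -mulr_suml !sum_mu_cell// -fineM; [|exact: fin_mu|exact: fin_mu].
  congr fine; rewrite -product_measure1E//.
have h := cut_le_four_cycles Y n_gt0 (fun i => small S i mS) (fun j => small A j mA).
rewrite -E in h.
rewrite dens_four_cycleE; apply: le_trans h.
rewrite -[leRHS]ger0_norm; last by rewrite exprn_even_ge0.
rewrite normrX lerXn2r// ?nnegrE//; exact: ltW.
Qed.

End StepGraphon.

(** * Convergence *)

Section Convergence.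
Variable R : realType.

Lemma cvg_le_inv (a : R^nat) (l C : R) :
  (forall n, (1 < n)%N -> `|a n - l| <= C / n%:R) -> a n @[n --> \oo] --> l.
Proof.
move=> aC; have C0 : 0 <= C.
  by have := le_trans (normr_ge0 _) (aC 2%N isT); rewrite pmulr_lge0// invr_gt0.
apply/cvgrPdist_le => e e0; near=> n.
have n1 : (1 < n)%N by near: n; exact: nbhs_infty_gt.
rewrite distrC; apply: (le_trans (aC n n1)).
rewrite ler_pdivrMr ?ltr0n ?(ltnW n1)// mulrC -ler_pdivrMr//.
by near: n; exact: nbhs_infty_ger.
Unshelve. all: by end_near. Qed.

End Convergence.

Section Main.
Variables (R : realType) (k : nat).
Variables (H : 'I_k.+1 -> {m : nat & sgraph m}) (beta : 'I_k.+1 -> R).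
Local Notation gamma := (influence_sum H beta).

Lemma Tfun_energy n (G : sgraph n) : (0 < n)%N ->
  Tfun H beta (step_graphon R G) = energy H beta (config_of G).
Proof. by move=> n0; apply: eq_bigr => i _; rewrite hom_density_step. Qed.

Lemma psi_free_energy n : (0 < n)%N -> psi H beta n = free_energy H beta n.
Proof.
move=> n0; rewrite /psi /free_energy /partition_function; congr (_ * ln _).
rewrite -(sum_config (fun x => expR (n%:R ^+ 2 * energy H beta x))).
by apply: eq_bigr => G _; rewrite Tfun_energy.
Qed.

Lemma law_gibbs n (G : sgraph n) : (0 < n)%N ->
  expR (n%:R ^+ 2 * (Tfun H beta (step_graphon R G) - psi H beta n)) =
  gibbs H beta (config_of G).
Proof.
move=> n0; rewrite psi_free_energy// Tfun_energy// /gibbs mulrBr expRD expRN.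
congr (_ / _); rewrite /free_energy mulrA mulfV ?mul1r.
  by rewrite lnK// posrE partition_function_gt0.
by rewrite expf_neq0// pnatr_eq0 -lt0n.
Qed.

Lemma expect_four_cycle u : gamma < 1 -> mean_field H beta u ->
  exists2 K, 0 <= K & forall n, (1 < n)%N ->
    expect (gibbs H beta (n := n)) (dens four_cycle u) <= K / n%:R.
Proof.
move=> g1 mf; have [K K0 hK] := free_energy_limit g1 mf.
have [/andP[u0 u1] _] := mf; have u01 : 0 <= u <= 1 by rewrite !ltW.
pose c := 4 * 4 * gamma / (1 - gamma).
have c0 : 0 <= c.
  apply: divr_ge0; last by rewrite subr_ge0 ltW.
  by apply: mulr_ge0; [lra|exact: influence_sum_ge0].
(* 32 = 2 * 4^2 accounts for the non-injective maps of the four vertices. *)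
exists (K + 4 * c + 32); first by lra.
move=> n n1; have n0 := ltnW n1.
have e : site n by exists (Ordinal n0, Ordinal n1).
have [_ hp] := hK n e n0.
have ai := @gibbs_almost_indep R k H beta n n0 4 e g1.
have pI : 0 <= edge_prob H beta e <= 1.
  by have /andP[? ?] := edge_prob_itv H beta e; rewrite !ltW.
have eps0 : 0 <= gibbs_eps H beta n 4 by exact: divr_ge0.
have := expect_dens n0 four_cycle_lt (gibbs_gt0 H beta (n := n)) (gibbs_sum1 H beta n) ai eps0 pI u01.
rewrite card_four_cycle => /(_ isT); rewrite ler_norml => /andP[_].
have -> : gibbs_eps H beta n 4 = c / n%:R by [].
set p := edge_prob H beta e in hp pI *.
have pu : (p - u) ^+ 4 <= K / n%:R.
  apply: le_trans hp; rewrite -[4%N]/(2 + 2)%N exprD ler_piMr ?sqr_ge0//.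
  by case/andP: pI => p0 p1; nra.
have -> : (K + 4 * c + 32) / n%:R = K / n%:R + 4%:R * (c / n%:R) + 2 * (4%:R ^+ 2 / n%:R) by ring.
lra.
Qed.

Section Law.
Variables (d : measure_display) (Omega : measurableType d) (P : probability Omega R).
Variables (n : nat) (X : Omega -> sgraph n).
Hypothesis HX : exp_random_graph H beta P X.
Hypothesis n_gt0 : (0 < n)%N.

(** Events need no measurability argument: they are finite unions of fibres of [X]. *)
Lemma law_event (A : pred (sgraph n)) :
  P [set w | A (X w)] = (\sum_(G | A G) gibbs H beta (config_of G))%:E.
Proof.
have -> : [set w | A (X w)] = \bigcup_(G in [set` enum A]) (X @^-1` [set G]).
  apply/seteqP; split=> w /=.
    by move=> Aw; exists (X w) => //=; rewrite mem_enum.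
  by move=> [G /=]; rewrite mem_enum => AG ->.
rewrite measure_fin_bigcup//; last by move=> G _; case: (HX G).
  rewrite -fsbig_seq ?enum_uniq// big_enum /= -sumEFin.
  by apply: eq_bigr => G _; rewrite (HX G).2 law_gibbs.
by move=> G G' _ _ [w [/= -> ->]].
Qed.

(** Markov's inequality, summed over graphs. *)
Lemma markov_four_cycle (f : sgraph n -> R) (u : R) (u01 : 0 <= u <= 1) (eps : R) : 0 < eps ->
  (forall G, `|f G| <= cut_dist (step_graphon R G) (cst_graphon u01)) ->
  exists r, [/\ P [set w | eps < `|f (X w)|] = r%:E, 0 <= r &
    r <= expect (gibbs H beta (n := n)) (dens four_cycle u) / eps ^+ 4].
Proof.
move=> eps0 hf; exists (\sum_(G | eps < `|f G|) gibbs H beta (config_of G)).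
have g0 G : 0 <= gibbs H beta (config_of G) by rewrite ltW// gibbs_gt0.
split; [exact: law_event|by apply: sumr_ge0|].
rewrite ler_pdivlMr ?exprn_gt0// /expect.
rewrite -(sum_config (fun x => gibbs H beta x * dens four_cycle u x)) mulr_suml.
rewrite [leRHS](bigID (fun G => eps < `|f G|))/=; apply: ler_wpDr.
  by apply: sumr_ge0 => G _; rewrite mulr_ge0// dens_four_cycle_ge0.
apply: ler_sum => G epsG; apply: ler_wpM2l => //.
apply: (cut_dist_step n_gt0 (u01 := u01) (ltW eps0)).
exact: lt_le_trans epsG (hf G).
Qed.

End Law.

(** Stated for any functional dominated by the cut distance to u, to serve both the
    distance to a given maximizer and the minimal distance to all of them. *)
Lemma cvg_prob_cut (d : nat -> measure_display) (Omega : forall n, measurableType (d n))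
  (P : forall n, probability (Omega n) R) (X : forall n, Omega n -> sgraph n)
  (HX : forall n, exp_random_graph H beta (P n) (X n))
  (u : R) (u01 : 0 <= u <= 1) (f : forall n, sgraph n -> R) :
  gamma < 1 -> mean_field H beta u ->
  (forall n (G : sgraph n), `|f n G| <= cut_dist (step_graphon R G) (cst_graphon u01)) ->
  cvg_prob_to0 P (fun n w => f n (X n w)).
Proof.
move=> g1 mf hf eps eps0; have [K K0 hK] := expect_four_cycle g1 mf.
have main n : (1 < n)%N -> exists r, [/\ P n [set w | eps < `|f n (X n w)|] = r%:E, 0 <= r &
    r <= K / eps ^+ 4 / n%:R].
  move=> n1; have [r [Pr r0 rK]] := markov_four_cycle (HX n) (ltnW n1) eps0 (hf n).
  exists r; split => //; apply: (le_trans rK).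
  rewrite [leRHS]mulrAC; apply: ler_wpM2r; first by rewrite invr_ge0 exprn_ge0// ltW.
  exact: hK.
apply: cvg_EFin.
  near=> n; have n1 : (1 < n)%N by near: n; exact: nbhs_infty_gt.
  by have [r [-> _ _]] := main n n1.
apply: (@cvg_le_inv _ _ _ (K / eps ^+ 4)) => n n1.
have [r [Pr r0 rK]] := main n n1.
by rewrite /= Pr /= subr0 ger0_norm.
Unshelve. all: by end_near. Qed.

Lemma delta_cut_ge0 (F G : Wtilde R) : 0 <= delta_cut F G.
Proof.
apply: lb_le_inf; first by eexists; exists (mp_id R); reflexivity.
by move=> _ [s ->]; exact: cut_dist_ge0.
Qed.

Lemma delta_cut_le (f : graphon R) (u : R) (u01 : 0 <= u <= 1) :
  delta_cut (tilde f) (tilde (cst_graphon u01)) <= cut_dist f (cst_graphon u01).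
Proof.
rewrite delta_cutE; apply: ge_inf.
  by exists 0 => _ [s ->]; exact: cut_dist_ge0.
by exists (mp_id R).
Qed.

End Main.

Theorem theorem6p2 (R : realType) (k : nat)
    (H : 'I_k.+1 -> {m : nat & sgraph m}) (beta : 'I_k.+1 -> R)
    (H1 : H ord0 = Tagged sgraph (complete_graph 2))
    (Hedge : forall i, (0 < eH H i)%N)
    (Hbeta : \sum_(i < k.+1 | i != ord0)
               `|beta i| * (eH H i)%:R * ((eH H i)%:R - 1) < 2)
    (d : nat -> measure_display) (Omega : forall n, measurableType (d n))
    (P : forall n, probability (Omega n) R)
    (X : forall n, Omega n -> sgraph n)
    (HX : forall n, exp_random_graph H beta (P n) (X n)) :
  [/\ (psi H beta n @[n --> \oo] -->
          sup [set ell H beta u | u in [set u : R | 0 <= u <= 1]]) /\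
       (forall h : graphon R,
          (forall g : graphon R,
             Tfun H beta g - entropy g <= Tfun H beta h - entropy h) ->
          exists2 u : R, ell_maximizers H beta u &
            {ae (@lebesgue_measure R \x @lebesgue_measure R)%E,
               forall z, unit_square R z -> h z = u}),
      (forall (u : R) (u01 : 0 <= u <= 1),
          ell_maximizers H beta = [set u] ->
          cvg_prob_to0 P (fun n w =>
            delta_cut (tilde (step_graphon R (X n w)))
                      (tilde (cst_graphon u01)))) &
      finite_set (ell_maximizers H beta) /\
      cvg_prob_to0 P (fun n w =>
        min_delta_cut H beta (tilde (step_graphon R (X n w))))].
Proof.
have e1 : eH H ord0 = 1%N.
  rewrite /eH H1 /num_edges /=.
  transitivity #|[set (@ord0 1, @ord_max 1)]%SET|; last by rewrite cards1.
  apply: eq_card => -[i j].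
  rewrite !inE /= xpair_eqE -!val_eqE /=.
  by case: i j => [[|[|i]] ?] [[|[|j]] ?].
have g1 : influence_sum H beta < 1.
  rewrite /influence_sum (bigD1 ord0)//= e1 subrr mulr0 add0r; lra.
have [u mf] := mean_field_exists H beta.
have [/andP[u0 u1] _] := mf; have u01 : 0 <= u <= 1 by rewrite !ltW.
have U := mean_field_maximizers g1 mf.
have umax : ell_maximizers H beta u by rewrite U.
split.
- split.
    have -> : sup [set ell H beta u | u in [set u : R | 0 <= u <= 1]] = ell H beta u.
      have ub : ubound [set ell H beta u | u in [set u : R | 0 <= u <= 1]] (ell H beta u).
        by move=> _ [v v01 <-]; case: umax => _; exact.
      apply/eqP; rewrite eq_le; apply/andP; split.
        by apply: ge_sup => //; exists (ell H beta u), u.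
      by apply: ub_le_sup; [exists (ell H beta u)|exists u].
    have [K K0 hK] := free_energy_limit g1 mf.
    apply: (@cvg_le_inv _ _ _ K) => n n1; have n0 := ltnW n1.
    have e : site n by exists (Ordinal n0, Ordinal n1).
    by rewrite psi_free_energy//; have [] := hK n e n0.
  by move=> h hmax; exists u => //; exact: graphon_maximizer mf hmax.
- move=> v v01; rewrite U => uv.
  have vu : v = u by have : [set v] v by []; rewrite -uv.
  move: v01; rewrite vu => v01.
  apply: (cvg_prob_cut HX (u01 := v01)
    (f := fun n G => delta_cut (tilde (step_graphon R G)) (tilde (cst_graphon v01)))) => // n G.
  by rewrite ger0_norm ?delta_cut_ge0// delta_cut_le.
split; first by rewrite U; exact: finite_set1.
apply: (cvg_prob_cut HX (u01 := u01)
    (f := fun n G => min_delta_cut H beta (tilde (step_graphon R G)))) => // n G.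
have lb : lbound [set r | exists u (u01 : 0 <= u <= 1),
    ell_maximizers H beta u /\ r = delta_cut (tilde (step_graphon R G)) (tilde (cst_graphon u01))] 0.
  by move=> _ [v [v01 [_ ->]]]; exact: delta_cut_ge0.
rewrite ger0_norm; last first.
  apply: lb_le_inf lb.
  by exists (delta_cut (tilde (step_graphon R G)) (tilde (cst_graphon u01))), u, u01.
apply: le_trans (delta_cut_le (step_graphon R G) u01).
by apply: ge_inf; [exists 0|exists u, u01].
Qed.
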